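(* Let $d\ge1$. For odd $n\ge3$ let $\mathbf{Y}=\mathbf{Y}^{(\mathbf{0})}$ be the smoothing process on $\mathbb{T}_n^d=(\mathbb{Z}/n\mathbb{Z})^d$ associated with simple random walk, started from unit mass at $\mathbf{0}$ and zero mass elsewhere, with energy functional $\mathcal{E}(t)$ and variance functional $\mathcal{V}(t)$. Let $\gamma^{(1)}_1=1-\cos(2\pi/n)$. There exist constants $\alpha_1,\alpha_2,\alpha_3>0$, $n_0\ge3$, $t_0>0$ (all depending on $d$) such that for all odd $n\ge n_0$ and all $t\ge t_0$, $$\frac{\alpha_1 n^{-d}}{t^{\frac d2+1}\wedge n^{d+2}}\exp\left(-2\gamma^{(1)}_1d^{-1}t\right)\le\mathbb{E}\,\mathcal{E}(t)\le\frac{\alpha_2 n^{-d}}{t^{\frac d2+1}\wedge n^{d+2}}\exp\left(-\left(2\gamma^{(1)}_1d^{-1}-\frac{\alpha_3}{n^{d+4}}\right)t\right),$$ $$\frac{\alpha_1 n^{-d}}{t^{\frac d2}\wedge n^{d}}\exp\left(-\left(2\gamma^{(1)}_1d^{-1}+\frac{\alpha_3}{n^{d+4}}\right)t\right)\le\mathbb{E}\,\mathcal{V}(t)\le\frac{\alpha_2 n^{-d}}{t^{\frac d2}\wedge n^{d}}\exp\left(-\left(2\gamma^{(1)}_1d^{-1}-\frac{\alpha_3}{n^{d+4}}\right)t\right).$$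
   Context: $a\wedge b=\min(a,b)$. Vertices $\mathbf{i},\mathbf{j}\in\mathbb{T}_n^d$ are neighbors ($\mathbf{i}\sim\mathbf{j}$) if they differ by $\pm1$ (mod $n$) in exactly one coordinate and agree in the others. Smoothing process on $\mathbb{T}_n^d$: each site carries a unit-intensity Poisson process (clock); all clocks are jointly independent and independent of $\mathbf{Y}(0)$. When the clock at $\mathbf{k}$ rings at time $t$, the value at $\mathbf{k}$ becomes $Y_{\mathbf{k}}(t)=\frac{1}{2d}\sum_{\mathbf{j}\sim\mathbf{k}}Y_{\mathbf{j}}(t-)$ and all other values remain unchanged. $\mathcal{E}(t)=\frac{1}{4dn^d}\sum_{\mathbf{i}\sim\mathbf{j}}(Y_{\mathbf{i}}(t)-Y_{\mathbf{j}}(t))^2$, with sum over ordered pairs of neighbors. $\mathcal{V}(t)=n^{-d}\sum_{\mathbf{i}\in\mathbb{T}_n^d}(Y_{\mathbf{i}}(t)-\overline{Y}(t))^2$ with $\overline{Y}(t)=n^{-d}\sum_{\mathbf{i}\in\mathbb{T}_n^d}Y_{\mathbf{i}}(t)$. *)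

(* Defs.v *)
From HB Require Import structures.
From mathcomp Require Import all_boot all_order all_algebra.
From mathcomp Require Import all_classical all_reals all_analysis.

Set Implicit Arguments.
Unset Strict Implicit.
Unset Printing Implicit Defensive.

Import Order.TTheory GRing.Theory Num.Theory.
Import numFieldNormedType.Exports.

Local Open Scope classical_set_scope.
Local Open Scope ring_scope.

(* 'Z_n is Z/nZ only for n >= 2; the torus is only used with n >= 3. *)
Definition torus (d n : nat) : finType := {ffun 'I_d -> 'Z_n}.

Definition origin (d n : nat) : torus d n := [ffun => 0].

Definition neighbors (d n : nat) (i j : torus d n) : bool :=
  [exists k : 'I_d, ((i k == j k + 1) || (i k == j k - 1)) &&
    [forall l : 'I_d, (l != k) ==> (i l == j l)]].

Section functionals.
Context {R : realType} {d n : nat}.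
Implicit Type y : torus d n -> R.

Definition neighbor_average y (k : torus d n) : R :=
  ((2 * d)%N%:R)^-1 * \sum_(j : torus d n | neighbors j k) y j.

Definition energy y : R :=
  (4 * d%:R * n%:R ^+ d)^-1 *
  \sum_(i : torus d n) \sum_(j : torus d n | neighbors i j) (y i - y j) ^+ 2.

Definition spatial_mean y : R := n%:R ^- d * \sum_(i : torus d n) y i.

Definition variance_functional y : R :=
  n%:R ^- d * \sum_(i : torus d n) (y i - spatial_mean y) ^+ 2.

End functionals.

Section processes.
Context {R : realType} {disp : measure_display} {Omega : measurableType disp}.
Variable P : probability Omega R.

Definition mutually_independent (I : finType) (G : I -> set (set Omega)) : Prop :=
  forall (J : {set I}) (A : I -> set Omega),
    (forall i, i \in J -> G i (A i)) ->
    P (\bigcap_(i in [set` J]) A i) = (\prod_(i in J) P (A i))%E.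

(* The sigma-algebra generated by the random variables X i, i in D. *)
Definition sigma_of {disp' : measure_display} {T : measurableType disp'}
    (I : Type) (D : set I) (X : I -> Omega -> T) : set (set Omega) :=
  <<s \bigcup_(i in D) preimage_set_system setT (X i) measurable >>.

(* Only the times t >= 0 are meaningful: N and Y below are unconstrained for
   negative times. Truncated subtraction on nat is harmless by monotonicity. *)
Record is_poisson_process (N : R -> Omega -> nat) : Prop := {
  poisson_measurable : forall t : R, 0 <= t -> measurable_fun setT (N t) ;
  poisson_start : forall w, N 0 w = 0%N ;
  poisson_nondecreasing : forall w (s t : R),
    0 <= s -> s <= t -> (N s w <= N t w)%N ;
  poisson_right_continuous : forall w (t : R), 0 <= t ->
    N s w @[s --> t^'+] --> N t w ;
  poisson_increment : forall s t : R, 0 <= s -> s < t -> forall k : nat,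
    P [set w | (N t w - N s w)%N = k] = (poisson_pmf (t - s) k)%:E ;
  poisson_independent_increments : forall (m : nat) (t : nat -> R),
    0 <= t 0%N -> (forall i, t i <= t i.+1) ->
    mutually_independent (fun i : 'I_m =>
      preimage_set_system setT
        (fun w => (N (t i.+1) w - N (t i) w)%N) measurable) }.

(* The counting path c jumps at time t. *)
Definition rings (c : R -> nat) (t : R) : Prop :=
  0 < t /\ forall s, 0 <= s -> s < t -> (c s < c t)%N.

(* N k t counts the rings of the clock at k up to time t. The evolution rule is
   imposed almost surely; ties between clocks have probability zero. *)
Record is_smoothing_process (d n : nat) (N : torus d n -> R -> Omega -> nat)
    (Y : R -> Omega -> torus d n -> R) : Prop := {
  clocks_poisson : forall k, is_poisson_process (N k) ;
  clocks_independent :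
    mutually_independent (fun o : option (torus d n) =>
      match o with
      | None => sigma_of setT (fun k w => Y 0 w k)
      | Some k => sigma_of [set t : R | 0 <= t] (N k)
      end) ;
  smoothing_measurable : forall (t : R) k, 0 <= t ->
    measurable_fun setT (fun w => Y t w k) ;
  smoothing_evolution : {ae P, forall w,
    (forall k t, rings (fun s => N k s w) t ->
       Y t w k = neighbor_average (fun j => lim (Y s w j @[s --> t^'-])) k) /\
    (forall k (s t : R), 0 <= s -> s <= t -> N k s w = N k t w ->
       Y t w k = Y s w k)} }.

Definition starts_from_unit_mass (d n : nat)
    (Y : R -> Omega -> torus d n -> R) : Prop :=
  forall w k, Y 0 w k = (k == origin d n)%:R.

End processes.

(* gamma_1^(1): the spectral gap of simple random walk on the n-cycle. *)
Definition cycle_gap {R : realType} (n : nat) : R := 1 - cos (2 * pi / n%:R).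

(* Main.v *)
Require Import Defs.
From HB Require Import structures.
From mathcomp Require Import all_boot all_order all_algebra.
From mathcomp Require Import all_classical all_reals all_analysis.
From mathcomp Require Import measurable_realfun.
From mathcomp Require Import ring lra zify.

Import Order.TTheory GRing.Theory Num.Theory.
Import numFieldNormedType.Exports.

Set Implicit Arguments.
Unset Strict Implicit.
Unset Printing Implicit Defensive.

Local Open Scope classical_set_scope.
Local Open Scope ring_scope.

(** The proof follows the expected power spectrum of the process.  For a
frequency [k], let [power y k] be the squared modulus of the Fourier
coefficient of [y] at [k], and [symbol k] the eigenvalue of minus the generator
of simple random walk.  A ring at [z] adds to the coefficient at [k] the
Laplacian of [y] at [z] times the character at [z].  When this is squared and
summed over [z], the cross terms assemble the Fourier coefficient of the
Laplacian, which is [- symbol k] times that of [y], and the square terms assemble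
the squared norm of the Laplacian, which is a spectral sum.  The average effect
of one ring is therefore linear in the power spectrum: a diagonal part plus the
same source for all frequencies ([sum_power_smooth]).  Energy and variance are
linear functionals of the power spectrum as well ([energy_power],
[variance_power]).

To turn this into a recursion in time, [0, t] is cut into [m] equal cells.  Up
to an event of probability O(1/m), every cell contains at most one ring,
and then the configuration at time [t] is a function of the word that records
which clock rings in which cell ([path_word]); the probability of a word is a
product over its letters ([prob_word_event]).  Summation over words gives
[spectrum], the recursion
[s_(j+1)(k) = (1 - 2 tau symbol k) s_j(k) + tau g_j], where [g_j] is the average
of [(symbol q)^2 s_j(q)] over all frequencies [q],
up to a normalising factor that tends to 1 ([iter_transfer_power]), and
[second_moment_bounds] sandwiches the true expectations; every estimate of the
recursion is uniform in [m], which then tends to infinity ([moment_limit]).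

Lower bounds.  The source is nonnegative, so that [s_j(k)] is at least
[(1 - 2 tau symbol k)^j], about [exp (- 2 t symbol k)].  It remains to bound a
heat-kernel sum from below ([modes_ge]): if [t] is at most [n^2], the frequencies
whose coordinates are all of order [n / sqrt t] suffice, and a single frequency
of smallest eigenvalue [lam1] suffices otherwise.

Upper bounds.  Duhamel expansion of the recursion shows that [g] solves a
renewal equation.  After division by [exp (- mu t)], where
[mu = 2 lam1 - a3 / n^(d+4)], its kernel is the average of
[(symbol k)^2 exp (- s (2 symbol k - mu))].  The total mass of this kernel is at
most 3/4 ([torus_kernel_mass]): since [symbol] has mean 1, the frequencies with
[symbol k >= 2 lam1] contribute little more than 1/2, and the [2 d] frequencies
with eigenvalue [lam1] contribute
[2 d n^(-d) lam1^2 n^(d+4) / a3], which is small for [a3] large.  This is the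
only reason for the correction of the exponential rate.  The kernel decays like
[min(t, n^2)^(-(d+4)/2)] ([torus_kernel_decay]), and a defective renewal equation
passes the decay of its kernel on to its solution ([renewal_bound],
[source_decay]).  Since [symbol] has mean 1, the energy [e] decreases exactly by
[tau g] at each step, and a combination of the variance and the energy decreases
by [2 tau e].  Two discrete integrations ([profile_drop], [tail_comparison])
thus convert the bound on [g] into bounds on [e] and on the variance, each at
the cost of one power of [min(t, n^2)]. *)

(** * Characters of the cyclic group *)

Section trigonometric_bounds.
Context {R : realType}.

Lemma sin_le_id (y : R) : 0 <= y -> sin y <= y.
Proof.
rewrite le_eqVlt => /predU1P[<-|y0]; first by rewrite sin0.
have [c _] := @MVT R sin cos 0 y y0 (fun x _ => is_derive_sin x)
  (continuous_subspaceT (@continuous_sin R)).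
rewrite sin0 !subr0 => ->; rewrite ler_piMl ?cos_le1// ltW//.
Qed.

(** The slope [cos 1 / 2] is not optimal: it comes from the mean value theorem on
[0, 1] and monotonicity of [sin] on [1, pi / 2], where [y / 2 <= 1]. *)
Lemma sin_ge_linear (y : R) : 0 <= y -> y <= pi / 2 -> cos 1 / 2 * y <= sin y.
Proof.
have c1 : 0 < cos 1 :> R := cos1_gt0 R.
have p2 : pi / 2 < 2 :> R := pihalf_lt2 R.
have p1 : 1 <= pi / 2 :> R := pihalf_ge1 R.
have key (z : R) : 0 <= z -> z <= 1 -> cos 1 * z <= sin z.
  rewrite le_eqVlt => /predU1P[<-|z0] z1; first by rewrite sin0 mulr0.
  have [c] := @MVT R sin cos 0 z z0 (fun x _ => is_derive_sin x)
    (continuous_subspaceT (@continuous_sin R)).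
  rewrite in_itv/= sin0 !subr0 => /andP[c0 cz] ->; rewrite ler_pM2r//.
  have := @ltr_cos R c 1; rewrite !in_itv/= => H.
  by rewrite ltW// H ?(lt_le_trans cz z1)//; lra.
move=> y0 yp; have [y1|y1] := leP y 1.
  by apply: le_trans (key y y0 y1); nra.
have := @ltr_sin R 1 y; rewrite !in_itv/= => H.
have s1 : sin 1 <= sin y by rewrite ltW// H//; lra.
by have := key 1 ler01 (lexx _); nra.
Qed.

Lemma one_sub_cos (x : R) : 1 - cos (x *+ 2) = 2 * sin x ^+ 2.
Proof. by rewrite cos_mulr2n sin2cos2; ring. Qed.

End trigonometric_bounds.

Section cyclic_group.
Context {n : nat}.
Hypothesis n3 : (2 < n)%N.
Implicit Types x y z : 'Z_n.

Let nZ : (Zp_trunc n).+2 = n. Proof. by rewrite Zp_cast//; lia. Qed.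

Lemma ltn_Zn z : (val z < n)%N.
Proof. by rewrite -[X in (_ < X)%N]nZ ltn_ord. Qed.

Lemma val_ZnD x y : val (x + y) = ((val x + val y) %% n)%N.
Proof. by transitivity ((val x + val y) %% (Zp_trunc n).+2)%N => //; congr modn. Qed.

Lemma val_Zn_opp z : z != 0 -> val (- z) = (n - val z)%N.
Proof.
move=> z0; have vz : (0 < val z)%N by rewrite lt0n -(inj_eq val_inj) in z0 *.
have lz := ltn_Zn z.
have -> : val (- z) = (((Zp_trunc n).+2 - val z) %% (Zp_trunc n).+2)%N by [].
by move: (val z) vz lz => a va la; rewrite nZ modn_small //; lia.
Qed.

(** The graph distance to 0 in the [n]-cycle. *)
Definition cycle_norm z : nat := minn (val z) (n - val z).

End cyclic_group.

Section characters.
Context {R : realType} {n : nat}.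
Hypothesis n3 : (2 < n)%N.
Implicit Types x y z : 'Z_n.

Let n0 : n%:R != 0 :> R. Proof. by rewrite pnatr_eq0; lia. Qed.

Definition cos_char z : R := cos (2 * pi * (val z)%:R / n%:R).
Definition sin_char z : R := sin (2 * pi * (val z)%:R / n%:R).

Lemma turn_mod (f : R -> R) (a : nat) : periodic f (pi *+ 2) ->
  f (2 * pi * (a %% n)%:R / n%:R) = f (2 * pi * a%:R / n%:R).
Proof.
move=> fP; rewrite [in RHS](divn_eq a n).
have -> : 2 * pi * (a %/ n * n + a %% n)%:R / n%:R =
   2 * pi * (a %% n)%:R / n%:R + (pi *+ 2) *+ (a %/ n) :> R.
  rewrite natrD natrM -(mulr_natr (pi *+ 2)) -(mulr_natr pi 2).
  by field.
by rewrite (periodicn fP).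
Qed.

Lemma angleD x y : (2 * pi * ((val x + val y)%N)%:R / n%:R : R) =
  2 * pi * (val x)%:R / n%:R + 2 * pi * (val y)%:R / n%:R.
Proof. by rewrite natrD mulrDr mulrDl. Qed.

Lemma cos_charD x y :
  cos_char (x + y) = cos_char x * cos_char y - sin_char x * sin_char y.
Proof.
by rewrite /cos_char /sin_char -cosD -angleD (val_ZnD n3) (turn_mod _ (@cosD2pi R)).
Qed.

Lemma sin_charD x y :
  sin_char (x + y) = sin_char x * cos_char y + cos_char x * sin_char y.
Proof.
by rewrite /cos_char /sin_char -sinD -angleD (val_ZnD n3) (turn_mod _ (@sinD2pi R)).
Qed.

Lemma cos_char0 : cos_char 0 = 1.
Proof. by rewrite /cos_char /= mulr0 mul0r cos0. Qed.

Lemma sin_char0 : sin_char 0 = 0.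
Proof. by rewrite /sin_char /= mulr0 mul0r sin0. Qed.

Lemma cos2Dsin2_char z : cos_char z ^+ 2 + sin_char z ^+ 2 = 1.
Proof. exact: cos2Dsin2. Qed.

Lemma char_opp z : cos_char (- z) = cos_char z /\ sin_char (- z) = - sin_char z.
Proof.
have := cos_charD z (- z); have := sin_charD z (- z).
rewrite subrr cos_char0 sin_char0; have := cos2Dsin2_char z.
set a := cos_char z; set b := sin_char z; set a' := cos_char _.
set b' := sin_char _ => h1 h2 h3; split.
  transitivity (a * (a * a' - b * b') + b * (b * a' + a * b')).
    by rewrite -[LHS]mul1r -h1; ring.
  by rewrite -h2 -h3; ring.
transitivity (a * (b * a' + a * b') - b * (a * a' - b * b')).
  by rewrite -[LHS]mul1r -h1; ring.
by rewrite -h2 -h3; ring.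
Qed.

(** Characters are eigenfunctions of the sum over the two neighbours.  Stated for
the real and imaginary parts separately, the same identity holds for both,
so that a single argument treats cosine and sine coefficients. *)
Lemma cos_char_add_sub x z :
  cos_char (x + z) + cos_char (x - z) = 2 * cos_char z * cos_char x.
Proof. by rewrite !cos_charD; have [-> ->] := char_opp z; ring. Qed.

Lemma sin_char_add_sub x z :
  sin_char (x + z) + sin_char (x - z) = 2 * cos_char z * sin_char x.
Proof. by rewrite !sin_charD; have [-> ->] := char_opp z; ring. Qed.

Lemma cos_char_le1 z : cos_char z <= 1. Proof. exact: cos_le1. Qed.

(** The half-angle form is symmetric in [z] and [- z], and its argument stays in
[0, pi / 2], where [sin] is comparable to the identity. *)
Lemma one_sub_cos_charE z : 1 - cos_char z =
  2 * sin (pi * (cycle_norm z)%:R / n%:R) ^+ 2.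
Proof.
rewrite -one_sub_cos; congr (1 - _).
have [->|z0] := eqVneq z 0.
  by rewrite cos_char0 /cycle_norm /= min0n mulr0 mul0r mul0rn cos0.
have lz := ltn_Zn n3 z.
rewrite /cycle_norm /minn; case: ifP => _.
  by rewrite /cos_char; congr cos; rewrite -mulr_natr; ring.
have [<- _] := char_opp z; rewrite /cos_char (val_Zn_opp n3)//.
by congr cos; rewrite -mulr_natr; ring.
Qed.

Let npos : 0 < n%:R :> R. Proof. by rewrite ltr0n; lia. Qed.

Lemma cycle_norm_angle z : 0 <= pi * (cycle_norm z)%:R / n%:R :> R /\
  pi * (cycle_norm z)%:R / n%:R <= pi / 2 :> R.
Proof.
split; first by rewrite divr_ge0 ?mulr_ge0 ?pi_ge0.
rewrite ler_pdivrMr// -[leRHS]mulrA ler_pM2l ?pi_gt0//.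
have lz := ltn_Zn n3 z.
rewrite mulrC ler_pdivlMr// -natrM ler_nat /cycle_norm; lia.
Qed.

Lemma one_sub_cos_char_le z :
  1 - cos_char z <= 32 * ((cycle_norm z)%:R / n%:R) ^+ 2.
Proof.
rewrite one_sub_cos_charE; have [t0 t1] := cycle_norm_angle z.
have p2 : pi < 4 :> R by have := pihalf_lt2 R; lra.
have := sin_le_id t0; have : 0 <= sin (pi * (cycle_norm z)%:R / n%:R) :> R.
  by apply: sin_ge0_pi; rewrite t0/=; have := pi_ge0 R; lra.
rewrite -mulrA; set s := sin _; set x := _%:R / _ => s0 s1.
have x0 : 0 <= x by rewrite divr_ge0.
have : s <= 4 * x by apply: le_trans s1 _; rewrite ler_wpM2r// ltW.
move=> s4; have : s ^+ 2 <= (4 * x) ^+ 2.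
  by rewrite lerXn2r// nnegrE// mulr_ge0.
by rewrite exprMn; lra.
Qed.

Lemma one_sub_cos_char_ge z :
  2 * cos 1 ^+ 2 * ((cycle_norm z)%:R / n%:R) ^+ 2 <= 1 - cos_char z.
Proof.
rewrite one_sub_cos_charE; have [t0 t1] := cycle_norm_angle z.
have p2 : 2 <= pi :> R := pi_ge2 R.
have c1 : 0 < cos 1 :> R := cos1_gt0 R.
have := sin_ge_linear t0 t1; rewrite -mulrA.
set s := sin _; set x := _%:R / _ => s1.
have x0 : 0 <= x by rewrite divr_ge0.
have : cos 1 * x <= s.
  by apply: le_trans s1; rewrite -mulrA ler_pM2l// mulrA ler_peMl//; lra.
move=> s2; have : (cos 1 * x) ^+ 2 <= s ^+ 2.
  by rewrite lerXn2r ?nnegrE ?mulr_ge0//; [exact: ltW|apply: le_trans s2; rewrite mulr_ge0// ltW].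
rewrite exprMn; lra.
Qed.

Lemma cos_char_lt1 z : z != 0 -> cos_char z < 1.
Proof.
move=> z0; rewrite -subr_gt0; apply: lt_le_trans (one_sub_cos_char_ge z).
have vz : (0 < val z)%N by rewrite lt0n -(inj_eq val_inj) in z0 *.
have lz := ltn_Zn n3 z.
have c0 : (0 < cycle_norm z)%N by rewrite /cycle_norm; lia.
apply: mulr_gt0; last by apply/exprn_gt0/divr_gt0 => //; rewrite ltr0n.
by apply: mulr_gt0 => //; exact/exprn_gt0/cos1_gt0.
Qed.

End characters.

(** * Fourier analysis on the torus *)

Section torus_fourier.
Context {R : realType} {d n : nat}.
Hypothesis n3 : (2 < n)%N.
Implicit Types (x z k : torus d n) (y : torus d n -> R) (l : 'I_d) (a : 'Z_n).

Definition coord_shift l a x : torus d n := [ffun i => x i + (if i == l then a else 0)].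

Definition dot k x : 'Z_n := \sum_l k l * x l.

Lemma torusP x z : (forall i, x i = z i) -> x = z.
Proof. by move=> xz; apply/ffunP. Qed.

Lemma coord_shiftK l a : cancel (coord_shift l a) (coord_shift l (- a)).
Proof.
move=> x; apply/ffunP => i; rewrite !ffunE -addrA.
by case: eqP => _; rewrite ?subrr !addr0.
Qed.

Lemma coord_shiftNK l a : cancel (coord_shift l (- a)) (coord_shift l a).
Proof. by move=> x; rewrite -{1}(opprK a) coord_shiftK. Qed.

Lemma coord_shift_bij l a : bijective (coord_shift l a).
Proof. exact: Bijective (coord_shiftK l a) (coord_shiftNK l a). Qed.

Lemma dot_shiftl l a k x : dot (coord_shift l a k) x = dot k x + a * x l.
Proof.
transitivity (\sum_i (k i * x i + (if i == l then a * x l else 0))).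
  apply: eq_bigr => i _; rewrite ffunE mulrDl; congr (_ + _).
  by case: eqP => [->//|_]; rewrite mul0r.
by rewrite big_split/= -big_mkcond big_pred1_eq.
Qed.

Lemma dotC k x : dot k x = dot x k.
Proof. by apply: eq_bigr => i _; rewrite mulrC. Qed.

Lemma dot_shiftr l a k x : dot k (coord_shift l a x) = dot k x + k l * a.
Proof. by rewrite dotC dot_shiftl dotC mulrC. Qed.

Lemma dot0 k : dot k (origin d n) = 0.
Proof. by apply: big1 => i _; rewrite ffunE mulr0. Qed.

Lemma card_torus : #|torus d n| = (n ^ d)%N.
Proof. by rewrite card_ffun !card_ord Zp_cast//; lia. Qed.

Let two_neq0 : 1 + 1 != 0 :> 'Z_n.
Proof.
apply/eqP => /(congr1 val); rewrite (val_ZnD n3) /= => /eqP.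
by rewrite -[_ == _]/(n %| 2)%N => /dvdn_leq; lia.
Qed.

Definition unit_step (b : bool) : 'Z_n := if b then 1 else -1.

Lemma unit_step_inj : injective unit_step.
Proof.
have h : (1 == -1 :> 'Z_n) = false.
  by apply/negbTE; rewrite -subr_eq0 opprK two_neq0.
case; case => // /eqP; rewrite /unit_step ?h //.
by rewrite eq_sym h.
Qed.

(** For [n >= 3] the [2 d] signed unit steps from [x] are pairwise distinct, so that
the sum over neighbours has no collisions. *)
Lemma neighbor_sum y x : \sum_(z : torus d n | neighbors z x) y z =
  \sum_l (y (coord_shift l 1 x) + y (coord_shift l (-1) x)).
Proof.
pose h (p : 'I_d * bool) := coord_shift p.1 (unit_step p.2) x.
have u0 b : unit_step b != 0 by case: b => //=; rewrite oppr_eq0.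
have hi : injective h.
  move=> [l b] [l' b'] /ffunP /= H.
  have ll : l = l'.
    have := H l; rewrite !ffunE eqxx => /addrI.
    by case: eqP => // _ /eqP; rewrite (negbTE (u0 b)).
  rewrite -{}ll in H *; congr pair; have := H l; rewrite !ffunE eqxx => /addrI.
  exact: unit_step_inj.
have -> : \sum_(z : torus d n | neighbors z x) y z =
    \sum_(z in h @: predT) y z.
  apply: eq_bigl => z; apply/idP/imsetP.
    case/existsP => l /andP[zl /forallP zo].
    have [b zb] : exists b, z l = x l + unit_step b.
      by case/orP: zl => /eqP ->; [exists true|exists false].
    exists (l, b) => //; rewrite /h /=; apply: torusP => i; rewrite ffunE.
    case: eqP => [->//|/eqP il]; rewrite addr0; apply/eqP.
    exact: (implyP (zo i)).
  case=> [[l b] _ ->]; apply/existsP; exists l; rewrite !ffunE eqxx /=.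
  apply/andP; split; first by case: b => /=; rewrite eqxx ?orbT.
  by apply/forallP => i; apply/implyP => il; rewrite ffunE (negbTE il) addr0.
rewrite big_imset /=; last by move=> ? ? _ _; exact: hi.
rewrite -(pair_bigA _ (fun l b => y (h (l, b)))) /=.
by apply: eq_bigr => l _; rewrite big_bool.
Qed.

(** The eigenvalue at frequency [k] of minus the generator of simple random walk. *)
Definition symbol k : R := 1 - d%:R^-1 * \sum_l cos_char (k l).

Definition cos_coef y k : R := \sum_x y x * cos_char (dot k x).
Definition sin_coef y k : R := \sum_x y x * sin_char (dot k x).
Definition power y k : R := cos_coef y k ^+ 2 + sin_coef y k ^+ 2.

(** If [z l <> 0], shifting the frequency by [1] and by [-1] in the coordinate [l]
leaves the sum [S] unchanged, while the two shifted sums add up to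
[2 cos_char (z l) S]; as [cos_char (z l) < 1], this forces [S = 0]. *)
Lemma sum_cos_char z : \sum_k cos_char (dot k z) = ((z == origin d n) * n ^ d)%N%:R :> R.
Proof.
have [->|/eqP z0] := eqVneq z (origin d n).
  under eq_bigr do rewrite dot0 cos_char0.
  by rewrite sumr_const card_torus mul1n.
have [l zl] : exists l, z l != 0.
  apply/existsP; apply: contra_notT z0; rewrite negb_exists => /forallP z0.
  by apply/ffunP => i; rewrite ffunE; apply/eqP; rewrite -[_ == _]negbK.
rewrite mul0n; set S := (LHS).
(* invariance of the sum under translation of the frequency *)
have sh a : S = \sum_k cos_char (dot k z + a * z l).
  rewrite /S (reindex (coord_shift l a)) /=; last exact: onW_bij (coord_shift_bij l a).
  by apply: eq_bigr => k _; rewrite dot_shiftl.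
have : S + S = 2 * cos_char (z l) * S.
  rewrite {1}(sh 1) {1}(sh (-1)) -big_split /= mulr_sumr.
  apply: eq_bigr => k _; rewrite mul1r mulN1r; exact: cos_char_add_sub.
have := @cos_char_lt1 R n n3 (z l) zl => c1 SS.
have : (1 - cos_char (z l)) * S = 0 by lra.
by move/eqP; rewrite mulf_eq0 => /orP[/eqP|/eqP//]; lra.
Qed.

Lemma parseval (y y' : torus d n -> R) :
  \sum_k (cos_coef y k * cos_coef y' k + sin_coef y k * sin_coef y' k) =
  (n ^ d)%:R * \sum_x y x * y' x.
Proof.
transitivity (\sum_k \sum_x \sum_z y x * y' z *
    cos_char (dot k [ffun i => x i - z i])).
  apply: eq_bigr => k _; rewrite !mulr_suml -big_split; apply: eq_bigr => x _ /=.
  rewrite !mulr_sumr -big_split; apply: eq_bigr => z _ /=.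
  have -> : dot k [ffun i => x i - z i] = dot k x + - dot k z.
    rewrite -sumrB; apply: eq_bigr => i _; rewrite ffunE; ring.
  by rewrite cos_charD//; have [-> ->] := @char_opp R n n3 (dot k z); ring.
rewrite exchange_big mulr_sumr; apply: eq_bigr => x _ /=.
rewrite exchange_big (bigD1 x) //= [X in _ + X]big1 ?addr0; last first.
  move=> z zx; rewrite -mulr_sumr sum_cos_char; case: eqP; last by rewrite mulr0.
  move/ffunP => xz; case/eqP: zx; apply/ffunP => i.
  by have := xz i; rewrite !ffunE => /eqP; rewrite subr_eq0 => /eqP.
rewrite -mulr_sumr sum_cos_char [X in X == _](_ : _ = origin d n) ?eqxx ?mul1n.
  by ring.
by apply/ffunP => i; rewrite !ffunE subrr.
Qed.

Hypothesis d1 : (1 <= d)%N.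

Let d0 : d%:R != 0 :> R. Proof. by rewrite pnatr_eq0; lia. Qed.

Lemma coef_neighbor_average y k :
  cos_coef (neighbor_average y) k = (1 - symbol k) * cos_coef y k /\
  sin_coef (neighbor_average y) k = (1 - symbol k) * sin_coef y k.
Proof.
have gen (chi : 'Z_n -> R) :
   (forall u v, chi (u + v) + chi (u - v) = 2 * cos_char v * chi u) ->
   \sum_x neighbor_average y x * chi (dot k x) =
   (1 - symbol k) * \sum_x y x * chi (dot k x).
  move=> chiP; transitivity (\sum_x \sum_l (2 * d)%N%:R^-1 *
      (y (coord_shift l 1 x) * chi (dot k x) + y (coord_shift l (-1) x) * chi (dot k x))).
    apply: eq_bigr => x _; rewrite /neighbor_average neighbor_sum -mulrA.
    by rewrite mulr_suml mulr_sumr; apply: eq_bigr => l _; rewrite mulrDl.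
  rewrite exchange_big /= /symbol opprB addrCA subrr addr0 -[RHS]mulrA.
  rewrite mulr_suml [RHS]mulr_sumr.
  apply: eq_bigr => l _; rewrite -mulr_sumr big_split /=.
  rewrite (reindex (coord_shift l (-1))) /=; last exact: onW_bij (coord_shift_bij _ _).
  rewrite [X in _ + X](reindex (coord_shift l 1)) /=; last exact: onW_bij (coord_shift_bij _ _).
  rewrite -big_split /= !mulr_sumr; apply: eq_bigr => x _.
  rewrite coord_shiftNK coord_shiftK.
  rewrite -mulrDr !dot_shiftr mulr1 mulrN1 [X in y x * X]addrC chiP.
  by rewrite natrM; field.
split; apply: gen => u v; [exact: cos_char_add_sub|exact: sin_char_add_sub].
Qed.

End torus_fourier.

(** * Effect of one ring on the power spectrum *)

Section smoothing_step.
Context {R : realType} {d n : nat}.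
Hypothesis n3 : (2 < n)%N.
Hypothesis d1 : (1 <= d)%N.
Implicit Types (x z k : torus d n) (y : torus d n -> R).

Let K : R := (n ^ d)%:R.

Let d0 : d%:R != 0 :> R. Proof. by rewrite pnatr_eq0; lia. Qed.
Let K0 : K != 0. Proof. by rewrite pnatr_eq0 expn_eq0; lia. Qed.

Definition smooth z y x : R := if x == z then neighbor_average y z else y x.

(** A ring perturbs the configuration at one site only, hence moves each
coefficient along the character of that site. *)
Lemma coef_smooth z y k :
  cos_coef (smooth z y) k =
    cos_coef y k + (neighbor_average y z - y z) * cos_char (dot k z) /\
  sin_coef (smooth z y) k =
    sin_coef y k + (neighbor_average y z - y z) * sin_char (dot k z).
Proof.
have gen (chi : 'Z_n -> R) : \sum_x smooth z y x * chi (dot k x) =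
    \sum_x y x * chi (dot k x) + (neighbor_average y z - y z) * chi (dot k z).
  rewrite (bigD1 z) //= [in RHS](bigD1 z) //= /smooth eqxx.
  have -> : \sum_(x | x != z) (if x == z then neighbor_average y z else y x)
     * chi (dot k x) = \sum_(x | x != z) y x * chi (dot k x).
    by apply: eq_bigr => x /negbTE ->.
  by ring.
by split; exact: gen.
Qed.

Lemma coef_laplacian y k :
  cos_coef (fun x => neighbor_average y x - y x) k = - symbol k * cos_coef y k /\
  sin_coef (fun x => neighbor_average y x - y x) k = - symbol k * sin_coef y k.
Proof.
have [hc hs] := coef_neighbor_average n3 d1 y k.
split.
  transitivity (cos_coef (neighbor_average y) k - cos_coef y k).
    by rewrite -sumrB; apply: eq_bigr => x _; rewrite mulrBl.
  by rewrite hc; ring.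
transitivity (sin_coef (neighbor_average y) k - sin_coef y k).
  by rewrite -sumrB; apply: eq_bigr => x _; rewrite mulrBl.
by rewrite hs; ring.
Qed.

Lemma parseval_sqr y : \sum_k power y k = K * \sum_x y x ^+ 2.
Proof.
have -> : \sum_x y x ^+ 2 = \sum_x y x * y x by apply: eq_bigr => x _; rewrite expr2.
by rewrite -(parseval n3 y y); apply: eq_bigr => k _; rewrite /power !expr2.
Qed.

(** With [D] the discrete Laplacian of [y], the squared coefficients of
[smooth z y] have cross terms that sum over [z] to the coefficients of [D],
that is [- symbol k] times those of [y], and square terms that sum to the squared
norm of [D], a spectral sum by Parseval. *)
Lemma sum_power_smooth y k : \sum_z power (smooth z y) k =
  (K - 2 * symbol k) * power y k + K^-1 * \sum_q symbol q ^+ 2 * power y q.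
Proof.
pose D x := neighbor_average y x - y x.
transitivity (\sum_z (power y k + 2 * (cos_coef y k * (D z * cos_char (dot k z))
   + sin_coef y k * (D z * sin_char (dot k z))) + D z ^+ 2)).
  apply: eq_bigr => z _; rewrite /power.
  have [-> ->] := coef_smooth z y k; rewrite -/(D z).
  have <- : D z ^+ 2 * (cos_char (dot k z) ^+ 2 + sin_char (dot k z) ^+ 2) = D z ^+ 2.
    by rewrite cos2Dsin2_char mulr1.
  ring.
have [hc hs] := coef_laplacian y k.
have -> : \sum_z (power y k + 2 * (cos_coef y k * (D z * cos_char (dot k z))
   + sin_coef y k * (D z * sin_char (dot k z))) + D z ^+ 2) =
   K * power y k + 2 * (cos_coef y k * cos_coef D k + sin_coef y k * sin_coef D k)
   + \sum_z D z ^+ 2.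
  rewrite 2!big_split /= sumr_const card_torus// -[power y k *+ _]mulr_natl.
  congr (_ + _ + _); rewrite {2}/cos_coef {2}/sin_coef !mulr_sumr -big_split /=.
  by rewrite mulr_sumr.
rewrite hc hs.
have -> : \sum_i D i ^+ 2 = K^-1 * \sum_q symbol q ^+ 2 * power y q.
  apply: (mulfI K0); rewrite -parseval_sqr mulVKf//; apply: eq_bigr => q _.
  by rewrite {1}/power; have [-> ->] := coef_laplacian y q; rewrite /power; ring.
by rewrite -mulr_natl -/K /power; ring.
Qed.

Lemma neighbors_sym x z : neighbors x z = neighbors z x.
Proof.
have half u v : neighbors u v -> neighbors v u :> bool.
  case/existsP => l /andP[h /forallP o]; apply/existsP; exists l.
  apply/andP; split.
    by case/orP: h => /eqP ->; rewrite ?addrK ?subrK eqxx ?orbT.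
  by apply/forallP => i; have := o i; rewrite [u i == v i]eq_sym.
by apply/idP/idP; exact: half.
Qed.

(** Summation by parts: the energy is the Dirichlet form of [y], and [symbol]
diagonalises the Laplacian. *)
Lemma energy_power y : energy y = K ^- 2 * \sum_k symbol k * power y k.
Proof.
have -> : \sum_k symbol k * power y k =
    K * \sum_x y x * (y x - neighbor_average y x).
  rewrite -(parseval n3 y (fun x => y x - neighbor_average y x)); apply: eq_bigr => k _.
  have -> : cos_coef (fun x => y x - neighbor_average y x) k = symbol k * cos_coef y k.
    rewrite -[LHS]opprK -[RHS]opprK -[in RHS]mulNr.
    have [<- _] := coef_laplacian y k; congr (- _).
    by rewrite -sumrN; apply: eq_bigr => x _; rewrite -mulNr opprB.
  have -> : sin_coef (fun x => y x - neighbor_average y x) k = symbol k * sin_coef y k.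
    rewrite -[LHS]opprK -[RHS]opprK -[in RHS]mulNr.
    have [_ <-] := coef_laplacian y k; congr (- _).
    by rewrite -sumrN; apply: eq_bigr => x _; rewrite -mulNr opprB.
  by rewrite /power; ring.
have nb x : \sum_(j : torus d n | neighbors x j) (y x - y j) ^+ 2 =
    2 * d%:R * y x ^+ 2 - 4 * d%:R * (y x * neighbor_average y x)
    + \sum_l (y (coord_shift l 1 x) ^+ 2 + y (coord_shift l (-1) x) ^+ 2).
  under eq_bigl do rewrite neighbors_sym.
  rewrite (neighbor_sum n3 (fun j => (y x - y j) ^+ 2)) /neighbor_average.
  rewrite (neighbor_sum n3) natrM.
  have -> : 4 * d%:R * (y x * ((2 * d%:R)^-1 * \sum_l (y (coord_shift l 1 x) + y (coord_shift l (-1) x))))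
     = \sum_l 2 * y x * (y (coord_shift l 1 x) + y (coord_shift l (-1) x)).
    by rewrite -mulr_sumr; set S := \sum_l _; field.
  have -> : 2 * d%:R * y x ^+ 2 = \sum_(l < d) 2 * y x ^+ 2.
    by rewrite sumr_const card_ord -mulr_natl; ring.
  by rewrite -sumrB -big_split /=; apply: eq_bigr => l _; ring.
rewrite /energy (eq_bigr _ (fun x _ => nb x)) big_split /= sumrB.
have -> : \sum_x \sum_l (y (coord_shift l 1 x) ^+ 2 + y (coord_shift l (-1) x) ^+ 2) =
    2 * d%:R * \sum_x y x ^+ 2.
  rewrite exchange_big /=.
  transitivity (\sum_(l < d) 2 * \sum_x y x ^+ 2); last first.
    by rewrite sumr_const card_ord -mulr_natl; ring.
  apply: eq_bigr => l _; rewrite big_split /=.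
  have sh a : \sum_x y (coord_shift l a x) ^+ 2 = \sum_x y x ^+ 2.
    by rewrite [RHS](reindex (coord_shift l a))//; exact: onW_bij (coord_shift_bij l a).
  by rewrite !sh; ring.
rewrite -!mulr_sumr -natrX -/K.
have -> : \sum_x y x * (y x - neighbor_average y x) =
    \sum_x y x ^+ 2 - \sum_x y x * neighbor_average y x.
  by rewrite -sumrB; apply: eq_bigr => x _; ring.
by set S := \sum_x _ ^+ 2; set S' := \sum_x _ * _; field; rewrite d0 K0.
Qed.

(** The zero mode carries exactly the squared mean, which the variance
subtracts from the second moment. *)
Lemma variance_power y : variance_functional y =
  K ^- 2 * \sum_(k | k != origin d n) power y k.
Proof.
have p0 : power y (origin d n) = (\sum_x y x) ^+ 2.
  rewrite /power /cos_coef /sin_coef.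
  under eq_bigr do rewrite dotC dot0 cos_char0 mulr1.
  under [X in _ + X ^+ 2]eq_bigr do rewrite dotC dot0 sin_char0 mulr0.
  by rewrite [X in _ + X ^+ 2]big1// expr0n addr0.
have := parseval_sqr y; rewrite (bigD1 (origin d n)) //= p0 => pE.
have -> : \sum_(k | k != origin d n) power y k =
    K * \sum_x y x ^+ 2 - (\sum_x y x) ^+ 2.
  by rewrite -pE addrC addrK.
rewrite /variance_functional.
have -> : \sum_i (y i - spatial_mean y) ^+ 2 =
    \sum_x y x ^+ 2 - 2 * spatial_mean y * \sum_x y x + K * spatial_mean y ^+ 2.
  transitivity (\sum_x (y x ^+ 2 - 2 * spatial_mean y * y x + spatial_mean y ^+ 2)).
    by apply: eq_bigr => x _; ring.
  by rewrite big_split /= sumrB -mulr_sumr sumr_const card_torus// -[_ ^+ 2 *+ _]mulr_natl.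
rewrite /spatial_mean -!natrX -/K.
by set S := \sum_x _ ^+ 2; set S' := \sum_x _; field.
Qed.

End smoothing_step.

(** * Renewal inequalities and decay profiles *)

Section renewal.
Context {R : realType}.

Lemma convolution_sum_le (q G : nat -> R) (J : nat) :
  (forall i, 0 <= q i) -> (forall i, 0 <= G i) ->
  \sum_(j < J) \sum_(i < j) q (j - i.+1)%N * G i <=
  (\sum_(l < J) q l) * \sum_(i < J) G i.
Proof.
move=> q0 G0.
have -> : \sum_(j < J) \sum_(i < j) q (j - i.+1)%N * G i =
    \sum_(i < J) \sum_(j < J | (i < j)%N) q (j - i.+1)%N * G i.
  transitivity (\sum_(j < J) \sum_(i < J | (i < j)%N) q (j - i.+1)%N * G i).
    apply: eq_bigr => j _.
    exact: (big_ord_widen J (fun i => q (j - i.+1)%N * G i) (ltnW (ltn_ord j))).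
  by rewrite (exchange_big_dep predT).
rewrite mulr_sumr; apply: ler_sum => i _; rewrite -mulr_suml ler_wpM2r//.
have -> : \sum_(j < J | (i < j)%N) q (j - i.+1)%N = \sum_(i.+1 <= j < J) q (j - i.+1)%N.
  by rewrite -(big_mkord (fun j => i < j)%N (fun j => q (j - i.+1)%N)) (big_nat_widenl i.+1 0).
rewrite -{1}(add0n i.+1) big_addn; under eq_bigr do rewrite addnK.
rewrite big_mkord (big_ord_widen J q (leq_subr _ _)).
by rewrite [leRHS](bigID (fun l : 'I_J => (l < J - i.+1)%N)) /= lerDl sumr_ge0.
Qed.

(** Summing the equation over all times bounds the total mass of [tau G] by 3.
For the decay, the convolution is split.  At the late times [i], [h i] exceeds
[h j] by a factor at most [5/4], so that the induction hypothesis loses only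
[3/4 * 5/4 = 15/16 < 1]; at the early times the kernel itself has decayed, and the
total mass of [G] is enough.  The constant is the solution [B] of
[B = C + 15/16 B + 3 C D]. *)
Lemma renewal_bound (q G h : nat -> R) (tau C D : R) (late : nat -> nat -> bool) :
  0 <= tau -> 0 <= C -> 0 <= D ->
  (forall i, 0 <= q i) -> (forall i, 0 <= G i) -> (forall i, 0 <= h i) ->
  (forall j, G j = q j + tau * \sum_(i < j) q (j - i.+1)%N * G i) ->
  (forall J, tau * \sum_(i < J) q i <= 3 / 4) ->
  (forall j, q j <= C * h j) ->
  (forall i j, (i < j)%N -> late j i -> h i <= 5 / 4 * h j) ->
  (forall i j, (i < j)%N -> ~~ late j i -> h (j - i.+1)%N <= D * h j) ->
  forall j, G j <= 16 * (C + 3 * (C * D)) * h j.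
Proof.
move=> tau0 C0 D0 q0 G0 h0 GE mass qh hlate hearly.
have sumG J : tau * \sum_(i < J) G i <= 3.
  have SE : tau * \sum_(i < J) G i = tau * \sum_(i < J) q i
      + tau * (tau * \sum_(j < J) \sum_(i < j) q (j - i.+1)%N * G i).
    rewrite -mulrDr; congr (_ * _); rewrite [X in _ + X]mulr_sumr -big_split /=.
    by apply: eq_bigr => j _; exact: GE.
  have := convolution_sum_le J q0 G0; have := mass J.
  have : 0 <= \sum_(i < J) G i by rewrite sumr_ge0.
  move: SE; set S := \sum_(i < J) G i; set Q := \sum_(i < J) q i.
  set X := \sum_(j < J) _ => SE S0 Q34 XQS.
  have h1 : tau * (tau * X) <= (tau * Q) * (tau * S).
    rewrite -mulrA ler_wpM2l// mulrCA ler_wpM2l//.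
  have h2 : (tau * Q) * (tau * S) <= 3 / 4 * (tau * S).
    by rewrite ler_wpM2r// mulr_ge0.
  by lra.
set B := 16 * (C + 3 * (C * D)).
have B0 : 0 <= B by rewrite mulr_ge0// addr_ge0 ?mulr_ge0.
elim/ltn_ind => j IH; rewrite GE (bigID (fun i : 'I_j => late j i)) /=.
have Bh0 : 0 <= B * (5 / 4 * h j) by apply/mulr_ge0/mulr_ge0 => //; lra.
have b1 : tau * \sum_(i < j | late j i) q (j - i.+1)%N * G i <= 15 / 16 * B * h j.
  have : \sum_(i < j | late j i) q (j - i.+1)%N * G i <=
      (\sum_(i < j) q i) * (B * (5 / 4 * h j)).
    rewrite [in leRHS](reindex_inj rev_ord_inj) /= mulr_suml.
    rewrite [leRHS](bigID (fun i : 'I_j => late j i)) /=.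
    apply: ler_wpDr; first by rewrite sumr_ge0// => i _; apply: mulr_ge0.
    apply: ler_sum => i li; apply: ler_wpM2l => //.
    apply: le_trans (IH i (ltn_ord i)) _.
    by apply: ler_wpM2l => //; exact: hlate.
  move=> le1; have hj := h0 j.
  apply: (@le_trans _ _ ((tau * \sum_(i < j) q i) * (B * (5 / 4 * h j)))).
    by rewrite -mulrA ler_wpM2l.
  apply: (@le_trans _ _ (3 / 4 * (B * (5 / 4 * h j)))); last by lra.
  by rewrite ler_wpM2r.
have b2 : tau * \sum_(i < j | ~~ late j i) q (j - i.+1)%N * G i <= 3 * (C * D) * h j.
  have le1 : \sum_(i < j | ~~ late j i) q (j - i.+1)%N * G i <=
      C * (D * h j) * \sum_(i < j) G i.
    rewrite mulr_sumr [leRHS](bigID (fun i : 'I_j => ~~ late j i)) /=.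
    apply: ler_wpDr; first by rewrite sumr_ge0// => i _; rewrite !mulr_ge0.
    apply: ler_sum => i li; apply: ler_wpM2r => //.
    by apply: le_trans (qh _) _; apply: ler_wpM2l => //; exact: hearly.
  apply: (@le_trans _ _ (C * (D * h j) * (tau * \sum_(i < j) G i))).
    by rewrite mulrCA ler_wpM2l.
  apply: (@le_trans _ _ (C * (D * h j) * 3)); last by lra.
  by rewrite ler_wpM2l// !mulr_ge0.
have := qh j; rewrite mulrDr; have -> : B * h j = C * h j + (15 / 16 * B * h j + 3 * (C * D) * h j).
  by rewrite /B; lra.
by move=> ?; rewrite lerD// lerD.
Qed.

(** This is integration from infinity: [x - W] is nondecreasing, so that a positive
value would persist as a lower bound on [x], which tends to 0 geometrically. *)
Lemma tail_comparison (x W : nat -> R) (r : R) :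
  0 <= r < 1 -> (forall j, 0 <= x j) -> (forall j, 0 <= W j) ->
  (forall j, x j.+1 <= r * x j) ->
  (forall j, x j - x j.+1 <= W j - W j.+1) ->
  forall j, x j <= W j.
Proof.
move=> /andP[r0 r1] x0 W0 xr xW j; rewrite leNgt; apply/negP => Wx.
have xW' i : x j - W j <= x (j + i)%N.
  have : x j - W j <= x (j + i)%N - W (j + i)%N.
    elim: i => [|i IH]; first by rewrite addn0.
    by apply: le_trans IH _; rewrite addnS; have := xW (j + i)%N; lra.
  by have := W0 (j + i)%N; lra.
have xg i : x (j + i)%N <= r ^+ i * x j.
  elim: i => [|i IH]; first by rewrite addn0 expr0 mul1r.
  by rewrite addnS exprS -mulrA; apply: le_trans (xr _) _; rewrite ler_wpM2l.
have xj0 : 0 < x j by apply: le_lt_trans Wx.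
have e0 : 0 < (x j - W j) / x j by rewrite divr_gt0// subr_gt0.
have rn : `|r| < 1 by rewrite ger0_norm.
have /cvgrPdist_lt/(_ _ e0) [N _ /(_ N (leqnn N))] := cvg_expr rn.
rewrite /= sub0r normrN ger0_norm ?exprn_ge0// ltr_pdivlMr// => H.
by have := le_trans (xW' N) (xg N); rewrite leNgt H.
Qed.

Lemma ler_expn (x y : R) (a : nat) : 0 <= x -> x <= y -> x ^+ a <= y ^+ a.
Proof. by move=> x0 xy; rewrite lerXn2r// nnegrE// (le_trans x0). Qed.

Lemma bernoulli_le (x : R) (a : nat) : 0 <= x <= 1 -> 1 - a%:R * x <= (1 - x) ^+ a.
Proof.
move=> /andP[x0 x1]; elim: a => [|a IH]; first by rewrite mul0r subr0 expr0.
rewrite exprS -(natr1 a); have h : (1 - x) * (1 - a%:R * x) <= (1 - x) * (1 - x) ^+ a.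
  by rewrite ler_wpM2l// subr_ge0.
have : 0 <= a%:R * x ^+ 2 :> R by rewrite mulr_ge0// exprn_ge0.
by move=> ax0; apply: le_trans h; lra.
Qed.

End renewal.

Section decay_profile.
Context {R : realType} (N : R).
Hypothesis N1 : 1 <= N.

(** The diffusive scale: [profile s ^+ a] is comparable to
[1 / min (s ^ (a / 2), N ^ a)] away from [s = 0], and is smoother in [s] than
this minimum. *)
Definition profile (s : R) : R := (Num.sqrt (1 + s))^-1 + N^-1.

Let N0 : 0 < N. Proof. exact: lt_le_trans N1. Qed.
Let Ni : 0 < N^-1. Proof. by rewrite invr_gt0. Qed.

Lemma profile_gt0 s : 0 < profile s.
Proof. by rewrite /profile ltr_wpDl// invr_ge0. Qed.

Lemma profile_le_scale (r s t : R) : 0 < r <= 1 -> 0 <= s -> 0 <= t ->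
  r * (1 + t) <= 1 + s -> profile s <= r^-1 * profile t.
Proof.
move=> /andP[r0 r1] s0 t0 rts; rewrite /profile mulrDr; apply: lerD.
  rewrite -invfM lef_pV2 ?posrE ?mulr_gt0 ?sqrtr_gt0; try lra.
  rewrite -[r]gtr0_norm// -sqrtr_sqr -sqrtrM ?sqr_ge0// ler_wsqrtr//.
  apply: le_trans rts; rewrite ler_wpM2r//; first lra.
  by rewrite expr2 ger_pMl.
by apply: ler_peMl; [exact: ltW|rewrite invf_ge1].
Qed.

(** A discrete form of the inequality
[- (exp (- mu s) profile s ^ (a + 1))' >= const exp (- mu s) profile s ^ (a + 3)].
While the diffusive term dominates the profile, the derivative of
[(1 + s) ^ (- 1 / 2)] supplies two more powers; when [N^-1] dominates, the factor
[mu >= c / N ^ 2] does.  The constant [48 = 6 * 8] combines the factor 6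
lost on the derivative with the [2 ^ 3] from [profile s <= 2 / sqrt (1 + s)], and
[2 ^ (a + 1)] compares the profiles at [s] and [s + tau]. *)
Lemma profile_drop (c tau s mu : R) (a : nat) :
  0 < c <= 1 -> 0 < tau <= 1 -> 0 <= s -> 0 <= mu -> mu * tau <= 1 ->
  c / N ^+ 2 <= mu ->
  c / (48 * 2 ^+ a.+1) * tau * profile s ^+ a.+3 <=
  profile s ^+ a.+1 - (1 - mu * tau) * profile (s + tau) ^+ a.+1.
Proof.
move=> /andP[c0 c1] /andP[t0 t1] s0 mu0 mut cmu.
set H := profile s; set H' := profile (s + tau).
have H0 : 0 < H := profile_gt0 s.
have H'0 : 0 < H' := profile_gt0 (s + tau).
pose u := Num.sqrt (1 + s); pose v := Num.sqrt (1 + (s + tau)).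
have u0 : 0 < u by rewrite sqrtr_gt0; lra.
have v0 : 0 < v by rewrite sqrtr_gt0; lra.
have u2 : u ^+ 2 = 1 + s by rewrite sqr_sqrtr; lra.
have v2 : v ^+ 2 = 1 + (s + tau) by rewrite sqr_sqrtr; lra.
have uv : u <= v by apply: ler_wsqrtr; lra.
have vu : v <= 2 * u.
  by rewrite -(@ler_pXn2r _ 2)// ?nnegrE ?mulr_ge0// ?ltW// exprMn u2 v2; lra.
have HE : H = u^-1 + N^-1 by [].
have H'E : H' = v^-1 + N^-1 by [].
have drop : tau / 6 * u^-1 ^+ 3 <= H - H'.
  have -> : H - H' = tau * (u^-1 * v^-1 * (u + v)^-1).
    have -> : tau = v ^+ 2 - u ^+ 2 by rewrite u2 v2; lra.
    rewrite HE H'E; field; rewrite !gt_eqF//; lra.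
  rewrite -mulrA; apply: ler_wpM2l; first exact: ltW.
  rewrite !exprS expr0 mulr1 mulrCA -[leRHS]mulrA.
  apply: ler_wpM2l; first by rewrite invr_ge0 ltW.
  have uv0 : 0 < u + v by rewrite addr_gt0.
  rewrite -!invfM lef_pV2 ?posrE ?mulr_gt0//.
  by nra.
have iu0 : 0 < u^-1 by rewrite invr_gt0.
have t6 : 0 <= tau / 6 by lra.
have H'H : H' <= H.
  by rewrite -subr_ge0; apply: le_trans drop; rewrite mulr_ge0// exprn_ge0// ltW.
have HH' : H <= 2 * H'.
  have : u^-1 <= 2 * v^-1.
    have -> : 2 * v^-1 = (v / 2)^-1 by rewrite invfM invrK mulrC.
    have vh : 0 < v / 2 by rewrite divr_gt0.
    by rewrite lef_pV2 ?posrE// ler_pdivrMr// mulrC.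
  move=> uv2; rewrite HE H'E; have Nii := Ni.
  lra.
have pow1 : H ^+ a * (H - H') <= H ^+ a.+1 - H' ^+ a.+1.
  rewrite !exprSr mulrBr lerB//; apply: ler_wpM2r; first exact: ltW.
  by apply: ler_expn => //; exact: ltW.
have pow2 : H ^+ a.+1 <= 2 ^+ a.+1 * H' ^+ a.+1.
  by rewrite -exprMn; apply: ler_expn => //; exact: ltW.
have -> : H ^+ a.+1 - (1 - mu * tau) * H' ^+ a.+1 =
  (H ^+ a.+1 - H' ^+ a.+1) + mu * tau * H' ^+ a.+1 by ring.
have p2 : 0 < 2 ^+ a.+1 :> R by rewrite exprn_gt0.
have p2' : 1 <= 2 ^+ a.+1 :> R by rewrite exprn_ege1// ler1n.
have Ha : 0 <= H ^+ a by rewrite exprn_ge0 ?ltW.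
have [uN|uN] := leP N^-1 u^-1.
  apply: (@le_trans _ _ (H ^+ a * (H - H'))); last first.
    by rewrite ler_wpDr// ?mulr_ge0 ?exprn_ge0// ltW.
  have H3 : H ^+ 3 <= 8 * u^-1 ^+ 3.
    have -> : 8 * u^-1 ^+ 3 = (2 * u^-1) ^+ 3 by ring.
    by apply: ler_expn; [exact: ltW|rewrite HE; lra].
  have -> : H ^+ a.+3 = H ^+ a * H ^+ 3 by rewrite -exprD addn3.
  rewrite mulrCA ler_wpM2l//.
  apply: le_trans drop.
  have cc : c / (48 * 2 ^+ a.+1) <= 48^-1.
    by rewrite ler_pdivrMr ?mulr_gt0// mulrA mulVf ?pnatr_eq0// mul1r; lra.
  have H30 : 0 <= H ^+ 3 by rewrite exprn_ge0 ?ltW.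
  apply: (@le_trans _ _ (48^-1 * tau * H ^+ 3)).
    by rewrite ler_wpM2r// ler_wpM2r// ltW.
  by apply: (@le_trans _ _ (48^-1 * tau * (8 * u^-1 ^+ 3))); [rewrite ler_wpM2l// mulr_ge0// ltW|lra].
apply: (@le_trans _ _ (mu * tau * H' ^+ a.+1)); last first.
  rewrite ler_wpDl// subr_ge0; apply: ler_expn => //; exact: ltW.
have H2 : H ^+ 2 <= 4 * (N ^+ 2)^-1.
  have -> : 4 * (N ^+ 2)^-1 = (2 * N^-1) ^+ 2 by rewrite exprMn exprVn; ring.
  by apply: ler_expn; [exact: ltW|rewrite HE; lra].
have -> : H ^+ a.+3 = H ^+ 2 * H ^+ a.+1 by rewrite -exprD.
apply: (@le_trans _ _ (c / (48 * 2 ^+ a.+1) * tau * (4 * (N ^+ 2)^-1 * (2 ^+ a.+1 * H' ^+ a.+1)))).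
  apply: ler_wpM2l.
    by apply: mulr_ge0; [apply: divr_ge0; rewrite ?mulr_ge0//|]; exact: ltW.
  by apply: ler_pM => //; apply: exprn_ge0; exact: ltW.
have -> : c / (48 * 2 ^+ a.+1) * tau * (4 * (N ^+ 2)^-1 * (2 ^+ a.+1 * H' ^+ a.+1))
   = c / N ^+ 2 / 12 * (tau * H' ^+ a.+1) by field; rewrite !gt_eqF.
rewrite -[leRHS]mulrA; apply: ler_wpM2r.
  by apply: mulr_ge0; [exact: ltW|apply: exprn_ge0; exact: ltW].
have : 0 < c / N ^+ 2 by rewrite divr_gt0// exprn_gt0.
by lra.
Qed.

End decay_profile.

(** * The second-moment recursion *)

Section second_moments.
Context {R : realType} {I : finType} (i0 : I) (lam : I -> R).

Let K : R := #|I|%:R.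

(** The recursion is studied for an abstract nonnegative function [lam] with
mean 1 and a zero at [i0].  All modes start at 1, as the power spectrum of
a unit mass does. *)
Fixpoint spectrum (tau : R) (j : nat) (k : I) : R :=
  if j is j'.+1 then
    (1 - 2 * tau * lam k) * spectrum tau j' k +
    tau * (K^-1 * \sum_q lam q ^+ 2 * spectrum tau j' q)
  else 1.

Definition source tau j : R := K^-1 * \sum_q lam q ^+ 2 * spectrum tau j q.
Definition spectral_energy tau j : R := K^-1 * \sum_k lam k * spectrum tau j k.
Definition spectral_variance tau j : R :=
  K^-1 * \sum_(k | k != i0) spectrum tau j k.

Hypothesis lam_i0 : lam i0 = 0.
Hypothesis lam_le2 : forall k, lam k <= 2.
Hypothesis lam_mean : \sum_k lam k = K.
Variable lam1 : R.
Hypothesis lam1_gt0 : 0 < lam1.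
Hypothesis lam1_le : forall k, k != i0 -> lam1 <= lam k.

Variable tau : R.
Hypothesis tau_gt0 : 0 < tau.
Hypothesis tau_le : tau <= 1 / 4.

Let g := source tau.
Let K0 : 0 < K. Proof. by rewrite ltr0n; apply/card_gt0P; exists i0. Qed.
Let Ki : 0 <= K^-1. Proof. by rewrite invr_ge0 ltW. Qed.

Let lam_ge0 k : 0 <= lam k.
Proof. by have [->|/lam1_le/(lt_le_trans lam1_gt0)/ltW//] := eqVneq k i0; rewrite lam_i0. Qed.

Lemma step_factor_ge0 k : 0 <= 1 - 2 * tau * lam k.
Proof.
have : tau * lam k <= 1 / 4 * lam k by rewrite ler_wpM2r.
by have := lam_le2 k; lra.
Qed.

(** Duhamel formula for the rank-one perturbation by the source. *)
Lemma spectrumE j k : spectrum tau j k = (1 - 2 * tau * lam k) ^+ j +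
  tau * \sum_(i < j) (1 - 2 * tau * lam k) ^+ (j - i.+1) * g i.
Proof.
elim: j => [|j IH]; first by rewrite big_ord0 mulr0 addr0.
rewrite /= IH -/(source tau j) -/g big_ord_recr /= subnn expr0 mul1r mulrDr.
rewrite exprS mulrDr addrA mulrCA; congr (_ + _ * _ + _).
rewrite mulr_sumr; apply: eq_bigr => i _.
by rewrite mulrA -exprS -subSn ?subSS// ltn_ord.
Qed.

Lemma spectrum_source_ge0 j : (forall k, 0 <= spectrum tau j k) /\ 0 <= g j.
Proof.
have gs i : (forall k, 0 <= spectrum tau i k) -> 0 <= g i.
  move=> s0; rewrite mulr_ge0// sumr_ge0// => q _.
  by rewrite mulr_ge0// exprn_ge0.
have s0 : forall k, 0 <= spectrum tau j k.
  elim: j => [|j IH] k /=; first by [].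
  apply: addr_ge0; apply: mulr_ge0; rewrite ?IH ?step_factor_ge0 ?(ltW tau_gt0)//.
  exact: (gs j IH).
by split => //; exact: gs.
Qed.

Let s0 j k : 0 <= spectrum tau j k. Proof. by have [] := spectrum_source_ge0 j. Qed.
Let g0 j : 0 <= g j. Proof. by have [] := spectrum_source_ge0 j. Qed.

Lemma spectrum_ge j k : (1 - 2 * tau * lam k) ^+ j <= spectrum tau j k.
Proof.
rewrite spectrumE lerDl mulr_ge0 ?(ltW tau_gt0)// sumr_ge0// => i _.
by rewrite mulr_ge0// exprn_ge0// step_factor_ge0.
Qed.

(** The diagonal part removes [2 tau g] and the source returns [tau g] times the
mean of [lam], which is 1. *)
Lemma spectral_energyS j :
  spectral_energy tau j.+1 = spectral_energy tau j - tau * g j.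
Proof.
rewrite /spectral_energy /g /source /=.
set G := K^-1 * \sum_q lam q ^+ 2 * _.
have -> : \sum_k lam k * ((1 - 2 * tau * lam k) * spectrum tau j k + tau * G) =
  \sum_k lam k * spectrum tau j k - 2 * tau * (\sum_q lam q ^+ 2 * spectrum tau j q)
   + tau * G * \sum_k lam k.
  rewrite !mulr_sumr -sumrB -big_split; apply: eq_bigr => k _ /=; ring.
rewrite lam_mean /G; set S := \sum_k _; set S' := \sum_q _; field.
by rewrite gt_eqF.
Qed.

Lemma spectral_varianceS j : spectral_variance tau j.+1 =
  spectral_variance tau j - 2 * tau * spectral_energy tau j + tau * (1 - K^-1) * g j.
Proof.
rewrite /spectral_variance /spectral_energy /=.
rewrite -/(source tau j) -/g.
have -> : \sum_(k | k != i0) ((1 - 2 * tau * lam k) * spectrum tau j k + tau * g j) =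
  \sum_(k | k != i0) spectrum tau j k - 2 * tau * \sum_(k | k != i0) lam k * spectrum tau j k
  + (K - 1) * (tau * g j).
  have -> : (K - 1) * (tau * g j) = \sum_(k | k != i0) tau * g j.
    have := sumr_const (mem I) (tau * g j); rewrite (bigD1 i0)//= => E.
    by rewrite mulrBl mul1r mulr_natl -E addrAC subrr add0r.
  rewrite mulr_sumr -sumrB -big_split; apply: eq_bigr => k _ /=; ring.
have -> : \sum_k lam k * spectrum tau j k = \sum_(k | k != i0) lam k * spectrum tau j k.
  by rewrite (bigD1 i0)//= lam_i0 mul0r add0r.
set S := \sum_(k | _) _; set S' := \sum_(k | _) _; field; by rewrite gt_eqF.
Qed.

Lemma spectral_energy_ge0 j : 0 <= spectral_energy tau j.
Proof. by rewrite mulr_ge0// sumr_ge0// => k _; rewrite mulr_ge0. Qed.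

Lemma spectral_variance_ge0 j : 0 <= spectral_variance tau j.
Proof. by rewrite mulr_ge0// sumr_ge0. Qed.

(** Together with the next lemma, this makes energy and variance decay
geometrically, so that they can be integrated from infinity. *)
Lemma source_ge j : lam1 * spectral_energy tau j <= g j.
Proof.
rewrite /g /source mulrCA; apply: ler_wpM2l => //.
rewrite mulr_sumr; apply: ler_sum => k _; rewrite mulrA.
apply: ler_wpM2r => //; have [->|k0] := eqVneq k i0; first by rewrite lam_i0; lra.
by rewrite expr2; apply: ler_wpM2r => //; exact: lam1_le.
Qed.

Lemma spectral_energy_ge j : lam1 * spectral_variance tau j <= spectral_energy tau j.
Proof.
rewrite /spectral_energy mulrCA; apply: ler_wpM2l => //.
rewrite [leRHS](bigD1 i0)//= lam_i0 mul0r add0r mulr_sumr.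
by apply: ler_sum => k k0; rewrite ler_wpM2r// lam1_le.
Qed.

(** ** Decay of source, energy and variance *)

(* The rate [mu] is slightly less than [2 lam1], so that the tilted kernel is
summable over all nonzero modes.  The exponent of the profile is [p + 5], that
is [d + 4] for [d = p + 1]. *)

Variables (mu N C c : R) (p : nat).
Hypothesis mu_ge : lam1 <= mu.
Hypothesis mu_lt : mu < 2 * lam1.
Hypothesis mu_tau : mu * tau <= 1 / 2.
Hypothesis N_ge1 : 1 <= N.
Hypothesis c_gt0 : 0 < c <= 1.
Hypothesis c_mu : c / N ^+ 2 <= mu.
Hypothesis C_ge0 : 0 <= C.
Hypothesis kernel_mass :
  K^-1 * \sum_(k | k != i0) lam k ^+ 2 / (2 * lam k - mu) <= 3 / 4.
Hypothesis kernel_decay : forall s, 0 <= s ->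
  K^-1 * \sum_(k | k != i0) lam k ^+ 2 * expR (- (s * (2 * lam k - mu))) <=
  C * profile N s ^+ p.+4.+1.

Let th := 1 - mu * tau.
Let th0 : 0 < th. Proof. by have := mu_tau; rewrite /th; lra. Qed.
Let mu0 : 0 < mu. Proof. exact: lt_le_trans mu_ge. Qed.
Let th1 : th <= 1. Proof. by rewrite /th gerBl mulr_ge0// ltW. Qed.
Let xr k := (1 - 2 * tau * lam k) / th.
Let q j := K^-1 * \sum_(k | k != i0) lam k ^+ 2 * xr k ^+ j.
Let G j := g j / th ^+ j.

Let xr0 k : 0 <= xr k.
Proof. by rewrite divr_ge0 ?step_factor_ge0// ltW. Qed.

Let q0 j : 0 <= q j.
Proof.
by rewrite mulr_ge0// sumr_ge0// => k _; rewrite mulr_ge0// exprn_ge0.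
Qed.

Let gap k : k != i0 -> 0 < 2 * lam k - mu.
Proof. by move=> /lam1_le; have := mu_lt; lra. Qed.

Let xE k : xr k = 1 - tau / th * (2 * lam k - mu).
Proof. by rewrite /xr; have := th0; rewrite /th => h; field; rewrite gt_eqF. Qed.

(* Dividing [g j] by [th ^+ j] multiplies the contribution of mode [k] to the
kernel by [th ^- j]: its decay factor becomes [xr k], still less than 1. *)
Let tilted_renewal j : G j = q j + tau / th * \sum_(i < j) q (j - i.+1)%N * G i.
Proof.
have thn i : th ^+ i != 0 by rewrite expf_neq0// gt_eqF.
have h0 i : K^-1 * \sum_k lam k ^+ 2 * ((1 - 2 * tau * lam k) ^+ i) = q i * th ^+ i.
  rewrite (bigD1 i0)//= lam_i0 expr0n mul0r add0r -mulrA; congr (_ * _).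
  rewrite mulr_suml; apply: eq_bigr => k _; rewrite -[RHS]mulrA; congr (_ * _).
  by rewrite /xr expr_div_n divfK.
have gE : g j = q j * th ^+ j + tau * \sum_(i < j) q (j - i.+1)%N * th ^+ (j - i.+1) * g i.
  rewrite /g /source; under eq_bigr do rewrite spectrumE mulrDr.
  rewrite big_split /= mulrDr h0; congr (_ + _).
  under eq_bigr do rewrite mulrCA mulr_sumr.
  rewrite -mulr_sumr mulrCA; congr (_ * _).
  rewrite exchange_big mulr_sumr; apply: eq_bigr => i _ /=.
  rewrite -h0 -/(source tau i) -[RHS]mulrA; congr (_ * _); rewrite [RHS]mulr_suml.
  by apply: eq_bigr => k _; rewrite mulrA.
rewrite /G gE mulrDl mulfK//; congr (_ + _).
rewrite -[LHS]mulrA -[RHS]mulrA; congr (_ * _); rewrite mulr_suml mulr_sumr.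
apply: eq_bigr => i _.
have -> : th ^+ j = th ^+ (j - i.+1) * th * th ^+ i.
  by rewrite -exprSr -exprD addSnnS subnK.
by field; rewrite !thn gt_eqF.
Qed.

(* geometric series, mode by mode *)
Let tilted_mass J : tau / th * \sum_(i < J) q i <= 3 / 4.
Proof.
apply: le_trans kernel_mass; rewrite /q -mulr_sumr mulrCA; apply: ler_wpM2l => //.
rewrite exchange_big mulr_sumr /=; apply: ler_sum => k k0.
rewrite -mulr_sumr mulrCA; apply: ler_wpM2l; first exact: exprn_ge0.
have gk := gap k0; have tt : 0 < tau / th by rewrite divr_gt0.
rewrite -(ler_pM2r gk) mulVf ?gt_eqF// mulrAC.
have -> : tau / th * (2 * lam k - mu) = 1 - xr k by rewrite xE; ring.
have -> : (1 - xr k) * \sum_(i < J) xr k ^+ i = 1 - xr k ^+ J.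
  by rewrite -[RHS]opprB subrX1; ring.
by rewrite gerBl exprn_ge0.
Qed.

Let tilted_decay j : q j <= C * profile N (tau * j%:R) ^+ p.+4.+1.
Proof.
apply: le_trans (kernel_decay _); last by rewrite mulr_ge0// ltW.
apply: ler_wpM2l => //; apply: ler_sum => k k0; apply: ler_wpM2l; first exact: exprn_ge0.
rewrite mulrAC -mulNr expRM_natr; apply: ler_expn => //.
apply: le_trans (expR_ge1Dx _); rewrite xE lerD2l lerN2 ler_wpM2r ?(ltW (gap k0))//.
by rewrite ler_pdivlMr// ler_piMr// ltW.
Qed.

(** With [b = p + 5] the exponent of the profile, the convolution is split at
[(1 - eps) j] with [eps = 1 / (5 b)].  After the splitting time the profile to the
power [b] changes by at most [(1 - eps) ^ (- b) <= 5 / 4], by Bernoulli; before it,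
the kernel has had a time [eps j] to decay, which costs
[eps ^ (- b) = (5 b) ^ b]. *)
Definition renewal_constant : R :=
  16 * (C + 3 * (C * (5 * p.+4.+1)%:R ^+ p.+4.+1)).

Lemma source_decay j :
  g j <= renewal_constant * th ^+ j * profile N (tau * j%:R) ^+ p.+4.+1.
Proof.
set b := p.+4.+1; have b0 : 0 < (5 * b)%:R :> R by rewrite ltr0n.
have [eps epsE] : exists eps : R, eps = ((5 * b)%:R)^-1 by eexists.
have eps0 : 0 < eps by rewrite epsE invr_gt0.
have eps1 : eps <= 1 / 5.
  rewrite div1r epsE lef_pV2 ?posrE// natrM ler_peMr//; exact: ler1n.
have beps : b%:R * eps = 1 / 5.
  by rewrite epsE natrM; field; rewrite !pnatr_eq0.
have H0 s : 0 <= profile N s by rewrite ltW// profile_gt0.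
have tj (j' : nat) : 0 <= tau * j'%:R by rewrite mulr_ge0// ltW.
suff : G j <= renewal_constant * profile N (tau * j%:R) ^+ b.
  by rewrite /G ler_pdivrMr ?exprn_gt0// mulrAC.
pose late (j i : nat) := (1 - eps) * j%:R <= i%:R :> R.
apply: (@renewal_bound _ q G (fun j => profile N (tau * j%:R) ^+ b) (tau / th) C
  ((5 * b)%:R ^+ b) late) => //.
- by rewrite divr_ge0// ltW.
- by move=> i; rewrite divr_ge0// exprn_ge0// ltW.
- by move=> i; rewrite exprn_ge0.
- move=> i i' ii' lt_ii'.
  apply: (@le_trans _ _ ((1 - eps)^-1 ^+ b * profile N (tau * i'%:R) ^+ b)).
    rewrite -exprMn; apply: ler_expn => //; apply: profile_le_scale => //; first by apply/andP; split; lra.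
    have : tau * ((1 - eps) * i'%:R) <= tau * i%:R by rewrite ler_wpM2l// ltW.
    by lra.
  apply: ler_wpM2r; first exact: exprn_ge0.
  rewrite exprVn -[5 / 4]invrK lef_pV2 ?posrE ?exprn_gt0 ?invr_gt0//; try lra.
  by apply: le_trans (@bernoulli_le _ eps b _); rewrite ?beps; lra.
- move=> i i' ii'; rewrite /late -ltNge => lt_ii'.
  rewrite -exprMn; apply: ler_expn => //.
  rewrite -[(5 * b)%:R]invrK -epsE; apply: profile_le_scale => //; first by apply/andP; split; lra.
  rewrite natrB// -natr1.
  have : tau * i%:R <= tau * ((1 - eps) * i'%:R) by rewrite ler_wpM2l// ltW.
  by have := tau_le; lra.
Qed.

Let r := 1 - tau * lam1.
Let r01 : 0 <= r < 1.
Proof. by have := mu_ge; have := mu_tau; have := lam1_gt0; have := tau_gt0; rewrite /r; nra. Qed.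

(* The barrier for [tail_comparison]: its decrements dominate the same profile
with two more powers. *)
Let W (A : R) (a j : nat) := A * th ^+ j * profile N (tau * j%:R) ^+ a.+1.

Let W_drop (A : R) a j : 0 <= A ->
  A * (c / (48 * 2 ^+ a.+1)) * tau * (th ^+ j * profile N (tau * j%:R) ^+ a.+3)
  <= W A a j - W A a j.+1.
Proof.
move=> A0; have tj : 0 <= tau * j%:R by rewrite mulr_ge0// ltW.
have := @profile_drop _ N N_ge1 c tau (tau * j%:R) mu a c_gt0.
have -> : tau * j%:R + tau = tau * j.+1%:R by rewrite -natr1; ring.
move=> /(_ _ tj (ltW mu0) _ c_mu) H.
have h1 : 0 < tau <= 1 by rewrite tau_gt0 /=; have := tau_le; lra.
have h2 : mu * tau <= 1 by have := mu_tau; lra.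
have := H h1 h2 => {}H; rewrite /W (exprS th) -/th in H *.
have -> : A * th ^+ j * profile N (tau * j%:R) ^+ a.+1 -
   A * (th * th ^+ j) * profile N (tau * j.+1%:R) ^+ a.+1 = A * th ^+ j *
   (profile N (tau * j%:R) ^+ a.+1 - th * profile N (tau * j.+1%:R) ^+ a.+1) by ring.
apply: le_trans (ler_wpM2l (_ : 0 <= A * th ^+ j) H); last first.
  by rewrite mulr_ge0// exprn_ge0// ltW.
by rewrite le_eqVlt; apply/orP; left; apply/eqP; ring.
Qed.

Let W_ge0 A a j : 0 <= A -> 0 <= W A a j.
Proof.
move=> A0; apply: mulr_ge0; last by rewrite exprn_ge0// ltW// profile_gt0.
by rewrite mulr_ge0// exprn_ge0// ltW.
Qed.

Definition energy_constant : R := renewal_constant * (48 * 2 ^+ p.+3 / c).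

Let rc0 : 0 <= renewal_constant.
Proof.
rewrite /renewal_constant; apply: mulr_ge0 => //; apply: addr_ge0 => //.
by apply: mulr_ge0 => //; apply: mulr_ge0 => //; exact: exprn_ge0.
Qed.

Let ec0 : 0 <= energy_constant.
Proof.
have /andP[c0 _] := c_gt0.
by apply: mulr_ge0 => //; apply: divr_ge0; [rewrite mulr_ge0|exact: ltW].
Qed.

(** The decrements of the energy are [tau g], and those of the barrier with two
fewer powers of the profile are larger. *)
Lemma spectral_energy_le j : spectral_energy tau j <=
  energy_constant * th ^+ j * profile N (tau * j%:R) ^+ p.+3.
Proof.
have /andP[c0 _] := c_gt0.
apply: (tail_comparison r01 spectral_energy_ge0 (W := W energy_constant p.+2)).
- by move=> i; exact: W_ge0.
- move=> i; rewrite spectral_energyS /r; have := source_ge i; have := tau_gt0; nra.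
- move=> i; rewrite spectral_energyS opprB addrCA subrr addr0.
  apply: le_trans (W_drop _ _ ec0); rewrite /energy_constant.
  have -> : renewal_constant * (48 * 2 ^+ p.+3 / c) * (c / (48 * 2 ^+ p.+3)) = renewal_constant.
    by field; rewrite ?gt_eqF//.
  apply: le_trans (ler_wpM2l (ltW tau_gt0) (source_decay i)) _.
  by rewrite le_eqVlt; apply/orP; left; apply/eqP; ring.
Qed.

Definition variance_constant : R := energy_constant * (2 * (48 * 2 ^+ p.+1 / c)).

(** The source makes the variance itself gain [tau (1 - K^-1) g] at each step;
adding [1 - K^-1] times the energy, which loses [tau g], cancels this gain and
leaves a quantity with decrements [2 tau e]. *)
Lemma spectral_variance_le j : spectral_variance tau j <=
  variance_constant * th ^+ j * profile N (tau * j%:R) ^+ p.+1.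
Proof.
have /andP[c0 _] := c_gt0.
have vc0 : 0 <= variance_constant.
  apply: mulr_ge0 => //; apply: mulr_ge0 => //.
  by apply: divr_ge0; [rewrite mulr_ge0|exact: ltW].
have K1 : 0 <= 1 - K^-1 <= 1.
  have : 1 <= K by rewrite ler1n; apply/card_gt0P; exists i0.
  rewrite -(invf_le1 K0) => Kle; have := Ki.
  by move=> ?; apply/andP; split; lra.
have /andP[k0 k1] := K1.
pose z j := spectral_variance tau j + (1 - K^-1) * spectral_energy tau j.
have zS i : z i.+1 = z i - 2 * tau * spectral_energy tau i.
  by rewrite /z spectral_varianceS spectral_energyS; ring.
suff : z j <= W variance_constant p j.
  apply: le_trans; rewrite /z lerDl mulr_ge0//; exact: spectral_energy_ge0.
pose r' := 1 - tau * lam1 / 2.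
have r'01 : 0 <= r' < 1 by have := r01; have := tau_gt0; have := lam1_gt0; rewrite /r' /r; nra.
apply: (tail_comparison r'01).
- by move=> i; rewrite addr_ge0 ?spectral_variance_ge0// mulr_ge0// spectral_energy_ge0.
- by move=> i; exact: W_ge0.
- move=> i; rewrite zS /r' /z.
  have e0 := spectral_energy_ge0 i; have v0 := spectral_variance_ge0 i.
  have ev := spectral_energy_ge i.
  have l2 : lam1 <= 2.
    have [k k0'] : exists k, k != i0.
      apply/existsP; rewrite -negb_forall; apply/negP => /forallP ai.
      have := lam_mean; rewrite big1 => [/eqP|k _]; first by rewrite lt_eqF.
      by have /eqP -> := ai k.
    exact: le_trans (lam1_le k0') (lam_le2 k).
  have h1 : lam1 * ((1 - K^-1) * spectral_energy tau i) <= 2 * spectral_energy tau i.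
    rewrite mulrA ler_wpM2r//; nra.
  have h2 : tau * (lam1 * (spectral_variance tau i + (1 - K^-1) * spectral_energy tau i))
     <= tau * (spectral_energy tau i + 2 * spectral_energy tau i).
    by rewrite ler_pM2l// mulrDr lerD.
  have h3 : 0 <= tau * spectral_energy tau i by rewrite mulr_ge0// ltW.
  lra.
- move=> i; rewrite zS opprB addrCA subrr addr0.
  apply: le_trans (W_drop _ _ vc0); rewrite /variance_constant.
  have -> : energy_constant * (2 * (48 * 2 ^+ p.+1 / c)) * (c / (48 * 2 ^+ p.+1)) = 2 * energy_constant.
    by field; rewrite ?gt_eqF//.
  have := spectral_energy_le i.
  set X := spectral_energy _ _; set Y := _ ^+ p.+3; set T := _ ^+ i => XY.
  have h2 : 2 * tau * X <= 2 * tau * (energy_constant * T * Y).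
    by rewrite ler_wpM2l// mulr_ge0// ltW.
  by apply: le_trans h2 _; rewrite le_eqVlt; apply/orP; left; apply/eqP; ring.
Qed.

End second_moments.

(** * Eigenvalues of the walk on the torus *)

Section cycle_spectrum.
Context {R : realType} {n : nat}.
Hypothesis n6 : (6 <= n)%N.
Implicit Types z : 'Z_n.

Let n3 : (2 < n)%N. Proof. exact: leq_trans n6. Qed.
Let n0 : 0 < n%:R :> R. Proof. by rewrite ltr0n (leq_trans _ n6). Qed.

Let gap : R := cycle_gap n.

Lemma val_Zn1 : val (1 : 'Z_n) = 1%N.
Proof. by rewrite -[RHS](@modn_small 1 n) ?(ltn_trans _ n3)//; congr modn; rewrite Zp_cast// (ltn_trans _ n3). Qed.

Lemma cycle_gapE : gap = 1 - cos_char (1 : 'Z_n).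
Proof. by rewrite /gap /cycle_gap /cos_char val_Zn1 mulr1. Qed.

Lemma cycle_norm1 : cycle_norm (1 : 'Z_n) = 1%N.
Proof. by rewrite /cycle_norm val_Zn1; apply/minn_idPl; rewrite subn_gt0 (ltn_trans _ n3). Qed.

Lemma cycle_gap_le : gap <= 32 / n%:R ^+ 2.
Proof.
rewrite cycle_gapE; apply: le_trans (one_sub_cos_char_le n3 _) _.
by rewrite cycle_norm1 expr_div_n expr1n mul1r.
Qed.

Lemma cycle_gap_ge : 2 * cos 1 ^+ 2 / n%:R ^+ 2 <= gap.
Proof.
rewrite cycle_gapE; apply: le_trans (one_sub_cos_char_ge n3 _).
by rewrite cycle_norm1 expr_div_n expr1n mul1r.
Qed.

Lemma cycle_gap_gt0 : 0 < gap.
Proof.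
apply: lt_le_trans cycle_gap_ge; rewrite divr_gt0 ?exprn_gt0// mulr_gt0// exprn_gt0//.
exact: cos1_gt0.
Qed.

Lemma cycle_gap_le1 : gap <= 1.
Proof.
apply: le_trans cycle_gap_le _; rewrite ler_pdivrMr ?exprn_gt0// mul1r.
by rewrite -natrX ler_nat (@leq_trans (6 ^ 2)) // leq_sqr.
Qed.

(** Monotonicity of [1 - cos] in the distance to 0. *)
Lemma one_sub_cos_char_gap (a : nat) z : (a <= cycle_norm z)%N ->
  1 - cos (2 * pi * a%:R / n%:R) <= 1 - cos_char z :> R.
Proof.
move=> az; rewrite one_sub_cos_charE// -one_sub_cos lerD2l lerN2.
have [t0 t1] := @cycle_norm_angle R n n3 z.
have p0 := pi_gt0 R.
have aE : 2 * pi * a%:R / n%:R = (pi * a%:R / n%:R) *+ 2 :> R.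
  by rewrite -mulr_natr; ring.
rewrite aE; set u := pi * a%:R / n%:R.
have u0 : 0 <= u by rewrite divr_ge0 ?mulr_ge0 ?pi_ge0.
have uv : u <= pi * (cycle_norm z)%:R / n%:R.
  by rewrite ler_pM2r ?invr_gt0// ler_pM2l// ler_nat.
rewrite le_eqVlt; move: uv; rewrite le_eqVlt => /predU1P[->|uv].
  by rewrite eqxx.
apply/orP; right; rewrite ltr_cos ?in_itv/=.
- by rewrite ltrMn2r.
- by rewrite mulrn_wge0//=; lra.
- by rewrite mulrn_wge0//=; lra.
Qed.

Lemma cycle_norm_gt0 z : z != 0 -> (0 < cycle_norm z)%N.
Proof.
move=> z0; rewrite /cycle_norm leq_min subn_gt0 ltn_Zn// andbT lt0n.
by rewrite -(inj_eq val_inj) in z0 *.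
Qed.

Lemma gap_le z : z != 0 -> gap <= 1 - cos_char z.
Proof.
move=> /cycle_norm_gt0/one_sub_cos_char_gap; apply: le_trans.
by rewrite mulr1.
Qed.

(** Beyond [0], [1] and [-1] the distance is at least 2, and
[1 - cos 2u = 2 (1 + cos u) (1 - cos u)] with [cos u >= 0]. *)
Lemma two_gap_le z : z != 0 -> z != 1 -> z != -1 -> 2 * gap <= 1 - cos_char z.
Proof.
move=> z0 z1 zN1.
have c2 : (1 < cycle_norm z)%N.
  have := cycle_norm_gt0 z0; rewrite leq_eqVlt => /predU1P[|//].
  rewrite /cycle_norm /minn; case: ifP => _ h.
    by case/eqP: z1; apply/val_inj; rewrite val_Zn1 -h.
  case/eqP: zN1; rewrite -[LHS]opprK; congr (- _); apply/val_inj.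
  by rewrite (val_Zn_opp n3 z0) -h val_Zn1.
apply: le_trans (one_sub_cos_char_gap c2).
have -> : 2 * pi * 2 / n%:R = (2 * pi / n%:R) *+ 2 :> R by rewrite -mulr_natr; ring.
rewrite one_sub_cos sin2cos2; have := cycle_gap_le1; rewrite /gap /cycle_gap.
by have := cos_le1 (2 * pi / n%:R : R); nra.
Qed.

End cycle_spectrum.

Section torus_spectrum.
Context {R : realType} {d n : nat}.
Hypothesis n6 : (6 <= n)%N.
Hypothesis d1 : (1 <= d)%N.
Implicit Types (k : torus d n).

Let n3 : (2 < n)%N. Proof. exact: leq_trans n6. Qed.
Let n0 : 0 < n%:R :> R. Proof. by rewrite ltr0n (leq_trans _ n6). Qed.
Let d0 : 0 < d%:R :> R. Proof. by rewrite ltr0n. Qed.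
Let di : 0 < d%:R^-1 :> R. Proof. by rewrite invr_gt0. Qed.

Let gap : R := cycle_gap n.
Let i0 := origin d n.
Let lam1 : R := gap / d%:R.
Let lam : torus d n -> R := symbol.

Lemma symbolE k : lam k = d%:R^-1 * \sum_l (1 - cos_char (k l)).
Proof.
rewrite /lam /symbol sumrB sumr_const card_ord mulrBr -[1 *+ d]/(d%:R : R).
by rewrite mulVf ?gt_eqF.
Qed.

Lemma symbol_origin : lam i0 = 0.
Proof.
rewrite symbolE big1 ?mulr0// => l _; rewrite ffunE cos_char0; exact: subrr.
Qed.

Lemma symbol_le2 k : lam k <= 2.
Proof.
rewrite symbolE mulrC ler_pdivrMr// mulr_natr.
have -> : 2 *+ d = \sum_(l < d) 2 :> R by rewrite sumr_const card_ord.
apply: ler_sum => l _.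
by have := cos_geN1 (2 * pi * (val (k l))%:R / n%:R : R); rewrite /cos_char; lra.
Qed.

(** The trace of the random walk vanishes: no site is its own neighbour. *)
Lemma symbol_mean : \sum_k lam k = #|torus d n|%:R.
Proof.
rewrite sumrB sumr_const -[RHS]subr0; congr (_ - _); rewrite -mulr_sumr exchange_big big1 ?mulr0//.
move=> l _ /=; have l1 : coord_shift l 1 i0 != i0.
  apply/eqP => /ffunP/(_ l); rewrite !ffunE eqxx add0r => /eqP.
  by rewrite (negbTE (oner_neq0 _)).
have := sum_cos_char (R := R) n3 (coord_shift l 1 i0); rewrite (negbTE l1) mul0n => E; rewrite -[RHS]E.
by apply: eq_bigr => k _; rewrite dot_shiftr dot0 add0r mulr1.
Qed.

Let coord_le k (l : 'I_d) : 1 - cos_char (k l) <= d%:R * lam k.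
Proof.
rewrite symbolE mulrA mulfV ?gt_eqF// mul1r (bigD1 l)//= lerDl sumr_ge0// => i _.
by rewrite subr_ge0 cos_char_le1.
Qed.

Lemma gap_le_symbol k : k != i0 -> lam1 <= lam k.
Proof.
move=> k0; have [l kl] : exists l, k l != 0.
  apply/existsP; apply: contraNT k0; rewrite negb_exists => /forallP k0.
  by apply/eqP/ffunP => i; rewrite ffunE; apply/eqP; rewrite -[_ == _]negbK.
rewrite /lam1 ler_pdivrMr// mulrC; apply: le_trans (coord_le k l).
exact: gap_le.
Qed.

(** The [2 d] frequencies carrying the smallest positive eigenvalue. *)
Definition first_shell : {set torus d n} :=
  [set coord_shift p.1 (unit_step p.2) i0 | p in predT : pred ('I_d * bool)]%SET.

Lemma card_first_shell : (#|first_shell| <= 2 * d)%N.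
Proof.
apply: leq_trans (leq_imset_card _ _) _.
by rewrite card_prod card_ord card_bool mulnC.
Qed.

Lemma symbol_first_shell k : k \in first_shell -> lam k = lam1.
Proof.
case/imsetP => -[l b] _ -> /=; rewrite symbolE mulrC; congr (_ / _).
rewrite (bigD1 l)//= big1 ?addr0.
  rewrite !ffunE eqxx add0r; rewrite /gap cycle_gapE//.
  by case: b => //=; have [-> _] := @char_opp R n n3 1.
by move=> i il; rewrite !ffunE (negbTE il) addr0 cos_char0; exact: subrr.
Qed.

Lemma origin_notin_first_shell : i0 \notin first_shell.
Proof.
apply/negP => /symbol_first_shell; rewrite symbol_origin => /esym/eqP.
by rewrite gt_eqF// divr_gt0// cycle_gap_gt0.
Qed.

Lemma mem_first_shell : exists k, k \in first_shell.
Proof.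
exists (coord_shift (Ordinal d1) (unit_step true) i0); apply/imsetP.
by exists (Ordinal d1, true).
Qed.

(** Either two coordinates are nonzero and each contributes the gap, or the only
nonzero one differs from [1] and [-1]. *)
Lemma two_gap_le_symbol k : k != i0 -> k \notin first_shell -> 2 * lam1 <= lam k.
Proof.
move=> k0 ks; have [l kl] : exists l, k l != 0.
  apply/existsP; apply: contraNT k0; rewrite negb_exists => /forallP k0.
  by apply/eqP/ffunP => i; rewrite ffunE; apply/eqP; rewrite -[_ == _]negbK.
rewrite /lam1 mulrA ler_pdivrMr// [leRHS]mulrC.
have [/existsP[l' /andP[ll' kl']]|/existsPn single] :=
    boolP [exists l', (l' != l) && (k l' != 0)].
  rewrite symbolE mulrA mulfV ?gt_eqF// mul1r (bigD1 l)//= (bigD1 l')//=.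
  have h1 := gap_le (R := R) n6 kl; have h2 := gap_le (R := R) n6 kl'.
  have : 0 <= \sum_(i | (i != l) && (i != l')) (1 - cos_char (k i)) :> R.
    by rewrite sumr_ge0// => i _; rewrite subr_ge0 cos_char_le1.
  by move: h1 h2; rewrite -/gap; lra.
apply: le_trans (coord_le k l).
have kE b : k l = unit_step b -> k \in first_shell.
  move=> klE; apply/imsetP; exists (l, b) => //=; apply/ffunP => i.
  rewrite !ffunE add0r; case: eqP => [->//|/eqP il].
  by have := single i; rewrite il /= negbK => /eqP.
apply: two_gap_le => //; apply: contra ks => /eqP E.
  exact: (kE true).
exact: (kE false).
Qed.

(** The first shell is where the tilted kernel has its small denominators and its
slow decay; it pays because it has only [2 d] members. *)
Lemma sum_shells (F : torus d n -> R) (x : R) : 0 <= x ->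
  (forall k, k \in first_shell -> F k <= x) ->
  \sum_(k | k != i0) F k <=
  (2 * d)%:R * x + \sum_(k | (k != i0) && (k \notin first_shell)) F k.
Proof.
move=> x0 Fx; rewrite (bigID (mem first_shell)) /= lerD2r.
apply: (@le_trans _ _ (\sum_(k in first_shell) x)).
  have -> : \sum_(i | (i != i0) && (i \in first_shell)) F i =
      \sum_(i in first_shell) F i.
    apply: eq_bigl => k; case: eqP => [->|//].
    by rewrite (negbTE origin_notin_first_shell).
  exact: ler_sum.
by rewrite sumr_const -[leLHS]mulr_natl ler_wpM2r// ler_nat card_first_shell.
Qed.

Let Kn : #|torus d n|%:R = n%:R ^+ d :> R.
Proof. by rewrite card_torus// natrX. Qed.

Variable (a3 : R).
Hypothesis a3_ge : 16384 <= a3.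
Let mu := 2 * lam1 - a3 / n%:R ^+ (d + 4).
Let delta := a3 / n%:R ^+ (d + 4).
Let delta0 : 0 < delta.
Proof. by rewrite divr_gt0 ?exprn_gt0//; have := a3_ge; lra. Qed.

Lemma spectral_gap_le : lam1 <= 32 / (d%:R * n%:R ^+ 2).
Proof.
rewrite /lam1 invfM mulrCA [leRHS]mulrC ler_pM2r//; exact: cycle_gap_le.
Qed.

Lemma spectral_gap_gt0 : 0 < lam1.
Proof. by rewrite divr_gt0// cycle_gap_gt0. Qed.

(** For [mu <= 2 lam1] the left-hand side is at most
[x ^ 2 / (2 (x - lam1))] with [x = lam k >= 2 lam1], and this exceeds its leading
part [x / 2] by at most [lam1]. *)
Lemma mass_outside_first_shell k : k != i0 -> k \notin first_shell ->
  lam k ^+ 2 / (2 * lam k - mu) <= lam k / 2 + lam1.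
Proof.
move=> k0 ks; have h := two_gap_le_symbol k0 ks; have l0 := spectral_gap_gt0.
have d1' := delta0.
have mE : mu = 2 * lam1 - delta by [].
have p : 0 < 2 * lam k - mu by rewrite mE; lra.
rewrite ler_pdivrMr//.
apply: (@le_trans _ _ ((lam k / 2 + lam1) * (2 * (lam k - lam1)))).
  by have : 0 <= lam1 * (lam k - 2 * lam1); [rewrite mulr_ge0//; lra|lra].
by apply: ler_wpM2l; rewrite ?mE; lra.
Qed.

(** The bound is [1/2 + 1/8 + 1/8]: the mean of [lam / 2], the excess [lam1], small
for [n >= 16], and the first shell, whose share is at most [2048 / a3] as
[lam1 <= 32 / (d n ^ 2)] and [2 * 32 ^ 2 = 2048]; this is where
[16384 = 8 * 2048] comes from. *)
Lemma torus_kernel_mass : (16 <= n)%N ->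
  #|torus d n|%:R^-1 * \sum_(k | k != i0) lam k ^+ 2 / (2 * lam k - mu) <= 3 / 4.
Proof.
move=> n16; have l0 := spectral_gap_gt0; have dl0 := delta0.
have K0 : 0 < #|torus d n|%:R :> R by rewrite Kn exprn_gt0.
have l32 := spectral_gap_le.
have d1R : 1 <= d%:R :> R by rewrite ler1n.
have mE : mu = 2 * lam1 - delta by [].
rewrite mulrC ler_pdivrMr//.
apply: le_trans (sum_shells (x := lam1 ^+ 2 / delta) _ _) _.
- by rewrite divr_ge0 ?sqr_ge0// ltW.
- by move=> k /symbol_first_shell ->; rewrite mE opprB addrCA subrr addr0.
have inner : (2 * d)%:R * (lam1 ^+ 2 / delta) <= #|torus d n|%:R / 8.
  have n4 : 0 < n%:R ^+ 2 :> R by rewrite exprn_gt0.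
  have dn0 : 0 < d%:R * n%:R ^+ 2 :> R by rewrite mulr_gt0.
  have sq : lam1 ^+ 2 <= (32 / (d%:R * n%:R ^+ 2)) ^+ 2 by apply: ler_expn => //; exact: ltW.
  have -> : lam1 ^+ 2 / delta = lam1 ^+ 2 * (n%:R ^+ (d + 4) / a3) by rewrite /delta invf_div.
  have a0 : 0 < a3 by have := a3_ge; lra.
  have q0 : 0 <= (2 * d)%:R * (n%:R ^+ (d + 4) / a3).
    by rewrite mulr_ge0// divr_ge0 ?exprn_ge0 ?ltW.
  apply: (@le_trans _ _ ((2 * d)%:R * (n%:R ^+ (d + 4) / a3) * (32 / (d%:R * n%:R ^+ 2)) ^+ 2)).
    by rewrite mulrA mulrAC ler_wpM2l.
  rewrite Kn exprD natrM.
  have -> : 2 * d%:R * (n%:R ^+ d * n%:R ^+ 4 / a3) * (32 / (d%:R * n%:R ^+ 2)) ^+ 2 =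
     n%:R ^+ d * (2048 / (d%:R * a3)) :> R by field; rewrite !gt_eqF.
  rewrite ler_pM2l ?exprn_gt0// ler_pdivrMr ?mulr_gt0//.
  by have := a3_ge; have : a3 <= d%:R * a3; [rewrite ler_peMl// ltW|lra].
have outer : \sum_(k | (k != i0) && (k \notin first_shell)) lam k ^+ 2 / (2 * lam k - mu)
   <= #|torus d n|%:R / 2 + #|torus d n|%:R * lam1.
  apply: (@le_trans _ _ (\sum_(k | (k != i0) && (k \notin first_shell)) (lam k / 2 + lam1))).
    by apply: ler_sum => k /andP[k0 ks]; exact: mass_outside_first_shell.
  have -> : #|torus d n|%:R / 2 + #|torus d n|%:R * lam1 = \sum_k (lam k / 2 + lam1).
    by rewrite big_split /= -mulr_suml symbol_mean sumr_const -[lam1 *+ _]mulr_natl.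
  rewrite [leRHS](bigID (fun k => (k != i0) && (k \notin first_shell))) /= lerDl.
  apply: sumr_ge0 => k _; apply: addr_ge0; last exact: ltW.
  have [->|k0] := eqVneq k i0; first by rewrite symbol_origin mul0r.
  by have := gap_le_symbol k0; lra.
have l8 : lam1 <= 1 / 8.
  apply: le_trans l32 _; rewrite ler_pdivrMr ?mulr_gt0 ?exprn_gt0//.
  have : 256 <= n%:R ^+ 2 :> R.
    by rewrite -natrX ler_nat (@leq_trans (16 ^ 2)) // leq_sqr.
  move=> n256; have : n%:R ^+ 2 <= d%:R * n%:R ^+ 2 :> R by rewrite ler_peMl//; lra.
  lra.
have : #|torus d n|%:R * lam1 <= #|torus d n|%:R * (1 / 8) by rewrite ler_pM2l.
lra.
Qed.

End torus_spectrum.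

(** * Heat kernel bounds *)

Section heat_kernel.
Context {R : realType}.

(** Comparison of the sum with the integral of [A ^ 2 / (A + x) ^ 2]. *)
Lemma inverse_square_sum (A : R) m : 0 < A ->
  \sum_(a < m.+1) (A / (A + a%:R)) ^+ 2 <= 1 + A.
Proof.
move=> A0; suff : \sum_(a < m.+1) (A / (A + a%:R)) ^+ 2 <= 1 + A - A ^+ 2 / (A + m%:R).
  move=> h; apply: le_trans h _; rewrite gerBl divr_ge0 ?sqr_ge0//.
  by rewrite addr_ge0// ltW.
elim: m => [|m IH].
  by rewrite big_ord1 addr0 divff ?gt_eqF// expr1n expr2 mulfK ?gt_eqF//; lra.
rewrite big_ord_recr /=; apply: le_trans (lerD IH (lexx _)) _.
have p0 : 0 < A + m%:R by rewrite ltr_wpDr.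
rewrite -natr1 addrA; set t := A + m%:R in p0 *.
have -> : 1 + A - A ^+ 2 / t + (A / (t + 1)) ^+ 2 =
    1 + A - A ^+ 2 / (t + 1) - A ^+ 2 / (t * (t + 1) ^+ 2).
  by field; rewrite !gt_eqF//; lra.
rewrite gerBl divr_ge0 ?sqr_ge0// mulr_ge0 ?sqr_ge0// ltW//.
Qed.

Context {n : nat}.
Hypothesis n6 : (6 <= n)%N.
Let n3 : (2 < n)%N. Proof. exact: leq_trans n6. Qed.
Let n0 : 0 < n%:R :> R. Proof. by rewrite ltr0n (leq_trans _ n6). Qed.

Lemma sum_Zn (F : nat -> R) : \sum_(z : 'Z_n) F (val z) = \sum_(a < n) F a.
Proof.
rewrite -(big_mkord predT F) -(big_mkord predT F); congr bigop.
by rewrite Zp_cast// (ltn_trans _ n3).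
Qed.

(** Each distance occurs at most twice on the cycle. *)
Lemma sum_cycle_norm (f : nat -> R) : (forall a, 0 <= f a) ->
  \sum_(z : 'Z_n) f (cycle_norm z) <= 2 * \sum_(a < n.+1) f a.
Proof.
move=> f0; apply: (@le_trans _ _ (\sum_(z : 'Z_n) (f (val z) + f (n - val z)%N))).
  apply: ler_sum => z _; rewrite /cycle_norm /minn; case: ifP => _.
    by rewrite lerDl.
  by rewrite lerDr.
rewrite big_split /= sum_Zn (sum_Zn (fun a => f (n - a)%N)) mulr2n mulrDl mul1r lerD//.
  by rewrite [leRHS]big_ord_recr /= lerDl.
rewrite (reindex_inj rev_ord_inj) /= big_ord_recl /=.
apply: ler_wpDl => //; apply: ler_sum => i _.
by rewrite subKn.
Qed.

Lemma cycle_norm_double (z : 'Z_n) : (cycle_norm z * 2 <= n)%N.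
Proof.
rewrite /cycle_norm; have := ltn_Zn n3 z; move: (val z) => a an; clear -an.
by lia.
Qed.

Variable (d : nat).
Hypothesis d1 : (1 <= d)%N.
Let d0 : 0 < d%:R :> R. Proof. by rewrite ltr0n. Qed.

Definition cycle_heat_constant : R := 8 * d%:R / cos 1 ^+ 2.

Let cc0 : 0 < cos 1 ^+ 2 :> R. Proof. exact/exprn_gt0/cos1_gt0. Qed.

(** From [exp (- x) <= 1 / (1 + x)] and the quadratic lower bound on [1 - cos], the
summand at [z] is at most a multiple of [(A / (A + |z|)) ^ 2] with
[A = n / sqrt (1 + s)], and the sum over the cycle of these is of order [1 + A].
After division by [n] this is the profile. *)
Lemma cycle_heat_le (s : R) : 0 <= s ->
  n%:R^-1 * \sum_(z : 'Z_n) expR (- (s / (2 * d%:R) * (1 - cos_char z))) <=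
  cycle_heat_constant * profile n%:R s.
Proof.
move=> s0.
have [w wE] : exists w : R, w = (Num.sqrt (1 + s))^-1 by eexists.
have w0 : 0 < w by rewrite wE invr_gt0 sqrtr_gt0; lra.
have w2 : w ^+ 2 * (1 + s) = 1.
  by rewrite wE exprVn sqr_sqrtr ?mulVf//; [rewrite gt_eqF//|]; lra.
have c1 : cos 1 ^+ 2 <= 1 :> R by rewrite expr_le1// ?cos_le1// ltW// cos1_gt0.
pose kap : R := cos 1 ^+ 2 / (2 * d%:R).
have kap0 : 0 < kap by rewrite divr_gt0// mulr_gt0.
have kap1 : kap <= 1 / 2.
  rewrite ler_pdivrMr ?mulr_gt0//; have : 1 <= d%:R :> R by rewrite ler1n.
  by move: c1; lra.
pose A : R := n%:R * w.
have A0 : 0 < A by rewrite mulr_gt0.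
have pt (z : 'Z_n) : expR (- (s / (2 * d%:R) * (1 - cos_char z))) <=
    2 / kap * (A / (A + (cycle_norm z)%:R)) ^+ 2.
  pose r : R := (cycle_norm z)%:R / n%:R.
  have r0 : 0 <= r by rewrite divr_ge0.
  have r1 : r <= 1 / 2.
    rewrite ler_pdivrMr// mulrC mulrA mulr1 ler_pdivlMr// -natrM ler_nat.
    exact: cycle_norm_double.
  have AE : A / (A + (cycle_norm z)%:R) = w / (w + r).
    have -> : A + (cycle_norm z)%:R = n%:R * (w + r).
      by rewrite /A /r mulrDr [_ * (_ / _)]mulrC divfK ?gt_eqF.
    by rewrite -mulf_div divff ?gt_eqF// mul1r.
  have xge : s * (2 * kap) * r ^+ 2 <= s / (2 * d%:R) * (1 - cos_char z).
    have := one_sub_cos_char_ge (R := R) n3 z; rewrite -/r => h.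
    have -> : s * (2 * kap) * r ^+ 2 = s / (2 * d%:R) * (2 * cos 1 ^+ 2 * r ^+ 2).
      by rewrite /kap; field; rewrite gt_eqF.
    by apply: ler_wpM2l => //; rewrite divr_ge0// mulr_ge0// ltW.
  set x := s / _ * _ in xge *.
  have y0 : 0 <= s * (2 * kap) * r ^+ 2.
    by apply: mulr_ge0; rewrite ?sqr_ge0// mulr_ge0// mulr_ge0// ltW.
  have x0 : 0 <= x by exact: le_trans xge.
  apply: (@le_trans _ _ (1 + x)^-1).
    by rewrite expRN lef_pV2 ?posrE ?expR_gt0 ?expR_ge1Dx//; lra.
  apply: (@le_trans _ _ (1 + s * (2 * kap) * r ^+ 2)^-1).
    by rewrite lef_pV2 ?posrE; lra.
  have wr0 : 0 < w + r by rewrite ltr_wpDr.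
  have y1 : 0 < 1 + s * (2 * kap) * r ^+ 2 by lra.
  rewrite AE -(ler_pM2r y1) mulVf ?gt_eqF//.
  have -> : 2 / kap * (w / (w + r)) ^+ 2 * (1 + s * (2 * kap) * r ^+ 2) =
      2 * w ^+ 2 * (1 + s * (2 * kap) * r ^+ 2) / (kap * (w + r) ^+ 2).
    by field; rewrite !gt_eqF.
  have kwr : 0 < kap * (w + r) ^+ 2 by rewrite mulr_gt0// exprn_gt0.
  rewrite ler_pdivlMr// mul1r.
  have r2 : r ^+ 2 <= 1 / 4 by rewrite expr2; nra.
  have sq : (w + r) ^+ 2 <= 2 * (w ^+ 2 + r ^+ 2).
    by have := sqr_ge0 (w - r); rewrite !expr2; lra.
  have main : kap * (w ^+ 2 + r ^+ 2) <= w ^+ 2 * (1 + s * (2 * kap) * r ^+ 2).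
    have -> : w ^+ 2 + r ^+ 2 = w ^+ 2 * (1 + r ^+ 2 * (1 + s)).
      by rewrite mulrDr mulr1 mulrCA w2 mulr1.
    rewrite mulrCA; apply: ler_wpM2l; first exact: sqr_ge0.
    have : 0 <= kap * (s * r ^+ 2).
      by apply: mulr_ge0; [exact: ltW|rewrite mulr_ge0 ?sqr_ge0].
    have : kap * (1 + r ^+ 2) <= 1 / 2 * (5 / 4).
      by apply: ler_pM; rewrite ?(ltW kap0)//; have := sqr_ge0 r; lra.
    lra.
  have : kap * (w + r) ^+ 2 <= kap * (2 * (w ^+ 2 + r ^+ 2)) by rewrite ler_pM2l.
  lra.
apply: (@le_trans _ _ (n%:R^-1 * (2 / kap * (2 * (1 + A))))).
  apply: ler_wpM2l; first by rewrite invr_ge0 ltW.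
  apply: (@le_trans _ _ (\sum_(z : 'Z_n) 2 / kap * (A / (A + (cycle_norm z)%:R)) ^+ 2)).
    by apply: ler_sum => z _; exact: pt.
  rewrite -mulr_sumr; apply: ler_wpM2l; first by rewrite divr_ge0// ltW.
  apply: le_trans (sum_cycle_norm (f := fun a => (A / (A + a%:R)) ^+ 2) _) _.
    by move=> a; exact: sqr_ge0.
  by rewrite ler_wpM2l// inverse_square_sum.
have -> : cycle_heat_constant * profile n%:R s = n%:R^-1 * (2 / kap * (2 * (1 + A))).
  rewrite /cycle_heat_constant /profile -wE /A /kap; field.
  by rewrite !gt_eqF// cos1_gt0.
exact: lexx.
Qed.

Let K : R := #|torus d n|%:R.

(** The heat kernel of the torus is a product over the coordinates. *)
Lemma torus_heat_le (s : R) : 0 <= s ->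
  K^-1 * \sum_(k : torus d n) expR (- (s / 2 * symbol k)) <=
  (cycle_heat_constant * profile n%:R s) ^+ d.
Proof.
move=> s0; rewrite /K card_torus//.
have -> : \sum_(k : torus d n) expR (- (s / 2 * symbol k)) =
   \prod_(l < d) \sum_(z : 'Z_n) expR (- (s / (2 * d%:R) * (1 - cos_char z))).
  rewrite bigA_distr_bigA /=; apply: eq_bigr => k _.
  rewrite -expR_sum; congr expR; rewrite symbolE// sumrN; congr (- _).
  by rewrite -mulr_sumr mulrA; congr (_ * _); rewrite invfM mulrA.
have -> : (n ^ d)%:R^-1 = \prod_(l < d) n%:R^-1 :> R.
  by rewrite prodr_const card_ord natrX exprVn.
rewrite -big_split /= prodr_const card_ord.
apply: ler_expn; last exact: cycle_heat_le.
by rewrite mulr_ge0 ?invr_ge0 ?(ltW n0)// sumr_ge0// => z _; exact: expR_ge0.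
Qed.

End heat_kernel.

Section torus_kernel.
Context {R : realType} {d n : nat}.
Hypothesis n6 : (6 <= n)%N.
Hypothesis d1 : (1 <= d)%N.

Let n3 : (2 < n)%N. Proof. exact: leq_trans n6. Qed.
Let n0 : 0 < n%:R :> R. Proof. by rewrite ltr0n (leq_trans _ n6). Qed.
Let d0 : 0 < d%:R :> R. Proof. by rewrite ltr0n. Qed.
Let n1 : 1 <= n%:R :> R. Proof. by rewrite ler1n (leq_trans _ n6). Qed.

Let gap : R := cycle_gap n.
Let i0 := origin d n.
Let lam1 : R := gap / d%:R.
Let lam : torus d n -> R := symbol.
Let K : R := #|torus d n|%:R.
Let Kn : K = n%:R ^+ d.
Proof. by rewrite /K card_torus// natrX. Qed.
Let K0 : 0 < K. Proof. by rewrite Kn exprn_gt0. Qed.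

Let lam_ge0 k : 0 <= lam k.
Proof.
have [->|/gap_le_symbol] := eqVneq k i0; first by rewrite /lam symbol_origin.
by move=> /(_ R n6 d1); apply: le_trans; exact/ltW/spectral_gap_gt0.
Qed.

Definition kernel_constant : R := 2048 + 36 * @cycle_heat_constant R d ^+ d.

(** Half of the exponential absorbs [x ^ 2]: with [E = exp (- s x / 4)], both
[x E <= 2] and [s x E <= 4], so that [(1 + s) x E <= 6] and [36 = 6 ^ 2]. *)
Lemma sqr_expR_le (x s : R) : 0 <= x -> x <= 2 -> 0 <= s ->
  x ^+ 2 * expR (- (s * x)) <=
  36 * ((Num.sqrt (1 + s))^-1) ^+ 4 * expR (- (s / 2 * x)).
Proof.
move=> x0 x2 s0.
have [w wE] : exists w : R, w = (Num.sqrt (1 + s))^-1 by eexists.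
have w2 : w ^+ 2 * (1 + s) = 1.
  by rewrite wE exprVn sqr_sqrtr ?mulVf//; [rewrite gt_eqF//|]; lra.
rewrite -wE; have -> : - (s * x) = - (s / 2 * x) + (- (s / 4 * x) + - (s / 4 * x)) by field.
rewrite expRD mulrCA mulrC; apply: ler_wpM2r; first exact: expR_ge0.
rewrite expRD -expr2 -exprMn; set E := expR _.
have E0 : 0 <= E by exact: expR_ge0.
have y0 : 0 <= s / 4 * x by rewrite mulr_ge0 ?divr_ge0.
have E1 : E <= 1 by rewrite expR_le1 oppr_le0.
have yE : s / 4 * x * E <= 1.
  rewrite /E expRN ler_pdivrMr ?expR_gt0// mul1r.
  by apply: le_trans (expR_ge1Dx _); rewrite lerDr.
have -> : 36 * w ^+ 4 = (6 * w ^+ 2) ^+ 2 by ring.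
apply: ler_expn; first by rewrite mulr_ge0.
have s1 : 0 < 1 + s by lra.
rewrite -(ler_pM2r s1) -[leRHS]mulrA w2 mulr1.
have xE : x * E <= 2 * 1 by apply: ler_pM.
lra.
Qed.

Variable (a3 : R).
Hypothesis a3_gt0 : 0 < a3.
Let mu := 2 * lam1 - a3 / n%:R ^+ (d + 4).

(** On the first shell [lam1 ^ 2] is already of order [n ^ (- 4)] and the average
over the torus gives [n ^ (- d)], with [2048 = 2 * 32 ^ 2].  Elsewhere
[2 lam - mu >= lam], and the two factors [lam] are worth four powers of the
profile in addition to the [d] of the heat kernel. *)
Lemma torus_kernel_decay (s : R) : 0 <= s ->
  K^-1 * \sum_(k | k != i0) lam k ^+ 2 * expR (- (s * (2 * lam k - mu))) <=
  kernel_constant * profile n%:R s ^+ (d + 4).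
Proof.
move=> s0; have l0 := spectral_gap_gt0 (R := R) n6 d1.
have a0 : 0 < a3 / n%:R ^+ (d + 4) by rewrite divr_gt0// exprn_gt0.
have mE : mu < 2 * lam1 by rewrite /mu; lra.
set H := profile n%:R s; have H0 : 0 < H by exact: profile_gt0.
have HN : n%:R^-1 <= H by rewrite /H /profile lerDr invr_ge0 sqrtr_ge0.
have Hw : (Num.sqrt (1 + s))^-1 <= H by rewrite /H /profile lerDl invr_ge0 ltW.
have w0 : 0 <= (Num.sqrt (1 + s))^-1 by rewrite invr_ge0 sqrtr_ge0.
rewrite /kernel_constant mulrDl mulrC ler_pdivrMr//.
apply: le_trans (sum_shells n6 d1 (x := lam1 ^+ 2) _ _) _; first exact: sqr_ge0.
  move=> k ks; have /= kE := symbol_first_shell (R := R) n6 d1 ks.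
  rewrite /lam kE -/gap -/lam1 ler_piMr ?sqr_ge0// expR_le1 oppr_le0 mulr_ge0//; lra.
rewrite mulrDl; apply: lerD.
  have l32 := spectral_gap_le (R := R) n6 d1; rewrite -/gap -/lam1 in l32.
  have sq : lam1 ^+ 2 <= (32 / (d%:R * n%:R ^+ 2)) ^+ 2 by apply: ler_expn => //; exact: ltW.
  apply: (@le_trans _ _ ((2 * d)%:R * (32 / (d%:R * n%:R ^+ 2)) ^+ 2)).
    by rewrite ler_wpM2l.
  have -> : (2 * d)%:R * (32 / (d%:R * n%:R ^+ 2)) ^+ 2 =
      2048 / d%:R * (n%:R^-1 ^+ (d + 4)) * K.
    by rewrite Kn natrM exprVn exprD; field; rewrite ?expf_neq0 ?gt_eqF ?exprn_gt0.
  rewrite ler_pM2r//; apply: ler_pM.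
  - exact: divr_ge0 (ler0n _ _) (ler0n _ _).
  - by rewrite exprn_ge0// invr_ge0 ltW.
  - by rewrite ler_pdivrMr// ler_peMr ?ler0n// ler1n.
  - by apply: ler_expn => //; rewrite invr_ge0 ltW.
apply: (@le_trans _ _ (\sum_(k : torus d n) 36 * H ^+ 4 * expR (- (s / 2 * lam k)))).
  rewrite [leRHS](bigID (fun k => (k != i0) && (k \notin first_shell))) /=.
  apply: ler_wpDr.
    rewrite sumr_ge0// => k _; apply: mulr_ge0; last exact: expR_ge0.
    by rewrite mulr_ge0// exprn_ge0// ltW.
  apply: ler_sum => k /andP[k0 ks].
  have h := two_gap_le_symbol (R := R) n6 d1 k0 ks; rewrite -/gap -/lam1 -/(lam k) in h.
  apply: (@le_trans _ _ (lam k ^+ 2 * expR (- (s * lam k)))).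
    rewrite ler_wpM2l ?sqr_ge0// ler_expR lerN2 ler_wpM2l//; lra.
  apply: le_trans (sqr_expR_le _ _ s0) _ => //; first exact: symbol_le2.
  rewrite ler_wpM2r ?expR_ge0// ler_wpM2l//.
  exact: ler_expn.
rewrite -mulr_sumr.
have := torus_heat_le (R := R) n6 d1 s0; rewrite -/K mulrC ler_pdivrMr// => h.
apply: (@le_trans _ _ (36 * H ^+ 4 * ((cycle_heat_constant d * H) ^+ d * K))).
  by rewrite ler_wpM2l// mulr_ge0// exprn_ge0// ltW.
by rewrite le_eqVlt; apply/orP; left; apply/eqP; rewrite exprMn exprD; ring.
Qed.

Lemma spectral_gap_ge : 2 * cos 1 ^+ 2 / d%:R / n%:R ^+ 2 <= lam1.
Proof. by rewrite /lam1 mulrAC ler_pM2r ?invr_gt0//; exact: cycle_gap_ge. Qed.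

End torus_kernel.

(** * Lower bounds by low frequencies *)

Section lower_bound.
Context {R : realType} {d n : nat}.
Hypothesis n6 : (6 <= n)%N.
Hypothesis d1 : (1 <= d)%N.

Let n3 : (2 < n)%N. Proof. exact: leq_trans n6. Qed.
Let n0 : 0 < n%:R :> R. Proof. by rewrite ltr0n (leq_trans _ n6). Qed.
Let d0 : 0 < d%:R :> R. Proof. by rewrite ltr0n. Qed.

Let i0 := origin d n.
Let lam1 : R := cycle_gap n / d%:R.
Let lam : torus d n -> R := symbol.
Let K : R := #|torus d n|%:R.
Let Kn : K = n%:R ^+ d.
Proof. by rewrite /K card_torus// natrX. Qed.
Let K0 : 0 < K. Proof. by rewrite Kn exprn_gt0. Qed.

(** On the box of frequencies used below [lam k <= 512 / t], whence
[exp (- 2 t lam k) >= exp (- 1024)]. *)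
Definition mode_constant (b : nat) : R :=
  (2 * cos 1 ^+ 2 / d%:R) ^+ b * expR (- 1024).

Lemma card_frequency_box (r : nat) : (2 * r <= n)%N ->
  #|[pred k : torus d n | [forall l, (r <= val (k l) < 2 * r)%N]]| = (r ^ d)%N.
Proof.
move=> rn; have cE : #|[pred z : 'Z_n | (r <= val z < 2 * r)%N]| = r.
  rewrite -sum1_card.
  rewrite (eq_bigl (fun z : 'I_(Zp_trunc n).+2 => (r <= z < 2 * r)%N)); last by [].
  rewrite -(big_mkord (fun a => (r <= a < 2 * r)%N) (fun=> 1%N)).
  rewrite Zp_cast ?(ltn_trans _ n3)//.
  under eq_bigl do rewrite andbC.
  rewrite -(big_nat_widenl r 0)//.
  have -> : (\sum_(r <= a < n | a < 2 * r) 1 = \sum_(r <= a < 2 * r) 1)%N.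
    by rewrite (big_nat_widen r (2 * r) n predT).
  by rewrite sum_nat_const_nat muln1 mul2n -addnn addnK.
transitivity (#|[pred z : 'Z_n | (r <= val z < 2 * r)%N]| ^ #|'I_d|)%N; last first.
  by rewrite cE card_ord.
rewrite -card_ffun_on; apply: eq_card => k; rewrite !inE.
by apply/forallP/forallP => h l; exact: (h l).
Qed.

(** Below the relaxation time [n ^ 2], with [r] of order [n / sqrt t], there are
[r ^ d] frequencies with all coordinates in [[r, 2 r)]; on these [lam k] is of
order [1 / t].  Above it, one frequency of the first shell suffices.  The
condition [64 <= t] makes [4 r <= n], so that coordinates below [2 r] coincide
with their distance to 0. *)
Lemma modes_ge (b : nat) (t : R) : 64 <= t ->
  mode_constant b * expR (- (2 * lam1 * t)) /
    Num.min (Num.sqrt t ^+ (d + 2 * b)) (n%:R ^+ (d + 2 * b)) <=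
  K^-1 * \sum_(k | k != i0) lam k ^+ b * expR (- (2 * lam k * t)).
Proof.
rewrite /mode_constant; have [e eE] : exists e : R, e = expR (- 1024) by eexists.
have e0 : 0 < e by rewrite eE; exact: expR_gt0.
have e1 : e <= 1 by rewrite eE expR_le1; lra.
rewrite -eE; move=> t64; have t0 : 0 < t by lra.
have cc0 : 0 < cos 1 ^+ 2 :> R by exact/exprn_gt0/cos1_gt0.
have cc2 : 0 < 2 * cos 1 ^+ 2 :> R by rewrite mulr_gt0.
have l0 : 0 < lam1 := spectral_gap_gt0 (R := R) n6 d1.
have c0 : 0 < 2 * cos 1 ^+ 2 / d%:R :> R by rewrite divr_gt0// mulr_gt0.
have F0 k : k != i0 -> 0 <= lam k ^+ b * expR (- (2 * lam k * t)).
  move=> /(gap_le_symbol (R := R) n6 d1) lk.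
  by rewrite mulr_ge0 ?expR_ge0// exprn_ge0//; apply: le_trans lk; exact: ltW.
have [sn|ns] := leP (Num.sqrt t ^+ (d + 2 * b)) (n%:R ^+ (d + 2 * b)); last first.
  have [k0 ks] := mem_first_shell (n := n) d1.
  have kE : lam k0 = lam1 := symbol_first_shell (R := R) n6 d1 ks.
  have k00 : k0 != i0.
    by apply: contraTneq ks => ->; exact: (origin_notin_first_shell (R := R)).
  rewrite [leRHS]mulrC ler_pdivlMr// (bigD1 k0)//=.
  apply: ler_wpDr; first by rewrite sumr_ge0// => k /andP[/F0].
  rewrite kE Kn exprD.
  have -> : (2 * cos 1 ^+ 2 / d%:R) ^+ b * e * expR (- (2 * lam1 * t)) /
     (n%:R ^+ d * n%:R ^+ (2 * b)) * n%:R ^+ d =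
     (2 * cos 1 ^+ 2 / d%:R / n%:R ^+ 2) ^+ b * (e * expR (- (2 * lam1 * t))).
    set c := 2 * cos 1 ^+ 2 / d%:R; rewrite exprM [in RHS]expr_div_n; field; by rewrite ?expf_neq0 ?gt_eqF ?exprn_gt0.
  apply: ler_pM.
  - by rewrite exprn_ge0// divr_ge0 ?exprn_ge0// ltW.
  - by rewrite mulr_ge0 ?expR_ge0 ?(ltW e0).
  - apply: ler_expn; last exact: spectral_gap_ge.
    by rewrite divr_ge0 ?exprn_ge0// ltW.
  - by rewrite ler_piMl ?expR_ge0.
have st0 : 0 < Num.sqrt t by rewrite sqrtr_gt0.
have st2 : Num.sqrt t ^+ 2 = t by rewrite sqr_sqrtr// ltW.
have st8 : 8 <= Num.sqrt t.
  by rewrite -(@ler_pXn2r _ 2)// ?nnegrE ?(ltW st0)// st2; lra.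
have stn : Num.sqrt t <= n%:R.
  by move: sn; rewrite ler_pXn2r ?nnegrE ?(ltW st0)// addn_gt0 d1.
pose r := (Num.truncn (n%:R / Num.sqrt t)).+1.
have x1 : 1 <= n%:R / Num.sqrt t by rewrite ler_pdivlMr// mul1r.
have r_ge : n%:R / Num.sqrt t <= r%:R by exact/ltW/truncnS_gt.
have r_le : r%:R <= 2 * (n%:R / Num.sqrt t).
  rewrite /r -natr1 mulr2n mulrDl mul1r lerD//.
  by rewrite truncn_le; lra.
have r4n : 4 * r%:R <= n%:R :> R.
  apply: (@le_trans _ _ (4 * (2 * (n%:R / Num.sqrt t)))); first by rewrite ler_pM2l.
  have : n%:R / Num.sqrt t <= n%:R / 8 by rewrite ler_pM2l// lef_pV2 ?posrE.
  by lra.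
have rn : (4 * r <= n)%N by rewrite -(ler_nat R) natrM.
pose box := [pred k : torus d n | [forall l, (r <= val (k l) < 2 * r)%N]].
pose m : R := (2 * cos 1 ^+ 2 / t) ^+ b * e.
have boxP k : k \in box -> k != i0 /\ m <= lam k ^+ b * expR (- (2 * lam k * t)).
  rewrite inE => /forallP kr.
  have cn l : cycle_norm (k l) = val (k l).
    have /andP[_ h] := kr l; apply/minn_idPl; move: (val (k l)) h => v h.
    by clear -h rn; lia.
  have rt l : (Num.sqrt t)^-1 <= (cycle_norm (k l))%:R / n%:R.
    rewrite cn ler_pdivlMr// mulrC; apply: le_trans r_ge _.
    by rewrite ler_nat; have /andP[] := kr l.
  have rt' l : (cycle_norm (k l))%:R / n%:R <= 4 / Num.sqrt t.
    rewrite cn ler_pdivrMr//.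
    apply: (@le_trans _ _ (2 * r%:R)).
      by rewrite -natrM ler_nat ltnW//; have /andP[] := kr l.
    apply: (@le_trans _ _ (2 * (2 * (n%:R / Num.sqrt t)))); first by rewrite ler_pM2l.
    by rewrite le_eqVlt; apply/orP; left; apply/eqP; ring.
  have ge1 l : 2 * cos 1 ^+ 2 / t <= 1 - cos_char (k l).
    apply: le_trans (one_sub_cos_char_ge (R := R) n3 _).
    rewrite ler_pM2l // -[t in leLHS]st2 -exprVn.
    by apply: ler_expn; [rewrite invr_ge0 ltW|exact: rt].
  have le1 l : 1 - cos_char (k l) <= 512 / t.
    apply: le_trans (one_sub_cos_char_le (R := R) n3 _) _.
    have -> : 512 / t = 32 * (4 / Num.sqrt t) ^+ 2.
      by rewrite expr_div_n st2; field; rewrite gt_eqF.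
    by rewrite ler_pM2l//; apply: ler_expn => //; rewrite divr_ge0// ltW.
  have avg (x : R) : x = d%:R^-1 * \sum_(l < d) x.
    by rewrite sumr_const card_ord -[x *+ d]mulr_natl mulrA mulVf ?gt_eqF// mul1r.
  have lam_ge : 2 * cos 1 ^+ 2 / t <= lam k.
    rewrite (avg (2 * _ / t)) /lam symbolE// ler_wpM2l ?invr_ge0 ?(ltW d0)//.
    by apply: ler_sum => l _; exact: ge1.
  have lam_le : lam k <= 512 / t.
    rewrite (avg (512 / t)) /lam symbolE// ler_wpM2l ?invr_ge0 ?(ltW d0)//.
    by apply: ler_sum => l _; exact: le1.
  have c0' : 0 < 2 * cos 1 ^+ 2 / t by rewrite divr_gt0// mulr_gt0.
  split.
    apply: contraTneq lam_ge => ->; rewrite /lam symbol_origin//.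
    by rewrite -ltNge.
  rewrite /m; apply: ler_pM; rewrite ?exprn_ge0 ?(ltW e0) ?(ltW c0')//.
    by apply: ler_expn => //; exact: ltW.
  rewrite eE ler_expR lerN2; move: lam_le; rewrite ler_pdivlMr//.
  by move=> ?; lra.
apply: (@le_trans _ _ (K^-1 * \sum_(k in box) m)); last first.
  rewrite ler_pM2l ?invr_gt0//.
  rewrite [leRHS](bigID (mem box)) /=; apply: ler_wpDr.
    by rewrite sumr_ge0// => k /andP[/F0].
  rewrite [leRHS](eq_bigl (mem box)); last first.
    by move=> k; rewrite /= andbC; case: (boolP (k \in box)) => // /boxP[].
  by apply: ler_sum => k /boxP[].
rewrite sumr_const card_frequency_box; last by clear -rn; lia.
rewrite -[m *+ _]mulr_natl natrX.
have -> : K^-1 * (r%:R ^+ d * m) = (n%:R^-1 * r%:R) ^+ d * m.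
  by rewrite Kn exprMn exprVn mulrA.
have h1 : (Num.sqrt t)^-1 ^+ d <= (n%:R^-1 * r%:R) ^+ d.
  apply: ler_expn; first by rewrite invr_ge0 ltW.
  by rewrite mulrC ler_pdivlMr// mulrC.
apply: (@le_trans _ _ ((Num.sqrt t)^-1 ^+ d * m)); last first.
  rewrite ler_wpM2r// mulr_ge0 ?(ltW e0)// exprn_ge0// divr_ge0 ?(ltW t0)//.
  by rewrite mulr_ge0// ltW.
rewrite /m exprD exprM st2.
have -> : (Num.sqrt t)^-1 ^+ d * ((2 * cos 1 ^+ 2 / t) ^+ b * e) =
   (2 * cos 1 ^+ 2) ^+ b * e / (Num.sqrt t ^+ d * t ^+ b).
  by rewrite expr_div_n exprVn; field; rewrite ?expf_neq0 ?gt_eqF ?exprn_gt0.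
rewrite ler_pM2r ?invr_gt0 ?mulr_gt0 ?exprn_gt0//.
rewrite -[leRHS]mulr1; apply: ler_pM.
- by rewrite mulr_ge0 ?(ltW e0)// exprn_ge0// ltW.
- exact: expR_ge0.
- rewrite ler_wpM2r ?(ltW e0)//; apply: ler_expn; first exact: ltW.
  by rewrite ler_pdivrMr// ler_peMr ?ler1n// mulr_ge0// ltW.
- rewrite expR_le1 oppr_le0; apply: mulr_ge0; last exact: ltW.
  by rewrite mulr_ge0// ltW.
Qed.

End lower_bound.

(** * Paths driven by words *)

Section paths.
Context {R : realType}.

Lemma right_continuous_nat_eq (c : R -> nat) (s : R) :
  c x @[x --> s^'+] --> c s -> exists2 e, 0 < e & forall x, s < x < s + e -> c x = c s.
Proof.
move=> /(_ [set c s]) []; first by rewrite nbhs_principalE.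
move=> e /= e0 sub; exists e => // x /andP[sx xe]; apply: sub => //=.
by rewrite distrC ger0_norm ?subr_ge0 ?ltW// ltrBlDl.
Qed.

(** The jump occurs at the infimum of the times at which the count has increased:
right continuity makes the count increase at the infimum itself. *)
Lemma jump_time (c : R -> nat) (s u : R) : 0 <= s -> s <= u ->
  (forall x y, 0 <= x -> x <= y -> (c x <= c y)%N) ->
  (forall x, 0 <= x -> c y @[y --> x^'+] --> c x) ->
  c u = (c s).+1 ->
  exists r, [/\ s < r, r <= u, rings c r & c r = c u].
Proof.
move=> s0 su mono rc cu.
pose E := [set x | s <= x <= u /\ (c s < c x)%N].
have Eu : E u by split; [rewrite su lexx|rewrite cu].
have lbE : lbound E s by move=> x [/andP[]].
have hE : has_inf E by split; [exists u|exists s].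
have sr : s <= inf E by apply: lb_le_inf => //; exists u.
have ru : inf E <= u by apply: ge_inf => //; exists s.
set r := inf E in sr ru.
have r0 : 0 <= r by exact: le_trans sr.
have cr : (c s < c r)%N.
  rewrite ltnNge; apply/negP => crs.
  have [e e0 ce] := right_continuous_nat_eq (rc r r0).
  have : r + e <= r; last by rewrite gerDl leNgt e0.
  apply: lb_le_inf; first by exists u.
  move=> x [/andP[sx xu] cx]; rewrite leNgt; apply/negP => xe.
  have rx : r <= x by apply: ge_inf; [exists s|split => //; rewrite sx].
  move: rx; rewrite le_eqVlt => /predU1P[rx|rx].
    by move: cx; rewrite -rx ltnNge crs.
  by move: cx; rewrite (ce x) ?rx ?xe// ltnNge crs.
have sltr : s < r by rewrite lt_neqAle sr andbT; apply: contraTneq cr => <-; rewrite ltnn.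
exists r; split => //.
  split; first exact: le_lt_trans sltr.
  move=> x x0 xr; have [xs|sx] := leP x s; first by apply: leq_ltn_trans cr; exact: mono.
  apply: leq_ltn_trans cr; rewrite leqNgt; apply/negP => csx.
  have : r <= x by apply: ge_inf; [exists s|split => //; rewrite (ltW sx) (ltW (lt_le_trans xr ru))].
  by rewrite leNgt xr.
by apply/eqP; rewrite eqn_leq mono// cu cr.
Qed.

Context {d n : nat}.
Hypothesis n3 : (2 < n)%N.
Variables (N : torus d n -> R -> nat) (Y : R -> torus d n -> R).
Hypothesis N_mono : forall k x y, 0 <= x -> x <= y -> (N k x <= N k y)%N.
Hypothesis N_rcont : forall k x, 0 <= x -> N k y @[y --> x^'+] --> N k x.
Hypothesis Y_ring : forall k t, rings (N k) t ->
  Y t k = neighbor_average (fun j => lim (Y s j @[s --> t^'-])) k.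
Hypothesis Y_still : forall k (s t : R), 0 <= s -> s <= t -> N k s = N k t ->
  Y t k = Y s k.

Definition act (o : option (torus d n)) (y : torus d n -> R) : torus d n -> R :=
  if o is Some z then smooth z y else y.

Lemma neighbors_neq (x z : torus d n) : neighbors x z -> x != z.
Proof.
case/existsP => l /andP[xl _]; apply: contraTneq xl => ->.
have -> : (z l == z l + 1) = false.
  by rewrite eq_sym -subr_eq0 addrAC subrr add0r (negbTE (oner_neq0 _)).
by rewrite eq_sym -subr_eq0 addrAC subrr add0r oppr_eq0 (negbTE (oner_neq0 _)).
Qed.

(** If only one clock rings, the neighbours of its site are constant up to the
ringing time, so that the left limits in the evolution rule are the values at
the beginning of the interval. *)
Lemma path_step (s u : R) (o : option (torus d n)) : 0 <= s -> s <= u ->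
  (forall k, (N k u - N k s)%N = (o == Some k)) -> Y u = act o (Y s).
Proof.
move=> s0 su; case: o => [z|] incr; last first.
  apply/funext => k; apply: Y_still => //; apply/eqP.
  by rewrite eqn_leq N_mono//= -subn_eq0 incr.
have still k : k != z -> N k s = N k u.
  move=> kz; apply/eqP; rewrite eqn_leq N_mono//= -subn_eq0 incr.
  by rewrite eqb0 (inj_eq Some_inj) eq_sym.
have nz : N z u = (N z s).+1.
  by have := incr z; rewrite eqxx /= => iz; rewrite -(subnK (N_mono z s0 su)) iz.
have [r [sr ru zr cr]] := jump_time s0 su (@N_mono z) (@N_rcont z) nz.
apply/funext => k /=; rewrite /smooth; case: eqP => [->|/eqP kz]; last first.
  by apply: Y_still => //; exact: still.
rewrite (Y_still (ltW (le_lt_trans s0 sr)) ru cr) (Y_ring zr).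
rewrite /neighbor_average; congr (_ * _); apply: eq_bigr => j /neighbors_neq jz.
apply: lim_near_cst => //.
near=> x; have sx : s <= x by near: x; exact: nbhs_left_ge.
have xr : x <= r by near: x; exact: nbhs_left_le.
apply: Y_still => //; apply/eqP; rewrite eqn_leq N_mono//=.
by rewrite (still j jz) N_mono//; [exact: le_trans sx|exact: le_trans ru].
Unshelve. all: by end_near. Qed.

Lemma path_word (T : nat -> R) (a : seq (option (torus d n))) :
  0 <= T 0%N -> (forall j, T j <= T j.+1) ->
  (forall j k, (j < size a)%N -> (N k (T j.+1) - N k (T j))%N = (nth None a j == Some k)) ->
  Y (T (size a)) = foldl (fun y o => act o y) (Y (T 0%N)) a.
Proof.
move=> T0 TS; have Tj j : 0 <= T j by elim: j => // j IH; exact: le_trans (TS j).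
elim/last_ind: a => [//|a o IH] incr; rewrite size_rcons foldl_rcons -IH.
  apply: path_step => // k; rewrite incr ?size_rcons// nth_rcons ltnn eqxx//.
move=> j k ja; rewrite incr ?size_rcons ?(ltn_trans ja)// nth_rcons ja//.
Qed.

End paths.

(** * Probabilities of words *)

Section words.
Context {R : realType} {disp : measure_display} {Omega : measurableType disp}.
Variable P : probability Omega R.
Context {T : finType}.

Lemma prod_option (F : option T -> R) :
  \prod_(o | o != None) F o = \prod_k F (Some k).
Proof.
rewrite (reindex_omap Some id) /=; last by case.
by apply: eq_bigl => k; rewrite eqxx.
Qed.

Lemma sum_option (F : option T -> R) : \sum_o F o = F None + \sum_k F (Some k).
Proof.
rewrite (bigD1 None) //=; congr (_ + _); rewrite (reindex_omap Some id) /=; last by case.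
by apply: eq_bigl => k; rewrite eqxx.
Qed.

Lemma prodEFin (I : Type) (r : seq I) (Q : pred I) (F : I -> R) :
  (\prod_(i <- r | Q i) (F i)%:E)%E = (\prod_(i <- r | Q i) F i)%:E.
Proof. by symmetry; exact: (big_morph EFin (fun _ _ => EFinM _ _) erefl). Qed.

Variable N : T -> R -> Omega -> nat.
Hypothesis N_poisson : forall k, is_poisson_process P (N k).
Variable G0 : set (set Omega).
Hypothesis N_indep : mutually_independent P (fun o : option T =>
  match o with
  | None => G0
  | Some k => sigma_of [set t : R | 0 <= t] (N k)
  end).

(** The elapsed clocks follow the word [a] over the grid of step [h]: during
    the [j]-th cell only the clock [a j] rings, and it rings once; the letter
    [None] stands for a silent cell. *)
Definition word_event (h : R) m (a : m.-tuple (option T)) : set Omega :=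
  [set w | forall (j : 'I_m) k,
    (N k (h * j.+1%:R) w - N k (h * j%:R) w)%N = (tnth a j == Some k)].

(** All clocks stay silent, or one of them rings once: these are the Poisson
probabilities [exp (- h)] and [h exp (- h)], multiplied over the clocks. *)
Definition letter_prob (h : R) (o : option T) : R :=
  expR (- h) ^+ #|T| * (if o is Some _ then h else 1).

Lemma poisson_letter h o : 0 < h ->
  \prod_k poisson_pmf h (o == Some k) = letter_prob h o.
Proof.
move=> h0; transitivity (\prod_k (expR (- h) * (if o == Some k then h else 1))).
  apply: eq_bigr => k _; rewrite /poisson_pmf h0 mulrC; congr (_ * _).
  by case: eqP => _; rewrite ?fact0 ?invr1 ?expr0 ?expr1 ?mulr1.
rewrite big_split /= prodr_const; congr (_ * _); case: o => [z|]; last first.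
  by rewrite big1// => k _.
rewrite (bigD1 z) //= eqxx big1 ?mulr1// => k kz.
by rewrite (inj_eq Some_inj) eq_sym (negbTE kz).
Qed.

Lemma sigma_of_increment k (s t : R) b : 0 <= s -> 0 <= t ->
  sigma_of [set t : R | 0 <= t] (N k) [set w | (N k t w - N k s w)%N = b].
Proof.
move=> s0 t0; pose U := g_sigma_algebraType
  (\bigcup_(i in [set t : R | 0 <= t]) preimage_set_system setT (N k i) measurable).
have gen x (C : set nat) : 0 <= x -> (measurable : set (set U)) (N k x @^-1` C).
  move=> x0; apply: sub_sigma_algebra; exists x => //; exists C => //.
  by rewrite setTI.
have -> : [set w | (N k t w - N k s w)%N = b] =
    \bigcup_c ((N k s @^-1` [set c]) `&` (N k t @^-1` [set x | (x - c)%N = b])).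
  by apply/seteqP; split => [w /= H|w [c _ [/= <- ]]//]; exists (N k s w).
have : (measurable : set (set U)) (\bigcup_c
    ((N k s @^-1` [set c]) `&` (N k t @^-1` [set x | (x - c)%N = b]))).
  by apply: bigcupT_measurable => c; apply: measurableI; exact: gen.
by [].
Qed.

Lemma sigma_ofI (I : Type) (D : set I) (X : I -> Omega -> nat) (J : finType)
    (A : J -> set Omega) :
  (forall j, sigma_of D X (A j)) -> sigma_of D X [set w | forall j, A j w].
Proof.
move=> mA; pose U := g_sigma_algebraType
  (\bigcup_(i in D) preimage_set_system setT (X i) measurable).
have : (measurable : set (set U)) (\bigcap_(j in [set: J]) A j).
  by apply: fin_bigcap_measurable => // j _; exact: mA.
congr (_ _); apply/seteqP; split => w /= H j; first exact: H.
by move=> _; exact: H.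
Qed.

Lemma grid_ge0 (h : R) (j : nat) : 0 < h -> 0 <= h * j%:R.
Proof. by move=> h0; rewrite mulr_ge0// ltW. Qed.

(** Independence is used first between the clocks and then between the increments
of each clock; regrouping the product by cells gives one factor per letter. *)
Lemma prob_word_event (h : R) m (a : m.-tuple (option T)) : 0 < h ->
  P (word_event h a) = (\prod_(o <- a) letter_prob h o)%:E.
Proof.
move=> h0.
pose A k (j : 'I_m) := [set w |
  (N k (h * j.+1%:R) w - N k (h * j%:R) w)%N = (tnth a j == Some k)].
pose B o := if o is Some k then [set w | forall j, A k j w] else setT.
have -> : word_event h a = \bigcap_(o in [set` [set o | o != None]%SET]) B o.
  apply/seteqP; split => [w wa [k|]//= _ j|w wB j k]; first exact: wa.
  by have /(_ _ j) := wB (Some k); apply; rewrite /= inE.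
rewrite (N_indep (J := [set o | o != None]%SET) (A := B)); last first.
  move=> [k|]; rewrite inE// => _ /=; apply: sigma_ofI => j.
  by apply: sigma_of_increment; exact: grid_ge0.
have PB k : P (B (Some k)) = (\prod_(j < m) poisson_pmf h (tnth a j == Some k))%:E.
  have [_ _ _ _ incr indep] := N_poisson k.
  have mono j : h * j%:R <= h * j.+1%:R by rewrite ler_pM2l// ler_nat.
  have -> : B (Some k) = \bigcap_(j in [set` [set: 'I_m]%SET]) A k j.
    apply/seteqP; split => w /= H j; first by move=> _; exact: H.
    by apply: H; rewrite /= inE.
  rewrite (indep m (fun j => h * j%:R) (grid_ge0 0 h0) mono [set: 'I_m]%SET (A k)).
    rewrite -prodEFin; apply: eq_big => [j|j _]; first by rewrite inE.
    rewrite /A incr ?grid_ge0//; last by rewrite ltr_pM2l// ltr_nat.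
    by rewrite -mulrBr -natrB// subSnn mulr1.
  move=> j _; exists [set (tnth a j == Some k : nat)] => //.
  by apply/seteqP; split => w //= -[].
pose v (o : option T) : R :=
  if o is Some k then \prod_(j < m) poisson_pmf h (tnth a j == Some k) else 1.
transitivity (\prod_(o in [set o | o != None]%SET) (v o)%:E)%E.
  by apply: eq_bigr => -[k|]; rewrite inE// => _; exact: PB.
rewrite prodEFin; congr (_%:E); under eq_bigl do rewrite inE.
rewrite prod_option /= exchange_big big_tuple.
by apply: eq_bigr => j _; exact: poisson_letter.
Qed.

Lemma measurable_word_event (h : R) m (a : m.-tuple (option T)) : 0 < h ->
  measurable (word_event h a).
Proof.
move=> h0; have -> : word_event h a = \bigcap_(j in [set: 'I_m]) \bigcap_(k in [set: T])
    [set w | (N k (h * j.+1%:R) w - N k (h * j%:R) w)%N = (tnth a j == Some k)].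
  apply/seteqP; split => [w H j _ k _|w H j k]; [exact: H|exact: (H j I k I)].
apply: fin_bigcap_measurable => // j _; apply: fin_bigcap_measurable => // k _.
have -> : [set w | (N k (h * j.+1%:R) w - N k (h * j%:R) w)%N = (tnth a j == Some k)] =
    \bigcup_c ((N k (h * j%:R) @^-1` [set c]) `&`
     (N k (h * j.+1%:R) @^-1` [set x | (x - c)%N = (tnth a j == Some k)])).
  by apply/seteqP; split => [w /= H|w [c _ [/= <- ]]//]; exists (N k (h * j%:R) w).
apply: bigcupT_measurable => c; apply: measurableI; rewrite -[X in measurable X]setTI;
  by apply: (poisson_measurable (N_poisson k)) => //; exact: grid_ge0.
Qed.

Lemma word_event_uniq (h : R) m (a b : m.-tuple (option T)) w :
  word_event h a w -> word_event h b w -> a = b.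
Proof.
move=> wa wb; apply: eq_from_tnth => j.
have ab k : (tnth a j == Some k) = (tnth b j == Some k).
  have := wa j k; rewrite (wb j k); by case: (_ == _); case: (_ == _).
case aj : (tnth a j) => [k|]; first by have := ab k; rewrite aj eqxx => /esym/eqP.
case bj : (tnth b j) => [k|//]; by have := ab k; rewrite aj bj eqxx.
Qed.

(** Expectation over one cell, restricted to at most one ring.  The restriction
makes the operator send the constant 1 to a number less than 1. *)
Definition transfer (V : Type) (act : option T -> V -> V) (h : R) (phi : V -> R) (y : V) : R :=
  \sum_o letter_prob h o * phi (act o y).

Lemma sum_words (V : Type) (act : option T -> V -> V) (h : R) m (phi : V -> R) (y : V) :
  \sum_(a : m.-tuple (option T)) (\prod_(o <- a) letter_prob h o) *
     phi (foldl (fun y o => act o y) y a) = iter m (transfer act h) phi y.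
Proof.
elim: m y => [|m IH] y.
  rewrite (big_pred1 [tuple]) /=; last by move=> a; apply/esym/eqP; exact: tuple0.
  by rewrite big_nil mul1r.
rewrite iterS /transfer.
rewrite (reindex (fun p : option T * m.-tuple (option T) => cons_tuple p.1 p.2)) /=; last first.
  exists (fun a => (thead a, [tuple of behead a])).
    by case=> o a _ /=; congr pair; apply: val_inj.
  by move=> a _ /=; rewrite [RHS]tuple_eta.
rewrite -(pair_bigA _ (fun (o : option T) (a : m.-tuple (option T)) => (\prod_(o' <- o :: a) letter_prob h o') *
     phi (foldl (fun y o => act o y) (act o y) a))) /=.
apply: eq_bigr => o _; rewrite -IH mulr_sumr; apply: eq_bigr => a _.
by rewrite big_cons mulrA.
Qed.

End words.

(** * Expectations along a partial partition *)

Section partition.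
Context {R : realType} {disp : measure_display} {Omega : measurableType disp}.
Variable P : probability Omega R.

Lemma expectation_step (I : finType) (E : I -> set Omega) (v p : I -> R) :
  (forall i, measurable (E i)) -> (forall i, P (E i) = (p i)%:E) ->
  (forall i, 0 <= v i) ->
  ('E_P[fun w => (\sum_i v i * \1_(E i) w)%R] = (\sum_i v i * p i)%R%:E)%E.
Proof.
move=> mE pE v0; rewrite unlock.
transitivity (\int[P]_w \sum_(i <- index_enum I) ((v i)%:E * (\1_(E i) w)%:E))%E.
  by apply: eq_integral => w _; rewrite -sumEFin.
rewrite ge0_integral_sum//.
- rewrite -sumEFin; apply: eq_bigr => i _; rewrite ge0_integralZl_EFin//.
  + rewrite integral_indic// setIT; by rewrite EFinM; congr (_ * _)%E; exact: pE.
  + by apply/measurable_EFinP; exact: measurable_indic.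
- move=> i; apply: measurable_funeM; by apply/measurable_EFinP; exact: measurable_indic.
- by move=> i w _; rewrite mule_ge0// lee_fin.
Qed.

(** Outside the union of the events the variable is only known to lie in [0, M];
replacing it there by 0 or by [M] gives step functions on both sides. *)
Lemma expectation_partition (I : finType) (E : I -> set Omega) (v p : I -> R)
    (X : Omega -> R) (M : R) :
  (forall i, measurable (E i)) -> (forall i, P (E i) = (p i)%:E) ->
  (forall i j w, E i w -> E j w -> i = j) ->
  (forall i, 0 <= v i) -> 0 <= M ->
  measurable_fun setT X -> (forall w, 0 <= X w) ->
  {ae P, forall w, (forall i, E i w -> X w = v i) /\ X w <= M} ->
  ((\sum_i v i * p i)%R%:E <= 'E_P[X] <=
   (\sum_i v i * p i + M * (1 - \sum_i p i))%R%:E)%E.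
Proof.
move=> mE pE dis v0 M0 mX X0 aeX.
pose E' (o : option I) := if o is Some i then E i else ~` (\bigcup_(i in [set: I]) E i).
have mU : measurable (\bigcup_(i in [set: I]) E i).
  by apply: fin_bigcup_measurable => // i _.
have mE' o : measurable (E' o) by case: o => [i|] /=; [exact: mE|exact: measurableC].
pose p' o := if o is Some i then p i else fine (P (E' None)).
have pE' o : P (E' o) = (p' o)%:E.
  by case: o => [i|] /=; [exact: pE|rewrite fineK ?fin_num_measure//; exact: (mE' None)].
pose v' (o : option I) := if o is Some i then v i else 0.
pose u' (o : option I) := if o is Some i then v i else M.
have stepE (c : option I -> R) w o : E' o w -> \sum_i c i * \1_(E' i) w = c o.
  move=> wo; rewrite (bigD1 o) //= big1 ?addr0 => [|i io].
    by rewrite indicE mem_set// mulr1.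
  rewrite indicE memNset ?mulr0// => wi; case/eqP: io.
  case: o i wo wi => [j|] [i|] //=; first by move=> wj wi; congr Some; exact: dis wi wj.
  - by move=> wj nU; exfalso; apply: nU; exists j.
  - by move=> nU wi; exfalso; apply: nU; exists i.
have cover w : exists o, E' o w.
  have [[i _ wi]|nU] := pselect ((\bigcup_(i in [set: I]) E i) w); first by exists (Some i).
  by exists None.
have total : p' None = 1 - \sum_i p i.
  have := expectation_step (v := fun=> 1) mE' pE' (fun=> ler01).
  have -> : (fun w => \sum_i 1 * \1_(E' i) w) = cst 1 :> (Omega -> R).
    by apply: funext => w; have [c wc] := cover w; rewrite (stepE (fun=> 1) w c wc).
  move=> H; have := etrans (esym H) (expectation_cst P 1).
  move=> -[]; rewrite sum_option /= mul1r => /(canRL (addrK _)) ->.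
  by congr (_ - _); apply: eq_bigr => i _; rewrite mul1r.
have mstep (c : option I -> R) : measurable_fun setT
    (fun w => \sum_(o : option I) c o * \1_(E' o) w : R).
  by apply: measurable_sum => o; apply: measurable_funM => //; exact: measurable_indic.
have step0 (c : option I -> R) w : (forall o, 0 <= c o) -> 0 <= \sum_(o : option I) c o * \1_(E' o) w :> R.
  by move=> c0; rewrite sumr_ge0// => o _; rewrite mulr_ge0.
have v'0 o : 0 <= v' o by case: o.
have u'0 o : 0 <= u' o by case: o.
have <- : \sum_o v' o * p' o = \sum_i v i * p i by rewrite sum_option /= mul0r add0r.
have <- : \sum_o u' o * p' o = \sum_o v' o * p' o + M * (1 - \sum_i p i).
  by rewrite !sum_option mul0r add0r -total addrC.
rewrite -!(expectation_step mE' pE')//; apply/andP; split; apply: expectation_le => //;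
  try by move=> w; exact: step0.
- apply: filterS aeX => w [wX _]; have [c wc] := cover w; rewrite (stepE v' w c wc).
  by case: c wc => [i /wX ->|].
- apply: filterS aeX => w [wX wM]; have [c wc] := cover w; rewrite (stepE u' w c wc).
  by case: c wc => [i /wX ->|].
Qed.

End partition.

(** * Expected power spectrum of the discretised process *)

Section discretised_process.
Context {R : realType} {d n : nat}.
Hypothesis n3 : (2 < n)%N.
Hypothesis d1 : (1 <= d)%N.

Let K : R := #|torus d n|%:R.
Let Kn : K = (n ^ d)%:R. Proof. by rewrite /K card_torus. Qed.
Let K0 : 0 < K.
Proof. by rewrite Kn ltr0n expn_gt0 (ltn_trans _ n3). Qed.

Definition unit_mass (x : torus d n) : R := (x == origin d n)%:R.

Lemma power_unit_mass k : power unit_mass k = 1.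
Proof.
have gen (chi : 'Z_n -> R) : \sum_x unit_mass x * chi (dot k x) = chi 0.
  rewrite (bigD1 (origin d n)) //= big1 ?addr0 => [|x xo].
    by rewrite /unit_mass eqxx mul1r dot0.
  by rewrite /unit_mass (negbTE xo) mul0r.
by rewrite /power /cos_coef /sin_coef !gen cos_char0 sin_char0 expr1n expr0n addr0.
Qed.

Variable h : R.
Hypothesis h0 : 0 < h.

(** The probability of at most one ring in a cell of length [h]. *)
Definition cell_prob : R := expR (- h) ^+ #|torus d n| * (1 + h * K).

Let tau : R := h / (1 + h * K).
Let hK0 : 0 < 1 + h * K. Proof. by rewrite ltr_wpDr// mulr_ge0 ?ltW. Qed.
Let T := transfer (@act R d n) h.

(** One cell performs, up to the factor [cell_prob], one step of the recursion
with [tau = h / (1 + h K)]: conditionally on at most one ring, [tau] is the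
probability that a given clock rings. *)
Lemma transfer_power k y : T (fun y => power y k) y =
  cell_prob * ((1 - 2 * tau * symbol k) * power y k +
    tau * (K^-1 * \sum_q symbol q ^+ 2 * power y q)).
Proof.
have alg (E a b l p S : R) : 1 + a * b != 0 -> b != 0 ->
    E * p + E * a * ((b - 2 * l) * p + b^-1 * S) = E * (1 + a * b) *
    ((1 - 2 * (a / (1 + a * b)) * l) * p + a / (1 + a * b) * (b^-1 * S)).
  by move=> h1 h2; field; rewrite h1 h2.
rewrite /T /transfer sum_option /= /letter_prob mulr1 -mulr_sumr.
rewrite sum_power_smooth// -Kn /cell_prob /tau.
by apply: alg; rewrite gt_eqF.
Qed.

Lemma transfer_sum (I : finType) (c : I -> R) (phi : I -> (torus d n -> R) -> R) m y :
  iter m T (fun y => \sum_i c i * phi i y) y = \sum_i c i * iter m T (phi i) y.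
Proof.
elim: m y => [//|m IH] y; rewrite iterS {1}/T /transfer.
under eq_bigr do rewrite IH mulr_sumr.
rewrite exchange_big; apply: eq_bigr => i _.
have -> : iter m.+1 T (phi i) y = \sum_o letter_prob h o * iter m T (phi i) (act o y).
  by rewrite iterS {1}/T.
by rewrite mulr_sumr; apply: eq_bigr => o _; rewrite mulrCA.
Qed.

Lemma iter_transfer_power m k :
  iter m T (fun y => power y k) unit_mass =
  cell_prob ^+ m * spectrum symbol tau m k.
Proof.
elim: m k => [|m IH] k; first by rewrite /= power_unit_mass mulr1.
pose A q : R := cell_prob * ((1 - 2 * tau * symbol k) * (q == k)%:R +
    tau * (K^-1 * symbol q ^+ 2)).
have TE : T (fun y => power y k) = (fun y => \sum_q A q * power y q).
  apply: funext => y; rewrite transfer_power.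
  have -> : (1 - 2 * tau * symbol k) * power y k =
      \sum_q (1 - 2 * tau * symbol k) * (q == k)%:R * power y q.
    rewrite (bigD1 k) //= eqxx mulr1 big1 ?addr0// => q /negbTE ->.
    by rewrite mulr0 mul0r.
  rewrite !mulr_sumr -big_split mulr_sumr; apply: eq_bigr => q _ /=; rewrite /A; ring.
rewrite iterSr TE transfer_sum; under eq_bigr do rewrite IH.
have -> : spectrum symbol tau m.+1 k = \sum_q ((1 - 2 * tau * symbol k) * (q == k)%:R +
    tau * (K^-1 * symbol q ^+ 2)) * spectrum symbol tau m q.
  rewrite /= -/K; have -> : (1 - 2 * tau * symbol k) * spectrum symbol tau m k =
      \sum_q (1 - 2 * tau * symbol k) * (q == k)%:R * spectrum symbol tau m q.
    rewrite (bigD1 k) //= eqxx mulr1 big1 ?addr0// => q /negbTE ->.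
    by rewrite mulr0 mul0r.
  by rewrite !mulr_sumr -big_split; apply: eq_bigr => q _ /=; ring.
by rewrite mulr_sumr; apply: eq_bigr => q _; rewrite /A (exprS cell_prob); ring.
Qed.

Lemma iter_transfer_one m y : iter m T (fun=> 1) y = cell_prob ^+ m.
Proof.
elim: m y => [//|m IH] y; rewrite iterS {1}/T /transfer.
under eq_bigr do rewrite IH; rewrite -mulr_suml exprS; congr (_ * _).
rewrite sum_option /= /letter_prob -mulr_sumr mulr1 sumr_const.
by rewrite -[h *+ _]mulr_natr -[X in X + _]mulr1 -mulrDr.
Qed.

Lemma cell_prob_le1 : 0 <= cell_prob <= 1.
Proof.
rewrite /cell_prob mulr_ge0 ?exprn_ge0 ?expR_ge0 ?(ltW hK0)//=.
rewrite -expRM_natr mulNr expRN mulrC ler_pdivrMr ?expR_gt0// mul1r.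
exact: expR_ge1Dx.
Qed.

(** Two rings in a cell have a probability of second order in its length. *)
Lemma cell_prob_ge m : h * K <= 1 -> 1 - m%:R * (h * K) ^+ 2 <= cell_prob ^+ m.
Proof.
move=> hK1; have hK : 0 <= h * K by rewrite mulr_ge0 ?ltW.
apply: le_trans (@bernoulli_le _ ((h * K) ^+ 2) m _) _.
  by rewrite sqr_ge0 exprn_ile1.
apply: ler_expn; first by rewrite subr_ge0 exprn_ile1.
rewrite /cell_prob; have -> : 1 - (h * K) ^+ 2 = (1 - h * K) * (1 + h * K) by ring.
rewrite ler_wpM2r// ?(ltW hK0)// -expRM_natr mulNr.
exact: expR_ge1Dx.
Qed.

Lemma act_unit_interval (o : option (torus d n)) (y : torus d n -> R) :
  (forall x, 0 <= y x <= 1) -> forall x, 0 <= act o y x <= 1.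
Proof.
case: o => [z|]// y01 x; rewrite /= /smooth; case: eqP => // _.
rewrite /neighbor_average neighbor_sum//.
have dd : 0 < (2 * d)%:R :> R by rewrite ltr0n muln_gt0.
apply/andP; split.
  apply: mulr_ge0; first by rewrite invr_ge0 ltW.
  apply: sumr_ge0 => l _; apply: addr_ge0.
    by have /andP[] := y01 (coord_shift l 1 z).
  by have /andP[] := y01 (coord_shift l (-1) z).
rewrite mulrC ler_pdivrMr// mul1r natrM mulr_natr.
have -> : 2 *+ d = \sum_(l < d) 2 :> R by rewrite sumr_const card_ord.
apply: ler_sum => l _.
have /andP[_ ?] := y01 (coord_shift l 1 z); have /andP[_ ?] := y01 (coord_shift l (-1) z).
lra.
Qed.

Lemma power_le (y : torus d n -> R) k : (forall x, 0 <= y x <= 1) -> power y k <= 2 * K ^+ 2.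
Proof.
move=> y01; have gen (chi : 'Z_n -> R) : (forall z, `|chi z| <= 1) ->
    (\sum_x y x * chi (dot k x)) ^+ 2 <= K ^+ 2.
  move=> chi1; rewrite -real_normK ?num_real//; apply: ler_expn => //.
  apply: le_trans (ler_norm_sum _ _ _) _.
  have -> : K = \sum_(x : torus d n) 1 by rewrite sumr_const.
  apply: ler_sum => x _; rewrite normrM; have /andP[y0 y1] := y01 x.
  by rewrite ger0_norm// mulr_ile1.
rewrite /power mulr2n mulrDl mul1r lerD//; apply: gen => z; [exact: cos_max|exact: sin_max].
Qed.

End discretised_process.

Section moments.
Context {R : realType} {d n : nat} {disp : measure_display} {Omega : measurableType disp}.
Variables (P : probability Omega R) (N : torus d n -> R -> Omega -> nat)
  (Y : R -> Omega -> torus d n -> R).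
Hypothesis n3 : (2 < n)%N.
Hypothesis d1 : (1 <= d)%N.
Hypothesis smoothing : is_smoothing_process P N Y.
Hypothesis start : starts_from_unit_mass Y.

Let K : R := #|torus d n|%:R.
Let K0 : 0 < K.
Proof. by rewrite /K card_torus// ltr0n expn_gt0 (ltn_trans _ n3). Qed.

Variable t : R.
Hypothesis t0 : 0 < t.

Let word_prob (m : nat) (a : m.-tuple (option (torus d n))) : R :=
  \prod_(o <- a) letter_prob (t / m%:R) o.

Let cell (m : nat) := t / m%:R.
Let cell_gt0 m : (0 < m)%N -> 0 < cell m.
Proof. by move=> m0; rewrite divr_gt0// ltr0n. Qed.

Let sum_word_prob m : \sum_(a : m.-tuple (option (torus d n))) word_prob a =
  @cell_prob R d n (cell m) ^+ m.
Proof.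
rewrite -(iter_transfer_one (cell m) m (@unit_mass R d n)) -sum_words.
by apply: eq_bigr => a _; rewrite mulr1.
Qed.

Let few_rings m : (0 < m)%N -> K * t <= m%:R ->
  1 - (K * t) ^+ 2 / m%:R <= @cell_prob R d n (cell m) ^+ m.
Proof.
move=> m0 mK; have mR : 0 < m%:R :> R by rewrite ltr0n.
have -> : (K * t) ^+ 2 / m%:R = m%:R * (cell m * K) ^+ 2.
  by rewrite /cell; field; rewrite gt_eqF.
by apply: cell_prob_ge; rewrite ?cell_gt0// /cell mulrAC ler_pdivrMr// mul1r mulrC.
Qed.

(** Almost surely the clocks follow some word once the cells are short enough:
the exceptional event for [m] cells has probability O(1/m).  This serves to
bound the configuration at time [t], which is only known along words. *)
Lemma word_event_ae :
  {ae P, forall w, exists m (a : m.-tuple (option (torus d n))),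
     (0 < m)%N /\ word_event N (cell m) a w}.
Proof.
pose bad m := ~` (\bigcup_(a in [set: m.+1.-tuple (option (torus d n))])
   word_event N (cell m.+1) a).
have mW m (a : m.+1.-tuple (option (torus d n))) : measurable (word_event N (cell m.+1) a).
  exact: (measurable_word_event (P := P) (clocks_poisson smoothing)) (cell_gt0 _).
have mbad m : measurable (bad m).
  by apply/measurableC/fin_bigcup_measurable => // a _; exact: mW.
exists (\bigcap_m bad m); split.
- exact: bigcap_measurable.
- apply/eqP; rewrite eq_le measure_ge0 andbT; apply/lee_addgt0Pr => e e0.
  rewrite add0e; pose m := Num.truncn (K * t + (K * t) ^+ 2 / e).
  have mgt : K * t + (K * t) ^+ 2 / e < m.+1%:R by exact: truncnS_gt.
  have Kt0 : 0 <= K * t by rewrite mulr_ge0 ?ltW.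
  have Ke0 : 0 <= (K * t) ^+ 2 / e by rewrite divr_ge0 ?sqr_ge0 ?ltW.
  apply: (@le_trans _ _ (P (bad m))).
    by apply: le_measure; rewrite ?inE//; [exact: bigcap_measurable|exact: bigcap_inf].
  have pE (a : m.+1.-tuple (option (torus d n))) :
      P (word_event N (cell m.+1) a) = (word_prob a)%:E.
    exact: (prob_word_event (P := P) (clocks_poisson smoothing)
      (clocks_independent smoothing)) (cell_gt0 (ltn0Sn m)).
  have uniq (a b : m.+1.-tuple (option (torus d n))) w :
      word_event N (cell m.+1) a w -> word_event N (cell m.+1) b w -> a = b.
    exact: word_event_uniq.
  have ae01 : {ae P, forall w,
      (forall a : m.+1.-tuple (option (torus d n)),
         word_event N (cell m.+1) a w -> \1_(bad m) w = 0 :> R) /\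
      \1_(bad m) w <= 1 :> R}.
    apply: aeW => w; split; last by rewrite indicE lern1 leq_b1.
    by move=> a wa; rewrite indicE memNset// => nU; apply: nU; exists a.
  have i0 w : 0 <= \1_(bad m) w :> R by [].
  have /andP[_] := expectation_partition (mW m) pE uniq
    (fun=> lexx 0) ler01 (measurable_indic (mbad m)) i0 ae01.
  rewrite expectation_indic// => /le_trans; apply; rewrite lee_fin sum_word_prob.
  rewrite big1 ?add0r ?mul1r => [|a _]; last by rewrite mul0r.
  have mR : 0 < m.+1%:R :> R by rewrite ltr0n.
  have fr : 1 - (K * t) ^+ 2 / m.+1%:R <= @cell_prob R d n (cell m.+1) ^+ m.+1.
    by apply: few_rings => //; lra.
  have : (K * t) ^+ 2 / m.+1%:R <= e.
    have : (K * t) ^+ 2 / e <= m.+1%:R by lra.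
    by rewrite ler_pdivrMr// => ?; rewrite ler_pdivrMr// [e * _]mulrC.
  by move: (_ / _) (cell_prob _ ^+ _) fr => x th *; lra.
- move=> w /= nw m _ [a _ wa]; apply: nw; exists m.+1, a; split => //.
Qed.

Lemma process_word_ae : {ae P, forall w, forall m (a : m.-tuple (option (torus d n))),
  (0 < m)%N -> word_event N (cell m) a w ->
  Y t w = foldl (fun y o => act o y) (@unit_mass R d n) a}.
Proof.
apply: filterS (smoothing_evolution smoothing) => w [ring_w still_w] m a m0 wa.
have T0 : 0 <= cell m * 0%:R by rewrite mulr0.
have TS j : cell m * j%:R <= cell m * j.+1%:R.
  by rewrite ler_pM2l ?cell_gt0// ler_nat.
have := path_word (Y := fun s => Y s w) (N := fun k s => N k s w)
  (fun k => poisson_nondecreasing (clocks_poisson smoothing k) w)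
  (fun k => poisson_right_continuous (clocks_poisson smoothing k) (w := w))
  ring_w still_w (T := fun j => cell m * j%:R) (a := a) T0 TS.
rewrite size_tuple mulr0 /cell divfK ?pnatr_eq0 -?lt0n//.
have -> : Y 0 w = @unit_mass R d n by apply: funext => k; rewrite start.
apply => j k jm; have := wa (Ordinal jm) k.
by rewrite (tnth_nth None).
Qed.

Lemma foldl_unit_interval (a : seq (option (torus d n))) :
  forall x, 0 <= foldl (fun y o => act o y) (@unit_mass R d n) a x <= 1.
Proof.
elim/last_ind: a => [|a o IH] x; first by rewrite /= /unit_mass ler0n lern1 leq_b1.
by rewrite foldl_rcons; exact: act_unit_interval.
Qed.

Lemma measurable_power k : measurable_fun setT (fun w => power (Y t w) k).
Proof.
have gen (chi : 'Z_n -> R) : measurable_fun setT (fun w => \sum_x Y t w x * chi (dot k x)).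
  apply: measurable_sum => x; apply: measurable_funM => //.
  exact: (smoothing_measurable smoothing) (ltW t0).
by apply: measurable_funD; apply: measurable_funX; exact: gen.
Qed.

(** On the words of length [m] the functional has the expectation given by the
recursion; the remaining event has probability at most [(K t) ^ 2 / m], and
there the functional is bounded because values stay in [0, 1]. *)
Lemma second_moment_bounds (c : torus d n -> R) m (tau F : R) : (forall k, 0 <= c k) ->
  (0 < m)%N -> K * t <= m%:R ->
  tau = cell m / (1 + cell m * K) ->
  F = \sum_k c k * spectrum symbol tau m k ->
  0 <= F /\
  (((1 - (K * t) ^+ 2 / m%:R) * F)%:E <=
     'E_P[fun w => (\sum_k c k * power (Y t w) k)%R] <=
   (F + (\sum_k c k * (2 * K ^+ 2)) * ((K * t) ^+ 2 / m%:R))%R%:E)%E.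
Proof.
move=> c0 m0 mK tauE FE; pose phi (y : torus d n -> R) := \sum_k c k * power y k.
have h0 := cell_gt0 m0.
pose M : R := \sum_k c k * (2 * K ^+ 2).
have phi0 y : 0 <= phi y.
  by apply: sumr_ge0 => k _; rewrite mulr_ge0// addr_ge0// sqr_ge0.
have M0 : 0 <= M by apply: sumr_ge0 => k _; rewrite mulr_ge0// mulr_ge0// sqr_ge0.
have phiM y : (forall x, 0 <= y x <= 1) -> phi y <= M.
  by move=> y01; apply: ler_sum => k _; rewrite ler_wpM2l// power_le.
pose v (a : m.-tuple (option (torus d n))) :=
  phi (foldl (fun y o => act o y) (@unit_mass R d n) a).
have mW (a : m.-tuple (option (torus d n))) : measurable (word_event N (cell m) a).
  exact: (measurable_word_event (P := P) (clocks_poisson smoothing)) h0.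
have pE (a : m.-tuple (option (torus d n))) :
    P (word_event N (cell m) a) = (word_prob a)%:E.
  exact: (prob_word_event (P := P) (clocks_poisson smoothing)
    (clocks_independent smoothing)) h0.
have uniq (a b : m.-tuple (option (torus d n))) w :
    word_event N (cell m) a w -> word_event N (cell m) b w -> a = b.
  exact: word_event_uniq.
have mX : measurable_fun setT (fun w => phi (Y t w)).
  by apply: measurable_sum => k; apply: measurable_funM => //; exact: measurable_power.
have aeX : {ae P, forall w, (forall a : m.-tuple (option (torus d n)),
    word_event N (cell m) a w -> phi (Y t w) = v a) /\ phi (Y t w) <= M}.
  apply: filterS2 word_event_ae process_word_ae => w [m' [a' [m'0 wa']]] fold_w.
  split; first by move=> a wa; rewrite /v (fold_w m a).
  by rewrite (fold_w m' a')//; apply: phiM; exact: foldl_unit_interval.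
have vpE : \sum_a v a * word_prob a = @cell_prob R d n (cell m) ^+ m * F.
  transitivity (iter m (transfer (@act R d n) (cell m)) phi (@unit_mass R d n)).
    by rewrite -sum_words; apply: eq_bigr => a _; rewrite mulrC.
  rewrite (transfer_sum (cell m) c (fun k y => power y k)) FE mulr_sumr.
  apply: eq_bigr => k _; rewrite mulrCA; congr (_ * _).
  by rewrite tauE; exact: iter_transfer_power.
have wp0 (a : m.-tuple (option (torus d n))) : 0 <= word_prob a.
  by rewrite -lee_fin -pE.
have vp0 : 0 <= \sum_a v a * word_prob a.
  by apply: sumr_ge0 => a _; rewrite mulr_ge0//; exact: phi0.
have th0 : 0 < @cell_prob R d n (cell m) ^+ m.
  apply: exprn_gt0; apply: mulr_gt0; first exact/exprn_gt0/expR_gt0.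
  by apply: ltr_wpDr => //; rewrite mulr_ge0 ?(ltW h0) ?(ltW K0).
have th1 : @cell_prob R d n (cell m) ^+ m <= 1.
  have := cell_prob_le1 (R := R) (d := d) n3 h0.
  by move=> /andP[cp0 cp1]; rewrite exprn_ile1.
have fr := few_rings m0 mK.
have /andP[] := expectation_partition mW pE uniq (fun a => phi0 _ : 0 <= v a) M0 mX
  (fun w => phi0 _) aeX.
rewrite sum_word_prob; move: vp0; rewrite vpE.
move: (cell_prob _ ^+ _) th0 th1 fr => th th0 th1 fr thF lo hi.
have F0 : 0 <= F by move: thF; rewrite pmulr_rge0.
split=> //; apply/andP; split.
  by apply: le_trans lo; rewrite lee_fin ler_wpM2r.
apply: le_trans hi _; rewrite lee_fin -/M; apply: lerD.
  by rewrite ler_piMl.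
by apply: ler_wpM2l => //; rewrite lerBlDr addrC -lerBlDr.
Qed.

End moments.

(** * Two-sided bounds on energy and variance *)

Section scales.
Context {R : realType}.

Lemma powR_half (t : R) (d b : nat) : 0 <= t ->
  t `^ (d%:R / 2 + b%:R) = Num.sqrt t ^+ (d + 2 * b).
Proof.
move=> t0; rewrite -powR_mulrn ?sqrtr_ge0// -powR12_sqrt// -powRrM; congr (_ `^ _).
by rewrite natrD natrM mulrDr mulrC; congr (_ + _); rewrite mulrA mulVf ?mul1r.
Qed.

Lemma profile_le_min (t n : R) (a : nat) : 0 < t -> 0 < n ->
  ((Num.sqrt t)^-1 + n^-1) ^+ a.+1 <=
  2 ^+ a.+1 / Num.min (Num.sqrt t ^+ a.+1) (n ^+ a.+1).
Proof.
move=> t0 n0; have s0 : 0 < Num.sqrt t by rewrite sqrtr_gt0.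
have si : 0 < (Num.sqrt t)^-1 by rewrite invr_gt0.
have ni : 0 < n^-1 by rewrite invr_gt0.
have [le|lt] := leP (Num.sqrt t ^+ a.+1) (n ^+ a.+1).
  rewrite -expr_div_n; apply: ler_expn; first by rewrite addr_ge0 ?ltW.
  have : n^-1 <= (Num.sqrt t)^-1.
    by move: le; rewrite lef_pV2 ?posrE// ler_pXn2r ?nnegrE ?(ltW s0) ?(ltW n0).
  lra.
rewrite -expr_div_n; apply: ler_expn; first by rewrite addr_ge0 ?ltW.
have : (Num.sqrt t)^-1 <= n^-1.
  by move/ltW: lt; rewrite lef_pV2 ?posrE// ler_pXn2r ?nnegrE ?(ltW s0) ?(ltW n0).
lra.
Qed.

(** From [1 / (1 - x) = 1 + x / (1 - x) <= exp (x / (1 - x))]; the quadratic loss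
vanishes as the cells shrink, since it is summed over [m] steps of size O(1/m). *)
Lemma one_sub_ge_expR (x : R) : 0 <= x <= 1 / 2 -> expR (- (x + 2 * x ^+ 2)) <= 1 - x.
Proof.
move=> /andP[x0 x1]; have y0 : 0 < 1 - x by lra.
apply: (@le_trans _ _ (expR (- (x / (1 - x))))).
  rewrite ler_expR lerN2 ler_pdivrMr//.
  have : 0 <= x ^+ 2 * (1 - 2 * x) by rewrite mulr_ge0 ?sqr_ge0//; lra.
  lra.
rewrite expRN -[leRHS]invrK lef_pV2 ?posrE ?invr_gt0 ?expR_gt0//.
apply: le_trans (expR_ge1Dx _); rewrite le_eqVlt; apply/orP; left; apply/eqP.
by field; rewrite gt_eqF.
Qed.

End scales.

Section asymptotics.
Context {R : realType} (d : nat).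
Hypothesis d1 : (1 <= d)%N.

Let p := d.-1.
Let a3 : R := 16384.
Let c : R := cos 1 ^+ 2 / d%:R.

(** As [mu <= 4] and the recursion runs for a time at least [t - 1], the factor
[exp 4] covers the missing unit of time; the powers of 2 convert the profile
into a minimum. *)
Definition upper_constant : R :=
  expR 4 * (energy_constant (kernel_constant (d := d)) c p * 2 ^+ p.+3 +
            variance_constant (kernel_constant (d := d)) c p * 2 ^+ p.+1).

(** The factor [exp (- 1)] pays for replacing powers by exponentials, and [1 / 2]
for the probability of the words. *)
Definition lower_constant : R :=
  expR (- 1) / 2 * Num.min (@mode_constant R d 0) (@mode_constant R d 1).

Let d0 : 0 < d%:R :> R. Proof. by rewrite ltr0n. Qed.
Let dp : d = p.+1. Proof. by rewrite /p prednK. Qed.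
Let cc0 : 0 < cos 1 ^+ 2 :> R. Proof. exact/exprn_gt0/cos1_gt0. Qed.
Let c0 : 0 < c. Proof. by rewrite divr_gt0. Qed.
Let c1 : c <= 1.
Proof.
rewrite ler_pdivrMr// mul1r; apply: (@le_trans _ _ 1); last by rewrite ler1n.
by rewrite exprn_ile1 ?cos_le1// ltW// cos1_gt0.
Qed.

Let kc0 : 0 < @kernel_constant R d.
Proof.
rewrite /kernel_constant; apply: ltr_wpDr; last by rewrite ltr0n.
apply: mulr_ge0 => //; apply: exprn_ge0; apply: divr_ge0; last exact: ltW.
exact: mulr_ge0.
Qed.

Let rc0 : 0 < renewal_constant (@kernel_constant R d) p.
Proof.
rewrite /renewal_constant; apply: mulr_gt0 => //; apply: ltr_wpDr => //.
by apply: mulr_ge0 => //; apply: mulr_ge0; [exact: ltW|exact: exprn_ge0].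
Qed.

Let ec0 : 0 < energy_constant (@kernel_constant R d) c p.
Proof.
by apply: mulr_gt0 => //; apply: divr_gt0 => //; apply: mulr_gt0 => //; exact: exprn_gt0.
Qed.

Let vc0 : 0 < variance_constant (@kernel_constant R d) c p.
Proof.
apply: mulr_gt0 => //; apply: mulr_gt0 => //.
by apply: divr_gt0 => //; apply: mulr_gt0 => //; exact: exprn_gt0.
Qed.

Lemma upper_constant_gt0 : 0 < upper_constant.
Proof.
rewrite /upper_constant; apply: mulr_gt0; first exact: expR_gt0.
by apply: addr_gt0; apply: mulr_gt0 => //; exact: exprn_gt0.
Qed.

Lemma mode_constant_gt0 b : 0 < @mode_constant R d b.
Proof.
apply: mulr_gt0; last exact: expR_gt0.
by apply: exprn_gt0; apply: divr_gt0 => //; exact: mulr_gt0.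
Qed.

Lemma lower_constant_gt0 : 0 < lower_constant.
Proof.
rewrite /lower_constant; apply: mulr_gt0.
  by rewrite divr_gt0 ?expR_gt0.
by rewrite lt_min !mode_constant_gt0.
Qed.

(** From this size on the correction [a3 / n ^ (d + 4)] is at most the spectral
gap, and [torus_kernel_mass] applies. *)
Definition size_threshold : nat :=
  maxn 17 (Num.truncn (a3 * d%:R / (2 * cos 1 ^+ 2))).+1.

Context {n : nat}.
Hypothesis n_large : (size_threshold <= n)%N.

Lemma size_ge16 : (16 <= n)%N.
Proof. by apply: leq_trans n_large; rewrite leq_max. Qed.

Let n6 : (6 <= n)%N. Proof. exact: leq_trans size_ge16. Qed.
Let n3 : (2 < n)%N. Proof. exact: leq_trans n6. Qed.
Let n0 : 0 < n%:R :> R. Proof. by rewrite ltr0n (leq_trans _ n6). Qed.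
Let n1 : 1 <= n%:R :> R. Proof. by rewrite ler1n (leq_trans _ n6). Qed.

Let lam1 : R := cycle_gap n / d%:R.
Let delta : R := a3 / n%:R ^+ (d + 4).
Let mu : R := 2 * lam1 - delta.
Let i0 := origin d n.
Let K : R := #|torus d n|%:R.
Let Kn : K = n%:R ^+ d. Proof. by rewrite /K card_torus// natrX. Qed.
Let K0 : 0 < K. Proof. by rewrite Kn exprn_gt0. Qed.

Lemma correction_le : delta <= lam1.
Proof.
apply: le_trans (spectral_gap_ge n6 d1); rewrite /delta.
have q0 : 0 < 2 * cos 1 ^+ 2 :> R by rewrite mulr_gt0.
have h : a3 <= 2 * cos 1 ^+ 2 / d%:R * n%:R.
  have : a3 * d%:R / (2 * cos 1 ^+ 2) <= n%:R.
    apply/ltW/(lt_le_trans (truncnS_gt _)); rewrite ler_nat.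
    by apply: leq_trans n_large; rewrite leq_max leqnn orbT.
  rewrite ler_pdivrMr// => h; rewrite mulrAC -(ler_pM2r d0) divfK ?gt_eqF//.
  by rewrite [leRHS]mulrC.
rewrite ler_pdivrMr ?exprn_gt0//; apply: le_trans h _.
rewrite -[leRHS]mulrA; apply: ler_wpM2l; first by rewrite divr_ge0// ltW.
rewrite -(ler_pM2l (_ : 0 < n%:R ^+ 2)) ?exprn_gt0// mulrA mulfV ?mul1r ?gt_eqF ?exprn_gt0//.
by rewrite -exprSr; apply: ler_weXn2l => //; rewrite addnC.
Qed.

Let l0 : 0 < lam1 := spectral_gap_gt0 n6 d1.

Let dl0 : 0 < delta.
Proof. by rewrite divr_gt0 ?exprn_gt0// /a3 ltr0n. Qed.

Let lam_le2 (k : torus d n) : symbol k <= 2 :> R := symbol_le2 d1 k.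

Let lam1_small : lam1 <= 2.
Proof.
have [k ks] := mem_first_shell (n := n) d1.
by rewrite -[lam1](symbol_first_shell n6 d1 ks).
Qed.

Let mu_ge : lam1 <= mu.
Proof.
have gen (x y : R) : y <= x -> x <= 2 * x - y by lra.
exact: gen correction_le.
Qed.
Let mu_lt : mu < 2 * lam1. Proof. by rewrite /mu ltrBlDr ltrDl. Qed.
Let mu_le4 : mu <= 4.
Proof.
have gen (x y : R) : y < 2 * x -> x <= 2 -> y <= 4 by lra.
exact: gen mu_lt lam1_small.
Qed.
Let mu_gt0 : 0 < mu. Proof. exact: lt_le_trans mu_ge. Qed.

Let lam_ge0 (k : torus d n) : 0 <= symbol k :> R.
Proof.
have [->|/(gap_le_symbol (R := R) n6 d1)] := eqVneq k i0.
  by rewrite symbol_origin.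
by apply: le_trans; exact: ltW.
Qed.

Section fixed_step.
Variables (t : R) (m : nat).
Hypothesis t_ge : 64 <= t.
(* The three terms make the quadratic loss of [one_sub_ge_expR] over [m] steps at
most 1, the time lost by the normalisation of [tau] at most 1, and [tau] at most
1/8. *)
Hypothesis m_ge : 32 * t ^+ 2 + t ^+ 2 * K + 8 * t <= m%:R.

Let h : R := t / m%:R.
Let tau : R := h / (1 + h * K).

Let t0 : 0 < t. Proof. by move: t_ge; lra. Qed.
Let t2 : 0 < t ^+ 2. Proof. exact: exprn_gt0. Qed.
Let t2K : 0 < t ^+ 2 * K. Proof. exact: mulr_gt0. Qed.
Let m0 : 0 < m%:R :> R.
Proof. by apply: lt_le_trans m_ge; rewrite !addr_gt0// mulr_gt0. Qed.
Let h0 : 0 < h. Proof. by rewrite divr_gt0. Qed.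
Let q0 : 0 < 1 + h * K. Proof. by rewrite addr_gt0// mulr_gt0. Qed.
Let tau0 : 0 < tau. Proof. by rewrite divr_gt0. Qed.
Let tau_h : tau <= h.
Proof. by rewrite ler_pdivrMr// ler_peMr ?(ltW h0)// lerDl mulr_ge0 ?ltW. Qed.
Let hm : h * m%:R = t. Proof. by rewrite divfK// gt_eqF. Qed.
Let tau8 : tau <= 1 / 8.
Proof.
apply: le_trans tau_h _; rewrite ler_pdivrMr//.
have gen (x y z w : R) : 0 < x -> 0 < y -> 32 * x + y + 8 * z <= w -> z <= 1 / 8 * w by lra.
exact: gen t2 t2K m_ge.
Qed.
Let tau4 : tau <= 1 / 4. Proof. by have := tau8; lra. Qed.
Let mu_tau : mu * tau <= 1 / 2.
Proof.
apply: (@le_trans _ _ (4 * (1 / 8))); last by lra.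
by apply: ler_pM => //; exact: ltW.
Qed.

(* The recursion runs for the time [tau m], which differs from [t] because cells
with two or more rings are discarded. *)
Let elapsed_le : tau * m%:R <= t.
Proof. by rewrite -hm ler_pM2r. Qed.

Let elapsed_ge : t - 1 <= tau * m%:R.
Proof.
have -> : tau * m%:R = t / (1 + h * K) by rewrite /tau mulrAC hm.
rewrite ler_pdivlMr//.
have hK : t * (h * K) <= 1.
  have -> : t * (h * K) = t ^+ 2 * K / m%:R by rewrite /h; field; rewrite gt_eqF.
  rewrite ler_pdivrMr// mul1r; apply: le_trans m_ge; rewrite addrAC lerDr.
  by rewrite addr_ge0 ?mulr_ge0 ?ltW.
have hK0 : 0 <= h * K by rewrite mulr_ge0 ?ltW.
have gen (a x : R) : 0 <= x -> a * x <= 1 -> (a - 1) * (1 + x) <= a by lra.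
exact: gen.
Qed.

(** Only the diagonal part of the recursion is kept. *)
Lemma spectrum_lower b :
  expR (-1) * \sum_(k | k != i0) symbol k ^+ b * expR (- (2 * symbol k * t)) <=
  \sum_(k | k != i0) symbol k ^+ b * spectrum (symbol (R := R)) tau m k.
Proof.
rewrite mulr_sumr; apply: ler_sum => k k0; rewrite mulrCA.
apply: ler_wpM2l; first exact: exprn_ge0.
apply: le_trans (spectrum_ge (symbol_origin d1) lam_le2 l0 (gap_le_symbol n6 d1)
  tau0 tau4 m k).
set x := 2 * tau * symbol k.
have x0 : 0 <= x by rewrite mulr_ge0// mulr_ge0// ltW.
have x1 : x <= 1 / 2.
  have : tau * symbol k <= 1 / 8 * 2 by apply: ler_pM => //; exact: ltW.
  have gen (y z : R) : y * z <= 1 / 8 * 2 -> 2 * y * z <= 1 / 2 by lra.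
  exact: gen.
have /one_sub_ge_expR xx : 0 <= x <= 1 / 2 by rewrite x0.
apply: (@le_trans _ _ (expR (- (x + 2 * x ^+ 2)) ^+ m)); last first.
  by apply: ler_expn => //; exact: expR_ge0.
rewrite -expRM_natr -expRD ler_expR mulNr -opprD lerN2 mulrDl addrC.
apply: lerD.
  have x4 : x ^+ 2 <= (4 * tau) ^+ 2.
    apply: ler_expn => //; rewrite /x mulrAC; apply: ler_wpM2r; first exact: ltW.
    have -> : 4 = 2 * 2 :> R by ring.
    by rewrite ler_pM2l.
  apply: (@le_trans _ _ (m%:R^-1 * m%:R)); last by rewrite mulVf ?gt_eqF.
  apply: ler_wpM2r; first exact: ltW.
  apply: (@le_trans _ _ (2 * (4 * h) ^+ 2)).
    apply: ler_wpM2l => //; apply: le_trans x4 _; apply: ler_expn.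
      by rewrite mulr_ge0// ltW.
    by rewrite ler_pM2l.
  have -> : 2 * (4 * h) ^+ 2 = 32 * t ^+ 2 / m%:R / m%:R by rewrite /h; field; rewrite gt_eqF.
  rewrite -[leRHS]mul1r ler_pM2r ?invr_gt0// ler_pdivrMr// mul1r; apply: le_trans m_ge.
  by rewrite -addrA lerDl addr_ge0 ?(ltW t2K)// mulr_ge0// ltW.
have -> : x * m%:R = 2 * symbol k * (tau * m%:R) by rewrite /x; ring.
by apply: ler_wpM2l => //; rewrite mulr_ge0.
Qed.

Let th := 1 - mu * tau.
Let th_pow : th ^+ m <= expR 4 * expR (- (mu * t)).
Proof.
rewrite -expRD; apply: (@le_trans _ _ (expR (- (mu * tau)) ^+ m)).
  apply: ler_expn; last exact: expR_ge1Dx.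
  have gen (x : R) : x <= 1 / 2 -> 0 <= 1 - x by lra.
  exact: gen mu_tau.
rewrite -expRM_natr ler_expR mulNr -mulrA.
apply: (@le_trans _ _ (- (mu * (t - 1)))).
  by rewrite lerN2 ler_pM2l.
have gen (x y : R) : x <= 4 -> - (x * (y - 1)) <= 4 - x * y by lra.
exact: gen mu_le4.
Qed.

Let profile_elapsed a : profile n%:R (tau * m%:R) ^+ a.+1 <=
  2 ^+ a.+1 / Num.min (Num.sqrt t ^+ a.+1) (n%:R ^+ a.+1).
Proof.
apply: le_trans (profile_le_min a t0 n0); apply: ler_expn.
  by apply: ltW; exact: profile_gt0.
have st : 0 < Num.sqrt t by rewrite sqrtr_gt0.
rewrite /profile lerD2r lef_pV2 ?posrE ?sqrtr_gt0//.
  by apply: ler_wsqrtr; rewrite -lerBlDl.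
by rewrite ltr_wpDr// mulr_ge0// ltW.
Qed.

Lemma spectral_upper :
  spectral_energy (@symbol R d n) tau m <=
    upper_constant / Num.min (Num.sqrt t ^+ (d + 2)) (n%:R ^+ (d + 2)) * expR (- (mu * t)) /\
  spectral_variance i0 (@symbol R d n) tau m <=
    upper_constant / Num.min (Num.sqrt t ^+ d) (n%:R ^+ d) * expR (- (mu * t)).
Proof.
have kd s : 0 <= s -> K^-1 * \sum_(k | k != i0) symbol k ^+ 2 *
    expR (- (s * (2 * symbol k - mu))) <= @kernel_constant R d * profile n%:R s ^+ p.+4.+1.
  move=> s0; have -> : p.+4.+1 = (d + 4)%N by rewrite addn4 dp.
  exact: torus_kernel_decay.
have cmu : c / n%:R ^+ 2 <= mu.
  apply: le_trans mu_ge; apply: le_trans (spectral_gap_ge n6 d1).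
  rewrite ler_pM2r ?invr_gt0 ?exprn_gt0// ler_pM2r ?invr_gt0//.
  by apply: ler_peMl; [exact: ltW|rewrite ler1n].
have c01 : 0 < c <= 1 by rewrite c0.
have km : K^-1 * \sum_(k | k != i0) symbol k ^+ 2 / (2 * symbol k - mu) <= 3 / 4.
  by apply: torus_kernel_mass => //; exact: size_ge16.
have minE0 a : 0 < Num.min (Num.sqrt t ^+ a) (n%:R ^+ a).
  by rewrite lt_min !exprn_gt0// sqrtr_gt0.
have gen (C : R) a : 0 <= C ->
    C * th ^+ m * profile n%:R (tau * m%:R) ^+ a.+1 <=
    expR 4 * (C * 2 ^+ a.+1) / Num.min (Num.sqrt t ^+ a.+1) (n%:R ^+ a.+1) *
    expR (- (mu * t)).
  move=> C0.
  have -> : expR 4 * (C * 2 ^+ a.+1) / Num.min (Num.sqrt t ^+ a.+1) (n%:R ^+ a.+1) *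
    expR (- (mu * t)) = C * (expR 4 * expR (- (mu * t))) *
      (2 ^+ a.+1 / Num.min (Num.sqrt t ^+ a.+1) (n%:R ^+ a.+1)) by ring.
  apply: ler_pM => //.
  - apply: mulr_ge0 => //; apply: exprn_ge0.
    have g (x : R) : x <= 1 / 2 -> 0 <= 1 - x by lra.
    exact: g mu_tau.
  - by apply: exprn_ge0; apply: ltW; exact: profile_gt0.
  - exact: ler_wpM2l.
have d2 : p.+3 = (d + 2)%N by rewrite addn2 dp.
split.
  apply: le_trans (spectral_energy_le (i0 := i0) (symbol_origin d1) lam_le2
    (symbol_mean n6) l0 (gap_le_symbol n6 d1) tau0 tau4 mu_ge mu_lt mu_tau n1 c01 cmu
    (ltW kc0) km kd m) _.
  apply: le_trans (gen _ _ (ltW ec0)) _; rewrite d2.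
  rewrite ler_pM2r ?expR_gt0// ler_pM2r ?invr_gt0// /upper_constant.
  by rewrite ler_pM2l ?expR_gt0// -d2 lerDl mulr_ge0 ?(ltW vc0)// exprn_ge0.
apply: le_trans (spectral_variance_le (i0 := i0) (symbol_origin d1) lam_le2
    (symbol_mean n6) l0 (gap_le_symbol n6 d1) tau0 tau4 mu_ge mu_lt mu_tau n1 c01 cmu
    (ltW kc0) km kd m) _.
apply: le_trans (gen _ _ (ltW vc0)) _; rewrite -dp.
rewrite ler_pM2r ?expR_gt0// ler_pM2r ?invr_gt0// /upper_constant.
by rewrite ler_pM2l ?expR_gt0// -dp lerDr mulr_ge0 ?(ltW ec0).
Qed.

End fixed_step.

Section process.
Context {disp : measure_display} {Omega : measurableType disp}.
Variables (P : probability Omega R) (N : torus d n -> R -> Omega -> nat)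
  (Y : R -> Omega -> torus d n -> R).
Hypothesis smoothing : is_smoothing_process P N Y.
Hypothesis start : starts_from_unit_mass Y.

Lemma energyE (w : Omega) t :
  energy (Y t w) = \sum_k (K ^- 2 * symbol k) * power (Y t w) k.
Proof.
rewrite energy_power// /K card_torus// mulr_sumr.
by apply: eq_bigr => k _; rewrite mulrA.
Qed.

Lemma varianceE (w : Omega) t :
  variance_functional (Y t w) = \sum_k (K ^- 2 * (k != i0)%:R) * power (Y t w) k.
Proof.
rewrite variance_power// /K card_torus// mulr_sumr big_mkcond.
by apply: eq_bigr => k _; case: (k != i0); rewrite ?mulr1// mulr0 mul0r.
Qed.

Lemma sum_energy (f : torus d n -> R) :
  \sum_k (K ^- 2 * symbol k) * f k = K^-1 * (K^-1 * \sum_k symbol k * f k).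
Proof.
rewrite mulrA -invfM -expr2 mulr_sumr.
by apply: eq_bigr => k _; rewrite mulrA.
Qed.

Lemma sum_variance (f : torus d n -> R) :
  \sum_k (K ^- 2 * (k != i0)%:R) * f k = K^-1 * (K^-1 * \sum_(k | k != i0) f k).
Proof.
rewrite mulrA -invfM -expr2 mulr_sumr [RHS]big_mkcond.
by apply: eq_bigr => k _; case: (k != i0); rewrite ?mulr1// mulr0 mul0r.
Qed.

Variable t : R.
Hypothesis t_ge : 64 <= t.
Let t0 : 0 < t. Proof. by apply: lt_le_trans t_ge; rewrite ltr0n. Qed.

(** The upper bound survives the limit of vanishing cell length without loss; for
the lower bound it is enough that words have probability at least [1 / 2]. *)
Lemma moment_limit (c' : torus d n -> R) (L U : R) :
  (forall k, 0 <= c' k) ->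
  (forall m, 32 * t ^+ 2 + t ^+ 2 * K + 8 * t <= m%:R ->
     let F := \sum_k c' k * spectrum symbol
                (t / m%:R / (1 + t / m%:R * K)) m k in 2 * L <= F /\ F <= U) ->
  (L%:E <= 'E_P[fun w => (\sum_k c' k * power (Y t w) k)%R] <= U%:E)%E.
Proof.
move=> c'0 FLU; pose M := \sum_k c' k * (2 * K ^+ 2).
have M0 : 0 <= M by apply: sumr_ge0 => k _; rewrite mulr_ge0// mulr_ge0// sqr_ge0.
have Kt0 : 0 <= K * t by rewrite mulr_ge0 ?ltW.
have fine_cells e : 0 < e -> exists m, [/\ (0 < m)%N,
    32 * t ^+ 2 + t ^+ 2 * K + 8 * t <= m%:R, K * t <= m%:R &
    (K * t) ^+ 2 / m%:R <= e].
  move=> e0; pose A := 32 * t ^+ 2 + t ^+ 2 * K + 8 * t.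
  have A0 : 0 <= A by rewrite !addr_ge0 ?mulr_ge0 ?sqr_ge0 ?(ltW t0) ?(ltW K0).
  have B0 : 0 <= (K * t) ^+ 2 / e by rewrite divr_ge0 ?sqr_ge0 ?ltW.
  exists (Num.truncn (A + K * t + (K * t) ^+ 2 / e)).+1.
  have := truncnS_gt (A + K * t + (K * t) ^+ 2 / e).
  set m := (Num.truncn _).+1 => mgt; split => //.
  - by apply: le_trans (ltW mgt); rewrite -/A -[leRHS]addrA lerDl addr_ge0.
  - by apply: le_trans (ltW mgt); rewrite [leRHS]addrAC lerDr addr_ge0.
  - rewrite ler_pdivrMr ?ltr0n// -ler_pdivrMl// [leLHS]mulrC.
    by apply: le_trans (ltW mgt); rewrite lerDr addr_ge0.
apply/andP; split.
  have [m [m0 mA mK m12]] := fine_cells (1 / 2) ltac:(lra).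
  have [LF _] := FLU m mA.
  have [F0 /andP[lo _]] := second_moment_bounds n3 d1 smoothing start t0 c'0 m0 mK erefl erefl.
  apply: le_trans lo; rewrite lee_fin.
  have gen (l f x : R) : 0 <= f -> 2 * l <= f -> x <= 1 / 2 -> l <= (1 - x) * f by nra.
  exact: gen F0 LF m12.
apply/lee_addgt0Pr => e e0; have e'0 : 0 < e / (M + 1) by rewrite divr_gt0// ltr_wpDl.
have [m [m0 mA mK me]] := fine_cells _ e'0.
have [_ FU] := FLU m mA.
have [F0 /andP[_ hi]] := second_moment_bounds n3 d1 smoothing start t0 c'0 m0 mK erefl erefl.
apply: le_trans hi _; rewrite -EFinD lee_fin; apply: lerD => //.
apply: (@le_trans _ _ (M * (e / (M + 1)))); first by rewrite ler_wpM2l.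
by rewrite mulrCA ler_piMr ?(ltW e0)// ler_pdivrMr ?ltr_wpDl// mul1r lerDl.
Qed.

Let volume : n%:R ^- d = K^-1. Proof. by rewrite Kn. Qed.

Lemma energy_bounds :
  ((lower_constant * n%:R ^- d / Num.min (Num.sqrt t ^+ (d + 2)) (n%:R ^+ (d + 2)) *
      expR (- (2 * lam1 * t)))%:E <=
   'E_P[fun w => energy (Y t w)] <=
   (upper_constant * n%:R ^- d / Num.min (Num.sqrt t ^+ (d + 2)) (n%:R ^+ (d + 2)) *
      expR (- (mu * t)))%:E)%E.
Proof.
have -> : (fun w => energy (Y t w)) =
    (fun w => \sum_k (K ^- 2 * symbol k) * power (Y t w) k).
  by apply: funext => w; exact: energyE.
apply: moment_limit => [k|m mA F]; first by rewrite mulr_ge0 ?invr_ge0 ?sqr_ge0.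
have -> : F = K^-1 * spectral_energy (@symbol R d n) (t / m%:R / (1 + t / m%:R * K)) m.
  exact: sum_energy.
have [up _] := spectral_upper t_ge mA; rewrite volume; split; last first.
  have alg (u k v e : R) : u * k / v * e = k * (u / v * e) by ring.
  by rewrite [leRHS]alg ler_pM2l ?invr_gt0.
have low := spectrum_lower t_ge mA 1; have md := modes_ge n6 d1 1 t_ge.
set mn := Num.min _ _ in md *.
have mn0 : 0 < mn by rewrite lt_min !exprn_gt0// sqrtr_gt0.
have -> : spectral_energy (@symbol R d n) (t / m%:R / (1 + t / m%:R * K)) m =
    K^-1 * \sum_(k | k != i0) symbol k ^+ 1 *
      spectrum symbol (t / m%:R / (1 + t / m%:R * K)) m k.
  rewrite /spectral_energy (bigD1 i0)//= symbol_origin// mul0r add0r.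
  by congr (_ * _); apply: eq_bigr => k _; rewrite expr1.
have -> : 2 * (lower_constant * K^-1 / mn * expR (- (2 * lam1 * t))) =
    K^-1 * (expR (-1) * (Num.min (@mode_constant R d 0) (@mode_constant R d 1) *
      expR (- (2 * lam1 * t)) / mn)).
  rewrite /lower_constant; move: (Num.min (mode_constant _) _) => mc.
  by field; rewrite !gt_eqF.
rewrite ler_pM2l ?invr_gt0//.
apply: le_trans (ler_wpM2l (_ : 0 <= K^-1) low); last by rewrite invr_ge0 ltW.
rewrite [leRHS]mulrCA; apply: ler_wpM2l; first exact: expR_ge0.
apply: le_trans md; rewrite ler_pM2r ?invr_gt0// ler_pM2r ?expR_gt0//.
by rewrite ge_min lexx orbT.
Qed.

Lemma variance_bounds :
  ((lower_constant * n%:R ^- d / Num.min (Num.sqrt t ^+ d) (n%:R ^+ d) *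
      expR (- (2 * lam1 * t)))%:E <=
   'E_P[fun w => variance_functional (Y t w)] <=
   (upper_constant * n%:R ^- d / Num.min (Num.sqrt t ^+ d) (n%:R ^+ d) *
      expR (- (mu * t)))%:E)%E.
Proof.
have -> : (fun w => variance_functional (Y t w)) =
    (fun w => \sum_k (K ^- 2 * (k != i0)%:R) * power (Y t w) k).
  by apply: funext => w; exact: varianceE.
apply: moment_limit => [k|m mA F]; first by rewrite mulr_ge0 ?invr_ge0 ?sqr_ge0.
have -> : F = K^-1 * spectral_variance i0 (@symbol R d n) (t / m%:R / (1 + t / m%:R * K)) m.
  exact: sum_variance.
have [_ up] := spectral_upper t_ge mA; rewrite volume; split; last first.
  have alg (u k v e : R) : u * k / v * e = k * (u / v * e) by ring.
  by rewrite [leRHS]alg ler_pM2l ?invr_gt0.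
have low := spectrum_lower t_ge mA 0; have md := modes_ge n6 d1 0 t_ge.
rewrite muln0 addn0 in md.
set mn := Num.min _ _ in md *.
have mn0 : 0 < mn by rewrite lt_min !exprn_gt0// sqrtr_gt0.
have -> : spectral_variance i0 (@symbol R d n) (t / m%:R / (1 + t / m%:R * K)) m =
    K^-1 * \sum_(k | k != i0) symbol k ^+ 0 *
      spectrum symbol (t / m%:R / (1 + t / m%:R * K)) m k.
  by congr (_ * _); apply: eq_bigr => k _; rewrite expr0 mul1r.
have -> : 2 * (lower_constant * K^-1 / mn * expR (- (2 * lam1 * t))) =
    K^-1 * (expR (-1) * (Num.min (@mode_constant R d 0) (@mode_constant R d 1) *
      expR (- (2 * lam1 * t)) / mn)).
  rewrite /lower_constant; move: (Num.min (mode_constant _) _) => mc.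
  by field; rewrite !gt_eqF.
rewrite ler_pM2l ?invr_gt0//.
apply: le_trans (ler_wpM2l (_ : 0 <= K^-1) low); last by rewrite invr_ge0 ltW.
rewrite [leRHS]mulrCA; apply: ler_wpM2l; first exact: expR_ge0.
apply: le_trans md; rewrite ler_pM2r ?invr_gt0// ler_pM2r ?expR_gt0//.
by rewrite ge_min lexx.
Qed.

End process.

End asymptotics.

Theorem theorem2p6 (R : realType) (d : nat) (hd : (1 <= d)%N) :
  exists (a1 a2 a3 : R) (n0 : nat) (t0 : R),
    [/\ 0 < a1, 0 < a2, 0 < a3, (3 <= n0)%N & 0 < t0] /\
    forall (n : nat), odd n -> (n0 <= n)%N ->
    forall (disp : measure_display) (Omega : measurableType disp)
      (P : probability Omega R)
      (N : torus d n -> R -> Omega -> nat) (Y : R -> Omega -> torus d n -> R),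
      is_smoothing_process P N Y -> starts_from_unit_mass Y ->
    forall t : R, t0 <= t ->
      ((a1 * n%:R ^- d / Num.min (t `^ (d%:R / 2 + 1)) (n%:R ^+ (d + 2)) *
          expR (- (2 * cycle_gap n * d%:R^-1 * t)))%:E
        <= 'E_P[fun w => energy (Y t w)]
        <= (a2 * n%:R ^- d / Num.min (t `^ (d%:R / 2 + 1)) (n%:R ^+ (d + 2)) *
          expR (- ((2 * cycle_gap n * d%:R^-1 - a3 / n%:R ^+ (d + 4)) * t)))%:E)%E
      /\
      ((a1 * n%:R ^- d / Num.min (t `^ (d%:R / 2)) (n%:R ^+ d) *
          expR (- ((2 * cycle_gap n * d%:R^-1 + a3 / n%:R ^+ (d + 4)) * t)))%:E
        <= 'E_P[fun w => variance_functional (Y t w)]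
        <= (a2 * n%:R ^- d / Num.min (t `^ (d%:R / 2)) (n%:R ^+ d) *
          expR (- ((2 * cycle_gap n * d%:R^-1 - a3 / n%:R ^+ (d + 4)) * t)))%:E)%E.
Proof.
exists (@lower_constant R d), (@upper_constant R d), 16384, (@size_threshold R d), 64.
split.
  split; [exact: lower_constant_gt0|exact: upper_constant_gt0|by rewrite ltr0n| |by rewrite ltr0n].
  by rewrite /size_threshold leq_max.
move=> n _ n_large disp Omega P N Y smoothing start t t_ge.
have t0 : 0 <= t by apply: le_trans t_ge; rewrite ler0n.
have gE : 2 * cycle_gap n * d%:R^-1 = 2 * (cycle_gap n / d%:R) :> R by rewrite mulrA.
have sE : t `^ (d%:R / 2 + 1) = Num.sqrt t ^+ (d + 2) by exact: (powR_half d 1 t0).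
have sV : t `^ (d%:R / 2) = Num.sqrt t ^+ d.
  by have := powR_half d 0 t0; rewrite addr0 addn0.
rewrite gE sE sV; split; first exact: (energy_bounds hd n_large smoothing start t_ge).
have /andP[lo hi] := variance_bounds hd n_large smoothing start t_ge.
apply/andP; split => //; apply: le_trans lo; rewrite lee_fin.
have lc0 := @lower_constant_gt0 R d hd.
apply: ler_wpM2l.
  apply: divr_ge0; first by rewrite mulr_ge0 ?invr_ge0 ?exprn_ge0 ?(ltW lc0).
  by rewrite le_min !exprn_ge0 ?sqrtr_ge0.
rewrite ler_expR lerN2; apply: ler_wpM2r => //.
rewrite lerDl; apply: divr_ge0; [exact: ler0n|exact: exprn_ge0].
Qed.
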